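(* Let $n\ge2$, $x_0>0$, $K\ge0$ and $0\le K_2\le K$, and consider the contest with regret over future failure to stop described in the context, in which $M^i=\sup_{\tau^i\le t\le H_0^i}X^i_t$. Let $N=n+K(n-1)$ and, for $x\ge0$, $$F(x)=\min\Big\{\Big(\frac{x}{Nx_0}\Big)^{1/(N-1)},\,1\Big\}.$$ Then there exists a symmetric, atom-free Nash equilibrium in which, for every player $i$, $X^i_{\tau^i}$ has law $F$: that is, if every player $j\neq i$ uses a stopping time $\tau^j$ with $X^j_{\tau^j}\sim F$, then any admissible stopping time $\tau^i$ with $X^i_{\tau^i}\sim F$ maximizes player $i$'s expected payoff over all admissible stopping times of player $i$.
   Context: There are $n$ players $i\in\{1,\dots,n\}$. Player $i$ privately observes a Brownian motion $X^i$ with $X^i_0=x_0>0$, absorbed at $0$; the processes $X^1,\dots,X^n$ are independent. Let $\mathcal{F}^i_t=\sigma(X^i_s:s<t)$ and $H^i_0=\inf\{t\ge0:X^i_t=0\}$. An admissible strategy of player $i$ is an $(\mathcal{F}^i_t)$-stopping time $\tau^i\le H^i_0$. Players do not observe the other processes or stopping times. Given a random variable $M^i\ge X^i_{\tau^i}$ (here $M^i=\sup_{\tau^i\le t\le H^i_0}X^i_t$), player $i$'s payoff is $$\frac1k\mathbf 1_{\{X^i_{\tau^i}=\max_{j}X^j_{\tau^j}\}}-K\,\mathbf 1_{\{X^i_{\tau^i}<\max_{j\ne i}X^j_{\tau^j}<M^i\}}-K_2\,\mathbf 1_{\{X^i_{\tau^i}<\max_{j\ne i}X^j_{\tau^j}=M^i\}},$$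 where $k=|\{l:X^l_{\tau^l}=\max_jX^j_{\tau^j}\}|$. Each player maximizes her expected payoff. A Nash equilibrium is symmetric if all players' stopped values have the same law, and atom-free if that law has no atoms. *)

(* Defs.v *)
From HB Require Import structures.
From mathcomp Require Import all_boot all_order all_algebra.
From mathcomp Require Import all_classical all_reals all_analysis.
From mathcomp Require Import normal_distribution.
Set Implicit Arguments.
Unset Strict Implicit.
Unset Printing Implicit Defensive.
Import Order.TTheory GRing.Theory Num.Theory.
Import numFieldNormedType.Exports.

Local Open Scope classical_set_scope.
Local Open Scope ring_scope.

Section contest_defs.
Context {R : realType} {d : measure_display} {T : measurableType d}.

Definition preimage_sigma (Y : T -> R) : set (set T) :=
  [set S | exists A : set R, measurable A /\ S = Y @^-1` A].

(* mutual independence of a finite family of sigma-algebras (each containing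
   the whole space): product rule for any choice of one event per index *)
Definition indep_family (P : probability T R) (I : finType)
  (G : I -> set (set T)) : Prop :=
  forall A : I -> set T, (forall i, G i (A i)) ->
    P (\bigcap_(i in [set: I]) A i) = (\prod_(i : I) fine (P (A i)))%:E.

Definition brownian_from (P : probability T R) (x0 : R) (B : R -> T -> R) :
  Prop :=
  [/\ (forall t, 0 <= t -> measurable_fun setT (B t)),
      (forall w, B 0 w = x0),
      (forall w, {within [set t : R | 0 <= t], continuous (fun t : R => B t w)}) &
      (forall (k : nat) (tt : nat -> R), 0 <= tt 0%N ->
         (forall j, (j < k)%N -> tt j < tt j.+1) ->
         indep_family P (fun j : 'I_k =>
            preimage_sigma (fun w => B (tt j.+1) w - B (tt j) w)) /\
         (forall j : 'I_k, forall A : set R, measurable A ->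
            P ((fun w => B (tt j.+1) w - B (tt j) w) @^-1` A) =
            normal_prob 0 (Num.sqrt (tt j.+1 - tt j)) A))].

Definition absorbed_at0 (B X : R -> T -> R) : Prop :=
  forall t w, 0 <= t ->
    X t w = if `[< exists2 s, 0 <= s <= t & B s w = 0 >] then 0 else B t w.

Definition absorbed_BM (P : probability T R) (x0 : R) (X : R -> T -> R) :
  Prop := exists B, brownian_from P x0 B /\ absorbed_at0 B X.

Definition proc_sigma (X : R -> T -> R) : set (set T) :=
  <<s [set S | exists t (A : set R), 0 <= t /\ measurable A /\
                S = X t @^-1` A] >>.

Definition filt (X : R -> T -> R) (t : R) : set (set T) :=
  <<s [set S | exists s (A : set R), 0 <= s < t /\ measurable A /\
                S = X s @^-1` A] >>.

Definition H0 (X : R -> T -> R) (w : T) : \bar R :=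
  ereal_inf (EFin @` [set t | 0 <= t /\ X t w = 0]).

Definition admissible (X : R -> T -> R) (tau : T -> \bar R) : Prop :=
  [/\ (forall w, (0 <= tau w)%E),
      (forall w, (tau w <= H0 X w)%E) &
      (forall t, 0 <= t -> filt X t [set w | (tau w <= t%:E)%E])].

(* stopped value X_tau (on the null event {tau = +oo} we use the absorbed
   value 0) *)
Definition stopped (X : R -> T -> R) (tau : T -> \bar R) (w : T) : R :=
  match tau w with EFin r => X r w | _ => 0 end.

Definition Msup (X : R -> T -> R) (tau : T -> \bar R) (w : T) : \bar R :=
  ereal_sup ((fun t => (X t w)%:E) @`
     [set t | (tau w <= t%:E)%E /\ (t%:E <= H0 X w)%E]).

Definition payoff (n : nat) (K K2 : R) (i : 'I_n) (y : 'I_n -> R)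
  (m : \bar R) : R :=
  let ymax := \big[Num.max/y i]_(j : 'I_n) y j in
  (* max_{j <> i} y_j; the default y i is harmless: it only matters when
     y i >= all others, in which case y i < mo is false anyway *)
  let mo := \big[Num.max/y i]_(j : 'I_n | j != i) y j in
  let k := #|[set j : 'I_n | y j == ymax]| in
  (if y i == ymax then (k%:R)^-1 else 0)
  - K * (if (y i < mo) && (mo%:E < m)%E then 1 else 0)
  - K2 * (if (y i < mo) && (mo%:E == m) then 1 else 0).

Definition expected_payoff (P : probability T R) (n : nat) (K K2 : R)
  (X : 'I_n -> R -> T -> R) (tau : 'I_n -> T -> \bar R) (i : 'I_n) : \bar R :=
  (\int[P]_w (payoff K K2 i (fun j => stopped (X j) (tau j) w)
                         (Msup (X i) (tau i) w))%:E)%E.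

Definition Fcdf (N x0 : R) (x : R) : R :=
  if x < 0 then 0 else Num.min ((x / (N * x0)) `^ (N - 1)^-1) 1.

Definition has_law (P : probability T R) (X : R -> T -> R)
  (tau : T -> \bar R) (G : R -> R) : Prop :=
  forall x : R, P [set w | stopped X tau w <= x] = (G x)%:E.

End contest_defs.

(* Main.v *)
Require Import Defs.
From HB Require Import structures.
From mathcomp Require Import all_boot all_order all_algebra.
From mathcomp Require Import all_classical all_reals all_analysis.
From mathcomp Require Import normal_distribution measurable_realfun.
From mathcomp Require Import ring lra.
Set Implicit Arguments.
Unset Strict Implicit.
Unset Printing Implicit Defensive.
Import Order.TTheory GRing.Theory Num.Theory.
Import numFieldNormedType.Exports.
Local Open Scope classical_set_scope.
Local Open Scope ring_scope.

(** Let [c = N x0] and let [Y] be the best rival value; it is independent of player [i] and, when the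
    rivals use [F], has cdf [G x = min((x/c)^(1/(1+K)), 1)].  If player [i] stops at a value [x < y],
    optional stopping at the exit time from [0, y] shows that she would later have reached [y] with
    probability [x/y].  Hence, up to ties of probability zero, her expected payoff is the mean of
    [G x - K E (x/Y; x < Y)] at [x = X_sigma], and the power law is exactly the solution of
    [G x - K E (x/Y; x < Y) = min(x/c, 1)].  So the payoff equals [E min(X_sigma/c, 1)], which is at
    most [x0/c = 1/N] by the supermartingale property, with equality when [X_sigma] has law [F].

    The law [F] is embedded by stopping at the first time [X_t >= N I_t], where [I] is the running
    minimum.  Optional stopping between the first passages below [r] and [r' < r] bounds the decrease
    of [p r = P (I_tau <= r)] from both sides, and on geometric grids these bounds leave only
    [p r = (r/x0)^(1/(N-1))]. *)

(** * Integration and independence *)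

(** The constant [N] comes from N - 1 = (n - 1)(1 + K): the maximum of n - 1 rivals with exponent
    1/(N - 1) has exponent 1/(1 + K), the one required by the balance with weight K. Shared prizes
    and the [K2] term are handled by squeezing the payoff between two expressions that resolve all
    ties in the player's favour or against it; their expectations agree because the best rival value
    is atomless and independent of the whole path of player i. No probability conditional on X_sigma
    = x appears: at a fixed level y optional stopping gives y P(X_sigma < y <= M) = E(X_sigma;
    X_sigma < y), then y is randomised and Tonelli's theorem lets X_sigma be frozen instead. Since
    mass may escape as n grows in optional stopping at min(tau, n), equalities are passed to the
    limit only for bounded differences of two stopped values; otherwise Fatou's lemma gives an
    inequality, and the equality case reads its mean off the law [F]. Admissibility refers to the
    strict past, so the embedding time has to be recognised through left limits of the path. *)

Section pi_lambda.
Context {R : realType} {d : measure_display} {T : measurableType d}.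
Variable P : probability T R.

(** Pi-lambda argument: for fixed [E] the events obeying the product rule are closed under
    complement (the measure is finite) and countable disjoint union, so they form a Dynkin class
    containing the pi-system [G]. *)
Lemma indep_gen (G : set (set T)) (E : set T) :
  setI_closed G -> (forall A, G A -> measurable A) -> measurable E ->
  (forall A, G A -> P (A `&` E) = (P A * P E)%E) ->
  forall A, <<s G >> A -> measurable A /\ P (A `&` E) = (P A * P E)%E.
Proof.
move=> GI mG mE GE A; rewrite -setI_closed_g_dynkin_g_sigma_algebra//.
pose H := [set A | measurable A /\ P (A `&` E) = (P A * P E)%E].
apply: (@smallest_sub _ _ _ H); last by move=> B GB; split; [exact: mG|exact: GE].
split.
- by split => //; rewrite setTI probability_setT mul1e.
- move=> B [mB BE]; split; first exact: measurableC.
  have -> : ~` B `&` E = E `\` (B `&` E).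
    by rewrite setDIr setDv setU0 setDE setIC.
  rewrite measureD//; [|exact: measurableI|exact: (le_lt_trans (probability_le1 P mE) (ltry _))].
  have -> : E `&` (B `&` E) = B `&` E by rewrite setIC -setIA setIid.
  transitivity (P E - P B * P E)%E; first by rewrite -BE.
  rewrite probability_setC//.
  rewrite -[P B]fineK ?fin_num_measure// -[P E]fineK ?fin_num_measure//.
  by rewrite -EFinM -!EFinB -EFinM; congr EFin; ring.
- move=> F tF HF.
  have mF n : measurable (F n) by case: (HF n).
  split; first exact: bigcup_measurable.
  rewrite setI_bigcupl measure_bigcup//; last 2 first.
    by move=> n _; exact: measurableI.
    exact: trivIset_setIr.
  rewrite measure_bigcup//.
  rewrite -[P E]fineK ?fin_num_measure// muleC -nneseriesZl//; last first.
  apply: eq_eseriesr => n _; have [_ e] := HF n.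
  rewrite muleC fineK ?fin_num_measure//; exact: e.
Qed.

(* No measurability is needed: on nonnegative functions the integral is a supremum over the
   simple functions below. *)
Lemma le_integralT d' (S : measurableType d') (mu : {measure set S -> \bar R}) (f g : S -> \bar R) :
  (forall x, (f x <= g x)%E) -> (\int[mu]_x f x <= \int[mu]_x g x)%E.
Proof.
move=> fg.
have mono (u v : S -> \bar R) : (forall x, 0 <= u x)%E -> (forall x, (u x <= v x)%E) ->
    (\int[mu]_x u x <= \int[mu]_x v x)%E.
  move=> u0 uv; rewrite !ge0_integralTE//; last by move=> x; exact: le_trans (uv x).
  apply: ereal_sup_le => _ /= [h hu <-]; exists h => // x.
  exact: le_trans (uv x).
rewrite integralE [leRHS]integralE; apply: leeB; apply: mono => x.
- exact: funepos_ge0.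
- by rewrite !funeposE ge_max le_max fg/= le_max lexx orbT.
- exact: funeneg_ge0.
- by rewrite !funenegE ge_max le_max leeN2 fg/= le_max lexx orbT.
Qed.

End pi_lambda.

Section independent_pair.
Context {R : realType} {d d1 d2 : measure_display} {T : measurableType d}
  {S1 : measurableType d1} {S2 : measurableType d2}.
Variable P : probability T R.

Definition indep_rv (U : T -> S1) (V : T -> S2) :=
  forall A B, measurable A -> measurable B ->
    P (U @^-1` A `&` V @^-1` B) = (P (U @^-1` A) * P (V @^-1` B))%E.

(** On rectangles the law of the pair agrees with the product of the two laws, hence everywhere, and
    Tonelli's theorem integrates out [V] with [U] frozen. *)
Lemma indep_integral (U : T -> S1) (V : T -> S2) (f : S1 * S2 -> \bar R) :
  measurable_fun setT U -> measurable_fun setT V -> indep_rv U V ->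
  measurable_fun setT f -> (forall z, 0 <= f z)%E ->
  (\int[P]_w f (U w, V w) = \int[P]_w \int[P]_w' f (U w, V w'))%E.
Proof.
move=> mU mV UV mf f0.
pose U' : {mfun T >-> S1} := HB.pack U (isMeasurableFun.Build _ _ _ _ _ mU).
pose V' : {mfun T >-> S2} := HB.pack V (isMeasurableFun.Build _ _ _ _ _ mV).
have mW : measurable_fun setT (fun w => (U w, V w)) by exact/measurable_fun_pair.
pose W : {mfun T >-> (S1 * S2)%type} := HB.pack (fun w => (U w, V w)) (isMeasurableFun.Build _ _ _ _ _ mW).
transitivity (\int[distribution P W]_z f z)%E.
  by rewrite ge0_integral_distribution.
transitivity (\int[(distribution P U' \x distribution P V')%E]_z f z)%E.
  apply: eq_measure_integral => A mA _; apply/esym.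
  by apply: product_measure_unique => // B C mB mC; exact: UV.
rewrite fubini_tonelli1// ge0_integral_distribution//; last 2 first.
- exact: measurable_fun_fubini_tonelli_F.
- by move=> x; apply: integral_ge0.
apply: eq_integral => w _ /=; rewrite /fubini_F.
rewrite (@ge0_integral_distribution _ _ _ _ _ P V' (fun y => f (U' w, y)))//.
by apply: measurableT_comp => //; exact: measurable_pair1.
Qed.

Lemma indep_prob (U : T -> S1) (V : T -> S2) (E : set (S1 * S2)) :
  measurable_fun setT U -> measurable_fun setT V -> indep_rv U V -> measurable E ->
  P [set w | E (U w, V w)] = (\int[P]_w P [set w' | E (U w, V w')])%E.
Proof.
move=> mU mV UV mE.
have mW : measurable_fun setT (fun w => (U w, V w)) by exact/measurable_fun_pair.
have mWu (u : S1) : measurable_fun setT (fun w => (u, V w)).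
  by apply/measurable_fun_pair => //; exact: measurable_cst.
have H := @indep_integral U V (fun z => (\1_E z)%:E) mU mV UV.
have PE (g : T -> S1 * S2) : measurable_fun setT g ->
    P [set w | E (g w)] = (\int[P]_w (\1_E (g w))%:E)%E.
  move=> mg; have mgE : measurable (g @^-1` E).
    by rewrite -[X in measurable X]setTI; exact: mg.
  transitivity (\int[P]_w (\1_(g @^-1` E) w)%:E)%E.
    by rewrite integral_indic// setIT.
  by apply: eq_integral => w _; rewrite !indicE; congr (_%:R%:E); apply/idP/idP; rewrite !inE.
rewrite PE// H//; last exact/measurable_EFinP/measurable_indic.
by apply: eq_integral => w _; rewrite PE.
Qed.

End independent_pair.

Section equal_joint_law.
Context {R : realType} {d d1 d2 : measure_display} {T : measurableType d}
  {S1 : measurableType d1} {S2 : measurableType d2}.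
Variable P : probability T R.

(** For each frozen value of [U] the inner integrals agree. With [V'] the negative of a Brownian
    increment [V], this replaces conditional expectations given the past. *)
Lemma symmetric_integral (U : T -> S1) (V V' : T -> S2) (f : S1 * S2 -> \bar R) :
  measurable_fun setT U -> measurable_fun setT V -> measurable_fun setT V' ->
  indep_rv P U V -> indep_rv P U V' ->
  (forall A, measurable A -> P (V @^-1` A) = P (V' @^-1` A)) ->
  measurable_fun setT f -> (forall z, 0 <= f z)%E ->
  (\int[P]_w f (U w, V w) = \int[P]_w f (U w, V' w))%E.
Proof.
move=> mU mV mV' UV UV' VV' mf f0.
rewrite (indep_integral mU mV UV mf f0) (indep_integral mU mV' UV' mf f0); apply: eq_integral => w _.
pose V1 : {mfun T >-> S2} := HB.pack V (isMeasurableFun.Build _ _ _ _ _ mV).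
pose V2 : {mfun T >-> S2} := HB.pack V' (isMeasurableFun.Build _ _ _ _ _ mV').
have mfw : measurable_fun setT (fun y => f (U w, y)).
  by apply: measurableT_comp => //; exact: measurable_pair1.
transitivity (\int[distribution P V1]_y f (U w, y))%E.
  by rewrite ge0_integral_distribution.
transitivity (\int[distribution P V2]_y f (U w, y))%E; last first.
  by rewrite ge0_integral_distribution.
by apply: eq_measure_integral => A mA _; exact: VV'.
Qed.

End equal_joint_law.

Section density.
Context {R : realType} {d : measure_display} {T : measurableType d}.
Import HBNNSimple.

(** The standard passage from indicators to simple functions to monotone limits. It serves to
    rewrite Gaussian integrals, as [normal_prob] integrates its density. *)
Lemma ge0_integral_density (mu nu : {measure set T -> \bar R}) (g : T -> R) (f : T -> \bar R) :
  measurable_fun setT g -> (forall x, 0 <= g x) ->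
  (forall A, measurable A -> nu A = \int[mu]_(x in A) (g x)%:E)%E ->
  measurable_fun setT f -> (forall x, 0 <= f x)%E ->
  (\int[nu]_x f x = \int[mu]_x (f x * (g x)%:E))%E.
Proof.
move=> mg g0 nuE mf f0.
have indicE A : measurable A -> (\int[nu]_x (\1_A x)%:E = \int[mu]_x ((\1_A x)%:E * (g x)%:E))%E.
  move=> mA; rewrite integral_indic// setIT nuE// integral_mkcond.
  by apply: eq_integral => x _; rewrite patchE indicE; case: ifPn => _; rewrite ?mul1e ?mul0e.
have sfE (h : {nnsfun T >-> R}) : (\int[nu]_x (h x)%:E = \int[mu]_x ((h x)%:E * (g x)%:E))%E.
  under [LHS]eq_integral do rewrite fimfunE -fsumEFin//.
  rewrite [LHS]ge0_integral_fsum//; last 2 first.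
    - by move=> r; exact/measurable_EFinP/measurableT_comp.
    - by move=> n x _; rewrite EFinM nnfun_muleindic_ge0.
  under [RHS]eq_integral.
    move=> x xD; rewrite fimfunE -fsumEFin// muleC ge0_mule_fsumr; last first.
      by move=> r; rewrite EFinM nnfun_muleindic_ge0.
    over.
  rewrite [RHS]ge0_integral_fsum//; last 2 first.
    - move=> r; apply: emeasurable_funM; first exact/measurable_EFinP.
      exact/measurable_EFinP/measurableT_comp.
    - by move=> n x _; apply: mule_ge0; [rewrite lee_fin|rewrite EFinM nnfun_muleindic_ge0].
  apply: eq_fsbigr => r _.
  have [->|r0] := eqVneq r 0.
    by rewrite !integral0_eq// => x _; rewrite mul0r// mule0.
  have [rneg|r0'] := ltP r 0.
    by rewrite preimage_nnfun0// !integral0_eq// => x _; rewrite indic0 mulr0// mule0.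
  under eq_integral do rewrite EFinM.
  rewrite ge0_integralZl//; last exact/measurable_EFinP/measurable_indic.
  rewrite indicE// -ge0_integralZl//; last 2 first.
    - by apply: emeasurable_funM; [exact/measurable_EFinP/measurable_indic|exact/measurable_EFinP].
    - by move=> x _; rewrite mule_ge0 ?lee_fin.
  by apply: eq_integral => x _; rewrite -!EFinM; congr EFin; ring.
pose f_ := nnsfun_approx measurableT mf.
transitivity (limn (fun n => \int[nu]_x (f_ n x)%:E))%E.
  rewrite -monotone_convergence//=.
  - apply: eq_integral => x _; apply/esym/cvg_lim => //=.
    exact: cvg_nnsfun_approx.
  - by move=> n; exact/measurable_EFinP/measurable_funTS.
  - by move=> n ? _; rewrite lee_fin.
  - by move=> ? _ ? ? mn; rewrite lee_fin; exact/lefP/nd_nnsfun_approx.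
transitivity (limn (fun n => \int[mu]_x ((f_ n x)%:E * (g x)%:E)))%E.
  by congr (limn _); apply/funext => n; exact: sfE.
rewrite -monotone_convergence//=.
- apply: eq_integral => x _; apply/cvg_lim => //=.
  apply: cvgeZr => //; exact: cvg_nnsfun_approx.
- by move=> n; apply: emeasurable_funM; exact/measurable_EFinP/measurable_funTS.
- by move=> n x _; rewrite mule_ge0 ?lee_fin.
- move=> x _ m n mn; rewrite lee_pmul ?lee_fin//; exact/lefP/nd_nnsfun_approx.
Qed.

End density.

(** * Limits of expectations under an L2 bound *)

Section expectation_limit.
Context {R : realType} {d : measure_display} {T : measurableType d}.
Variable P : probability T R.

Lemma integrable_bounded (f : T -> R) (M : R) : measurable_fun setT f ->
  (forall w, `|f w| <= M) -> P.-integrable setT (EFin \o f).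
Proof.
move=> mf fM.
apply: (@le_integrable _ _ _ P setT measurableT _ (cst M%:E)) => //.
- exact/measurable_EFinP.
- by move=> x _ /=; rewrite lee_fin (le_trans (fM x))// ler_norm.
- exact: finite_measure_integrable_cst.
Qed.

Lemma integrable_L2 (f : T -> R) (C : R) : measurable_fun setT f ->
  (\int[P]_w ((f w) ^+ 2)%:E <= C%:E)%E -> P.-integrable setT (EFin \o f).
Proof.
move=> mf fC.
have mf2 : measurable_fun setT (fun w => (f w ^+ 2)%:E).
  by apply/measurable_EFinP; exact: measurable_funX.
have i2 : P.-integrable setT (fun w => (f w ^+ 2)%:E).
  apply/integrableP; split => //.
  under eq_integral do rewrite gee0_abs ?lee_fin ?sqr_ge0//.
  exact: le_lt_trans fC (ltry _).
apply: (@le_integrable _ _ _ P setT measurableT _ (fun w => 1%:E + (f w ^+ 2)%:E)%E) => //.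
- exact/measurable_EFinP.
- move=> x _; rewrite (_ : (1 + _)%E = (1 + f x ^+ 2)%:E)//= lee_fin [leRHS]ger0_norm; last first.
    by rewrite addr_ge0// sqr_ge0.
  rewrite -(real_normK (num_real (f x))); set a := `|f x|.
  have : 0 <= (a - 1) ^+ 2 by rewrite sqr_ge0.
  have : 0 <= a by rewrite /a.
  nra.
- by apply: integrableD => //; exact: finite_measure_integrable_cst.
Qed.

(* [x / (1 + (e x)^2)] is bounded and continuous and differs from [x] by at most [e x^2], so
   dominated convergence applies to it and an L2 bound controls the error. *)
Lemma truncation_bound (e x : R) : 0 < e ->
  `|x / (1 + (e * x) ^+ 2)| <= e^-1 /\
  `|x - x / (1 + (e * x) ^+ 2)| <= e * x ^+ 2.
Proof.
move=> e0; set D := 1 + _.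
have D0 : 0 < D by rewrite /D ltr_pwDl// sqr_ge0.
have exD : `|e * x| <= D.
  rewrite /D -(real_normK (num_real (e * x))); set a := `|_|.
  have : 0 <= (a - 1) ^+ 2 by rewrite sqr_ge0.
  have : 0 <= a by rewrite /a.
  nra.
split.
  rewrite normrM normfV (gtr0_norm D0) ler_pdivrMr// ler_pdivlMl//.
  by move: exD; rewrite normrM (gtr0_norm e0).
have -> : x - x / D = x * (e * x) ^+ 2 / D.
  by rewrite /D; field; rewrite -/D gt_eqF.
rewrite normrM normfV (gtr0_norm D0) ler_pdivrMr// normrM normrX.
rewrite [X in X <= _](_ : _ = (e * `|x| ^+ 2) * `|e * x|); last first.
  by rewrite normrM (gtr0_norm e0); ring.
rewrite real_normK ?num_real//.
by rewrite ler_wpM2l// mulr_ge0 ?sqr_ge0// ltW.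
Qed.

Lemma continuous_truncation (e : R) : continuous (fun x : R => x / (1 + (e * x) ^+ 2)).
Proof.
move=> x; apply: cvgM; first exact: cvg_id.
apply: cvgV; first by rewrite gt_eqF// ltr_pwDl// sqr_ge0.
apply: cvgD; first exact: cvg_cst.
rewrite expr2; under eq_fun do rewrite expr2.
by apply: cvgM; (apply: cvgM; [exact: cvg_cst|exact: cvg_id]).
Qed.

Lemma measurable_truncation (e : R) (f : T -> R) : measurable_fun setT f ->
  measurable_fun setT (fun w => f w / (1 + (e * f w) ^+ 2)).
Proof.
move=> mf; apply: (@measurableT_comp _ _ _ _ _ _ (fun x : R => x / (1 + (e * x) ^+ 2))) => //.
by apply: continuous_measurable_fun; exact: continuous_truncation.
Qed.

(** The error is linear in [e] with a factor depending only on the second moment, hence uniform over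
    a sequence bounded in L2. *)
Lemma truncation_expectation (f : T -> R) (C e : R) : 0 < e ->
  measurable_fun setT f -> (\int[P]_w ((f w) ^+ 2)%:E <= C%:E)%E ->
  (`| \int[P]_w (f w)%:E - \int[P]_w (f w / (1 + (e * f w) ^+ 2))%:E |
    <= (e * C)%:E)%E.
Proof.
move=> e0 mf fC.
have mt := measurable_truncation e mf.
rewrite -integralB_EFin//; last 2 first.
- exact: integrable_L2 fC.
- by apply: (@integrable_bounded _ e^-1) => // w; have [] := truncation_bound (f w) e0.
apply: (le_trans (le_abse_integral _ _ _)) => //.
  by apply/measurable_EFinP; exact: measurable_funB.
apply: (@le_trans _ _ (\int[P]_w (e%:E * ((f w) ^+ 2)%:E))%E).
  apply: le_integralT => w; rewrite -EFinB abse_EFin -EFinM lee_fin.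
  by have [] := truncation_bound (f w) e0.
rewrite ge0_integralZl//; last 3 first.
- by apply/measurable_EFinP; exact: measurable_funX.
- by move=> w _; rewrite lee_fin sqr_ge0.
- by rewrite lee_fin ltW.
by rewrite EFinM lee_pmul2l.
Qed.

(** Boundedness in L2 gives uniform integrability. The limit inherits the bound by Fatou's lemma;
    the bounded truncations converge by dominated convergence, and truncating costs at most [e * C]
    both along the sequence and at the limit. *)
Lemma expectation_L2_limit (V_ : nat -> T -> R) (V : T -> R) (a C : R) :
  (forall n, measurable_fun setT (V_ n)) ->
  (forall w, V_ n w @[n --> \oo] --> V w) ->
  (forall n, \int[P]_w ((V_ n w) ^+ 2)%:E <= C%:E)%E ->
  (forall n, \int[P]_w (V_ n w)%:E = a%:E)%E ->
  [/\ measurable_fun setT V, P.-integrable setT (EFin \o V) & (\int[P]_w (V w)%:E = a%:E)%E].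
Proof.
move=> mV_ cV VC Va.
have mV : measurable_fun setT V by apply: (measurable_fun_cvg mV_) => w _; exact: cV.
have V2 : (\int[P]_w ((V w) ^+ 2)%:E <= C%:E)%E.
  have sqc w : ((V_ n w) ^+ 2)%:E @[n --> \oo] --> ((V w) ^+ 2)%:E.
    apply: cvg_EFin; first exact: nearW.
    rewrite expr2; apply: cvg_trans; last exact: (cvgM (cV w) (cV w)).
    by apply: near_eq_cvg; apply: nearW => n /=; rewrite expr2.
  have -> : (\int[P]_w ((V w) ^+ 2)%:E = \int[P]_w limn_einf (fun n => ((V_ n w) ^+ 2)%:E))%E.
    by apply: eq_integral => w _; rewrite (cvg_limn_einf_sup (sqc w)).1.
  apply: le_trans (fatou _ _ _ _) _ => //.
  - by move=> n; apply/measurable_EFinP; exact: measurable_funX.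
  - by move=> n w _; rewrite lee_fin sqr_ge0.
  rewrite limn_einf_lim; apply: lime_le; first exact: is_cvg_einfs.
  apply: nearW => n; apply: le_trans (VC n).
  by rewrite /einfs; apply: ereal_inf_lbound; exists n => /=.
have iV := integrable_L2 mV V2.
split => //.
have [v vE] : exists v, (\int[P]_w (V w)%:E = v%:E)%E.
  by exists (fine (\int[P]_w (V w)%:E)); rewrite fineK//; exact: integrable_fin_num.
rewrite vE; congr EFin; apply/eqP; rewrite -subr_eq0 -normr_le0.
apply/ler_addgt0Pl => eta eta0; rewrite addr0.
have C0 : 0 <= C.
  by rewrite -lee_fin; apply: le_trans (VC 0%N); apply: integral_ge0 => w _; rewrite lee_fin sqr_ge0.
(* Makes the two truncation errors add up to at most [eta]; the [+ 1] covers [C = 0]. *)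
pose e := eta / (2 * (C + 1)).
have e0 : 0 < e by rewrite divr_gt0// mulr_gt0// ltr_wpDl.
have eC : 2 * (e * C) <= eta.
  rewrite /e [X in X <= _](_ : _ = eta * (C / (C + 1))); last first.
    by field; rewrite gt_eqF// ltr_wpDl.
  have CC : C / (C + 1) <= 1 by rewrite ler_pdivrMr ?mul1r ?ltr_wpDl ?lerDl.
  exact: (ler_piMr (ltW eta0)).
pose phi (x : R) := x / (1 + (e * x) ^+ 2).
have cphi w : phi (V_ n w) @[n --> \oo] --> phi (V w).
  exact: (cvg_comp (fun n => V_ n w) phi (cV w) (@continuous_truncation e (V w))).
have mphi n : measurable_fun setT (EFin \o (fun w => phi (V_ n w))).
  by apply/measurable_EFinP; exact: measurable_truncation.
have mphiV : measurable_fun setT (EFin \o (fun w => phi (V w))).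
  by apply/measurable_EFinP; exact: measurable_truncation.
have [_ _ dc] : [/\ P.-integrable setT (EFin \o (fun w => phi (V w))),
    [sequence \int[P]_w (`|(phi (V_ n w))%:E - (phi (V w))%:E|)]_n @ \oo --> 0%E &
    [sequence \int[P]_w ((phi (V_ n w))%:E)]_n @ \oo --> \int[P]_w ((phi (V w))%:E)]%E.
  apply: (@dominated_convergence _ _ _ P setT measurableT
    (fun n => EFin \o (fun w => phi (V_ n w))) _ (cst (e^-1)%:E)) => //.
  - by apply: aeW => w _; apply: cvg_EFin; [exact: nearW|exact: cphi].
  - exact: finite_measure_integrable_cst.
  - by apply: aeW => w n _ /=; rewrite lee_fin; have [] := truncation_bound (V_ n w) e0.
have iphi : P.-integrable setT (EFin \o (fun w => phi (V w))).
  by apply: (@integrable_bounded _ e^-1) => [|w]; [exact: measurable_truncation|have [] := truncation_bound (V w) e0].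
have [p pE] : exists p, (\int[P]_w (phi (V w))%:E = p%:E)%E.
  by exists (fine (\int[P]_w (phi (V w))%:E)); rewrite fineK//; exact: integrable_fin_num.
have vp : `|v - p| <= e * C.
  by have := truncation_expectation e0 mV V2; rewrite -/(phi _) vE pE -EFinB abse_EFin lee_fin.
have ap : `|a - p| <= e * C.
  rewrite -lee_fin -abse_EFin EFinB -pE.
  have : (`|a%:E - \int[P]_w (phi (V_ n w))%:E|)%E @[n --> \oo] --> (`|a%:E - \int[P]_w (phi (V w))%:E|)%E.
    by apply: cvg_abse; apply: cvgeB => //; exact: cvg_cst.
  move=> /cvg_lim <- //; apply: lime_le.
    by apply/cvg_ex; eexists; apply: cvg_abse; apply: cvgeB; [|exact: cvg_cst|exact: dc].
  by apply: nearW => n; rewrite -(Va n); exact: truncation_expectation.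
rewrite -(subrKA p); apply: (le_trans (ler_normD _ _)); apply: le_trans eC.
by rewrite mulr2n mulrDl !mul1r lerD// distrC.
Qed.

End expectation_limit.

(** * Continuous paths and hitting times *)

Section continuous_paths.
Context {R : realType}.
Implicit Types f : R -> R.

Definition path_continuous f := {within [set t : R | 0 <= t], continuous f}.

Lemma path_continuousP f : path_continuous f <->
  forall t e : R, 0 <= t -> 0 < e -> exists2 d : R, 0 < d &
    forall s : R, 0 <= s -> `|s - t| < d -> `|f s - f t| < e.
Proof.
rewrite /path_continuous subspace_continuousP; split.
- move=> cf t e t0 e0; have /cvgrPdist_lt/(_ e e0) := cf t t0.
  move=> /nbhs_ballP[d /= d0 H]; exists d => // s s0 st.
  by rewrite distrC; apply: H => //; rewrite /ball/= distrC.
- move=> H t t0; apply/cvgrPdist_lt => e e0.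
  have [d d0 K] := H t e t0 e0.
  apply/nbhs_ballP; exists d => //= s; rewrite /ball/= => st s0.
  by rewrite distrC; apply: K => //; rewrite distrC.
Qed.

Lemma path_continuous_itv f a b : 0 <= a -> path_continuous f ->
  {within `[a, b], continuous f}.
Proof.
move=> a0; apply: continuous_subspaceW => x /=; rewrite in_itv/= => /andP[ax _].
exact: le_trans ax.
Qed.

(** Entry time into a closed half-line after [s], infinite if there is none. Absorption, the exit
    from an interval, the passage below a level and the drawup time are all obtained from it by
    choosing [f], so attainment and measurability are proved once. *)
Definition hit (s : \bar R) f : \bar R :=
  ereal_inf (EFin @` [set t | [/\ 0 <= t, (s <= t%:E)%E & 0 <= f t]]).

Lemma hit_ge0 s f : (0 <= hit s f)%E.
Proof. by apply: le_ereal_inf_tmp => _ [t [t0 _ _] <-]; rewrite lee_fin. Qed.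

Lemma hit_ge s f : (s <= hit s f)%E.
Proof. by apply: le_ereal_inf_tmp => _ [t [_ st _] <-]. Qed.

Lemma hit_le s f t : 0 <= t -> (s <= t%:E)%E -> 0 <= f t -> (hit s f <= t%:E)%E.
Proof. by move=> t0 st ft; apply: ge_ereal_inf; exists t%:E => //; exists t. Qed.

Lemma hit_before s f t : 0 <= t -> (s <= t%:E)%E -> (t%:E < hit s f)%E -> f t < 0.
Proof. by move=> t0 st; apply: contraTT; rewrite -!leNgt; exact: hit_le. Qed.

(** A negative value at the infimum would persist on a neighbourhood by continuity, although times
    with [0 <= f t] lie arbitrarily close to it. *)
Lemma hit_attained s f r : path_continuous f -> hit s f = r%:E ->
  [/\ 0 <= r, (s <= r%:E)%E & 0 <= f r].
Proof.
move=> /path_continuousP cf hr.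
have r0 : 0 <= r by rewrite -lee_fin -hr hit_ge0.
split=> //; first by rewrite -hr hit_ge.
rewrite leNgt; apply/negP => fr.
have fr' : 0 < - f r by rewrite oppr_gt0.
have [d d0 H] := cf r _ r0 fr'.
have hfin : ereal_inf (EFin @` [set t | [/\ 0 <= t, (s <= t%:E)%E & 0 <= f t]]) \is a fin_num.
  by rewrite -/(hit s f) hr.
have [_ [t [t0 st ft] <-]] := lb_ereal_inf_adherent d0 hfin.
rewrite -/(hit s f) hr -EFinD lte_fin => trd.
have rt : r <= t by rewrite -lee_fin -hr hit_le.
have := H t t0; rewrite ger0_norm ?subr_ge0// ltrBlDl trd => /(_ isT).
by move=> /(le_lt_trans (ler_norm _)); rewrite ltrBlDr addNr ltNge ft.
Qed.

Lemma hit_leP s f t : path_continuous f ->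
  (hit s f <= t%:E)%E <-> exists u : R, [/\ 0 <= u, u <= t, (s <= u%:E)%E & 0 <= f u].
Proof.
move=> cf; split.
- case: (hit s f) (hit_ge0 s f) (@hit_attained s f ^~ cf) => [r| |]//= r0 /(_ r erefl)[r0' sr fr].
  by rewrite lee_fin => rt; exists r.
- move=> [u [u0 ut su fu]]; apply: le_trans (hit_le u0 su fu) _.
  by rewrite lee_fin.
Qed.

(** Countable description of the event, using no time after [t]. A hit at [u < t] yields rationals
    just to the right of [u], which stay above [s]; a hit at [u = t] leaves no room for them, whence
    the separate case. Conversely the maximum of [f] on [[s, t]] is attained, and it cannot be
    negative. *)
Lemma closed_hitP s f t : path_continuous f -> 0 <= t -> (0 <= s)%E ->
  (hit s f <= t%:E)%E <-> (s <= t%:E)%E /\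
  (0 <= f t \/ forall k : nat, exists q : rat,
     [/\ 0 <= (ratr q : R), (ratr q : R) < t, (s <= (ratr q)%:E)%E & - k.+1%:R^-1 < f (ratr q)]).
Proof.
move=> cf t0 s0; rewrite hit_leP//; split.
- move=> [u [u0 ut su fu]]; split; first by apply: (le_trans su); rewrite lee_fin.
  move: ut; rewrite le_eqVlt => /predU1P[<-|ut]; first by left.
  right => k; have k0 : 0 < k.+1%:R^-1 :> R by rewrite invr_gt0.
  have [d d0 H] := (path_continuousP f).1 cf u _ u0 k0.
  have : u < Num.min t (u + d) by rewrite lt_min ut ltrDl.
  move=> /rat_in_itvoo[q]; rewrite in_itv/= lt_min => /and3P[uq qt qd].
  have q0 : 0 <= (ratr q : R) by rewrite (le_trans u0)// ltW.
  exists q; split => //; first by apply: (le_trans su); rewrite lee_fin ltW.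
  have := H (ratr q) q0; rewrite ger0_norm ?subr_ge0 ?(ltW uq)// ltrBlDl qd => /(_ isT).
  rewrite ltr_norml => /andP[+ _]; rewrite ltrBrDr; by apply: le_lt_trans; rewrite lerDl.
- move=> [st [ft|H]]; first by exists t.
  case: s s0 st H => [a| |]//; rewrite !lee_fin => a0 at_ H.
  have [c] := EVT_max at_ (path_continuous_itv a0 cf).
  rewrite in_itv/= => /andP[ac ct] fc.
  exists c; split; rewrite ?lee_fin//; first exact: le_trans ac.
  rewrite leNgt; apply/negP => fc0.
  have fc1 : 0 < - f c by rewrite oppr_gt0.
  have [k] := ltr_add_invr fc1; rewrite add0r => kf.
  have [q [q0 qt aq fq]] := H k.
  have fqc : f (ratr q) <= f c by apply: fc; rewrite in_itv/= -lee_fin aq ltW.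
  have := lt_le_trans fq fqc; rewrite ltNge => /negP; apply.
  by rewrite -lerN2 opprK ltW.
Qed.

(** The hypotheses only concern times up to [t], so [G] can be the past at time [t], and the
    conclusion is then that the hitting time is adapted. *)
Lemma measurable_hit {T : pointedType} (G : set (set T)) (s : T -> \bar R) (Z : R -> T -> R) t :
  0 <= t -> (forall w, 0 <= s w)%E ->
  (forall q, 0 <= q <= t -> <<s G >> [set w | (s w <= q%:E)%E]) ->
  (forall q, 0 <= q <= t -> measurable_fun setT (Z q : g_sigma_algebraType G -> R)) ->
  (forall w, path_continuous (Z^~ w)) ->
  <<s G >> [set w | (hit (s w) (Z^~ w) <= t%:E)%E].
Proof.
move=> t0 s0 ms mZ cZ.
pose T' := g_sigma_algebraType G.
have mge q (a : R) : 0 <= q <= t -> measurable ([set w | a <= Z q w] : set T').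
  move=> qt; rewrite (_ : [set w | _] = Z q @^-1` `[a, +oo[%classic).
    by rewrite -[X in measurable X]setTI; apply: (mZ q qt) => //; exact: measurable_itv.
  by apply/seteqP; split => w /=; rewrite in_itv/= andbT.
have mgt q (a : R) : 0 <= q <= t -> measurable ([set w | a < Z q w] : set T').
  move=> qt; rewrite (_ : [set w | _] = Z q @^-1` `]a, +oo[%classic).
    by rewrite -[X in measurable X]setTI; apply: (mZ q qt) => //; exact: measurable_itv.
  by apply/seteqP; split => w /=; rewrite in_itv/= andbT.
pose E (k : nat) (q : rat) : set T' := [set w | [/\ 0 <= (ratr q : R), (ratr q : R) < t,
   (s w <= (ratr q)%:E)%E & - k.+1%:R^-1 < Z (ratr q) w]].
have mE k q : measurable (E k q).
  case: (boolP ((0 <= (ratr q : R)) && ((ratr q : R) < t))) => [/andP[q0 qt]|nq].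
    rewrite (_ : E k q = [set w | (s w <= (ratr q)%:E)%E] `&` [set w | - k.+1%:R^-1 < Z (ratr q) w]).
      by apply: measurableI; [apply: ms|apply: mgt]; rewrite q0 ltW.
    by apply/seteqP; split => w; [move=> [? ? ? ?]|move=> [? ?]].
  rewrite (_ : E k q = set0)//; apply/seteqP; split => w // [q0 qt _ _].
  by move: nq; rewrite q0 qt.
have -> : [set w | (hit (s w) (Z^~ w) <= t%:E)%E] =
    [set w | (s w <= t%:E)%E] `&` ([set w | 0 <= Z t w] `|` \bigcap_k \bigcup_q E k q).
  apply/seteqP; split => w.
  - move=> /(closed_hitP (cZ w) t0 (s0 w))[st [Zt|H]]; split => //; [by left|right].
    by move=> k _; have [q Hq] := H k; exists q.
  - move=> [st [Zt|H]]; apply/(closed_hitP (cZ w) t0 (s0 w)); split => //; [by left|right].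
    by move=> k; have [q _ Hq] := H k I; exists q.
change (measurable ([set w | (s w <= t%:E)%E] `&`
  ([set w | 0 <= Z t w] `|` \bigcap_k \bigcup_q E k q) : set T')).
apply: measurableI; first by apply: ms; rewrite t0 lexx.
apply: measurableU; first by apply: mge; rewrite t0 lexx.
by apply: bigcapT_measurable => k; apply: bigcupT_measurable_rat.
Qed.

Definition running_inf f t := inf (f @` [set s | 0 <= s <= t]).

Lemma running_inf_attained f t : path_continuous f -> 0 <= t ->
  exists2 s, 0 <= s <= t & running_inf f t = f s.
Proof.
move=> cf t0; have [c] := EVT_min t0 (path_continuous_itv (lexx 0) cf).
rewrite in_itv/= => ct fc; exists c => //.
apply/eqP; rewrite eq_le; apply/andP; split.
- apply: ge_inf; last by exists c.
  by exists (f c) => _ [s /= st <-]; apply: fc; rewrite in_itv.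
- apply: lb_le_inf; first by exists (f c), c.
  by move=> _ [s /= st <-]; apply: fc; rewrite in_itv.
Qed.

Lemma running_inf_le f s t : path_continuous f -> 0 <= s <= t -> running_inf f t <= f s.
Proof.
move=> cf /andP[s0 st]; have t0 := le_trans s0 st.
have [c _ fc] := EVT_min t0 (path_continuous_itv (lexx 0) cf).
apply: ge_inf; last by exists s => //=; rewrite s0.
by exists (f c) => _ [u /= ut <-]; apply: fc; rewrite in_itv.
Qed.

Lemma running_inf_nincr f s t : path_continuous f -> 0 <= s -> s <= t ->
  running_inf f t <= running_inf f s.
Proof.
move=> cf s0 st; have [u /andP[u0 us] ->] := running_inf_attained cf s0.
by apply: running_inf_le => //; rewrite u0 (le_trans us).
Qed.

(** The minima up to [s] and up to [t] can differ only if the later one is attained between [s] and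
    [t], where the path is close to [f t]. *)
Lemma running_inf_continuous f : path_continuous f -> path_continuous (running_inf f).
Proof.
move=> cf; apply/path_continuousP => t e t0 e0.
have e20 : 0 < e / 2 by rewrite divr_gt0.
have [d d0 H] := (path_continuousP f).1 cf t _ t0 e20.
exists d => // s s0 std.
have key u : Num.min s t < u -> u <= Num.max s t -> `|f u - f t| < e / 2.
  move=> mu uM; apply: H.
    by rewrite (le_trans _ (ltW mu))// le_min s0 t0.
  apply: le_lt_trans std; case: (leP s t) mu uM => st mu uM.
    by rewrite !ler0_norm ?subr_le0//; lra.
  by rewrite !ger0_norm ?subr_ge0//; lra.
have Hs := H s s0 std.
case: (leP s t) key => [st|ts] key.
- have gst := running_inf_nincr cf s0 st.
  have [u /andP[u0 ut] gu] := running_inf_attained cf t0.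
  have [us|su] := leP u s.
    have : running_inf f s <= f u by apply: running_inf_le => //; rewrite u0.
    rewrite -gu => gs; have -> : running_inf f s = running_inf f t by lra.
    by rewrite subrr normr0.
  have := key u su ut; move: Hs; rewrite !ltr_norml => /andP[h1 h2] /andP[h3 h4].
  have h5 : running_inf f s <= f s by apply: running_inf_le => //; rewrite s0 lexx.
  by rewrite gu; apply/andP; split; lra.
- have gst := running_inf_nincr cf t0 (ltW ts).
  have [u /andP[u0 us] gu] := running_inf_attained cf s0.
  have [ut|tu] := leP u t.
    have : running_inf f t <= f u by apply: running_inf_le => //; rewrite u0.
    rewrite -gu => gs; have -> : running_inf f s = running_inf f t by lra.
    by rewrite subrr normr0.
  have := key u tu us; rewrite !ltr_norml => /andP[h1 h2].
  have h5 : running_inf f t <= f t by apply: running_inf_le => //; rewrite t0 lexx.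
  by rewrite gu; apply/andP; split; lra.
Qed.

End continuous_paths.

(** * Gaussian increments and optional stopping *)

Section gaussian.
Context {R : realType}.
Local Notation mu := (@lebesgue_measure R).

Lemma normal_pdfN (s x : R) : s != 0 -> normal_pdf 0 s (- x) = normal_pdf 0 s x.
Proof. by move=> s0; rewrite !normal_pdfE// /normal_fun !subr0 sqrrN. Qed.

Lemma normal_probN (s : R) (A : set R) : s != 0 -> measurable A ->
  normal_prob 0 s ((fun x => - x) @^-1` A) = normal_prob 0 s A.
Proof.
move=> s0 mA; rewrite /normal_prob.
have mN : measurable_fun [set: R] (-%R : measurableTypeR R -> measurableTypeR R) by exact: oppr_measurable.
have H := @ge0_integral_pushforward _ _ (measurableTypeR R) (measurableTypeR R) R -%R mN mu A (EFin \o normal_pdf 0 s) mA.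
transitivity (\int[mu]_(x in -%R @^-1` A) (normal_pdf 0 s (- x))%:E)%E.
  by apply: eq_integral => x _ /=; rewrite normal_pdfN.
rewrite -[LHS]H; last 2 first.
- by apply/measurable_EFinP/measurable_funTS; exact: measurable_normal_pdf.
- by move=> y _; rewrite lee_fin normal_pdf_ge0.
by apply: eq_measure_integral => //= B mB BA; exact: lebesgue_measureN.
Qed.

(* The constant 6 is not sharp: it comes from dominating [x^2] times the density by a multiple of
   the density with standard deviation [2 * s]. *)
Lemma normal_second_moment (s : R) : 0 < s ->
  (\int[normal_prob 0 s]_x (x ^+ 2)%:E <= (6 * s ^+ 2)%:E)%E.
Proof.
move=> s0.
have s20 : 0 < 2 * s by rewrite mulr_gt0.
rewrite (@ge0_integral_density _ _ _ mu _ (normal_pdf 0 s))//; last 4 first.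
- exact: measurable_normal_pdf.
- by move=> x; exact: normal_pdf_ge0.
- by apply/measurable_EFinP; exact: measurable_funX.
- by move=> x; rewrite lee_fin sqr_ge0.
apply: (@le_trans _ _ (\int[mu]_x ((6 * s ^+ 2)%:E * (normal_pdf 0 (2 * s) x)%:E))%E); last first.
  rewrite ge0_integralZl//; last 3 first.
  - by apply/measurable_EFinP; exact: measurable_normal_pdf.
  - by move=> x _; rewrite lee_fin normal_pdf_ge0.
  - by rewrite lee_fin mulr_ge0// sqr_ge0.
  by rewrite integral_normal_pdf mule1.
apply: le_integralT => x; rewrite -!EFinM lee_fin.
rewrite !normal_pdfE ?gt_eqF// /normal_fun !subr0.
have -> : normal_peak s = 2 * normal_peak (2 * s).
  have e : (2 * s) ^+ 2 * pi *+ 2 = 2 ^+ 2 * (s ^+ 2 * pi *+ 2) :> R.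
    by rewrite exprMn -mulrA mulrnAr.
  by rewrite /normal_peak e sqrtrM ?sqr_ge0// sqrtr_sqr ger0_norm// invfM mulrA divff ?mul1r.
have p0 := normal_peak_ge0 (2 * s).
(* The gap between the two Gaussian exponents: [x ^+ 2] is 8/3 times [s ^+ 2 * y], the peaks
   contribute a factor 2, and y exp(-y) <= 1, so the constant has to dominate 16/3. *)
set y := 3 * x ^+ 2 / (8 * s ^+ 2).
have -> : - x ^+ 2 / (s ^+ 2 *+ 2) = - y + - x ^+ 2 / ((2 * s) ^+ 2 *+ 2).
  by rewrite /y; field; rewrite gt_eqF.
rewrite expRD.
have y0 : 0 <= y by rewrite /y divr_ge0// mulr_ge0// sqr_ge0.
have hy : y * expR (- y) <= 1.
  rewrite expRN ler_pdivrMr ?expR_gt0// mul1r (le_trans _ (expR_ge1Dx y))// lerDr.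
  exact: ler01.
have -> : x ^+ 2 = (8 / 3) * s ^+ 2 * y by rewrite /y; field; rewrite gt_eqF.
set E := expR (- _ / _).
have E0 : 0 <= E by exact: expR_ge0.
rewrite (_ : 8 / 3 * s ^+ 2 * y * _ = (16 / 3) * s ^+ 2 * (normal_peak (2 * s) * E) * (y * expR (- y))); last by ring.
rewrite -[leRHS]mulr1; apply: ler_pM => //.
- apply: mulr_ge0; last exact: mulr_ge0.
  by apply: mulr_ge0; [lra|exact: sqr_ge0].
- by rewrite mulr_ge0// expR_ge0.
- by rewrite ler_wpM2r ?mulr_ge0// ler_wpM2r ?sqr_ge0//; lra.
Qed.

Lemma normal_prob_itv (s a b : R) : 0 < s -> a <= b ->
  (normal_prob 0 s `[a, b] <= (normal_peak s * (b - a))%:E)%E.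
Proof.
move=> s0 ab; rewrite /normal_prob.
apply: (@le_trans _ _ (\int[mu]_(x in `[a, b]) (normal_peak s)%:E)%E).
  apply: ge0_le_integral => //=.
  - by move=> x _; rewrite lee_fin normal_pdf_ge0.
  - by apply/measurable_EFinP/measurable_funTS; exact: measurable_normal_pdf.
  - by move=> x _; rewrite lee_fin normal_pdf_ub// gt_eqF.
rewrite integral_cst//= lebesgue_measure_itv/= lte_fin EFinM.
case: ltP => [_|]; first by rewrite -EFinB.
by move=> ba; rewrite mule0 mule_ge0// lee_fin ?normal_peak_ge0// subr_ge0.
Qed.

End gaussian.

(** * From independence along grids to independence of the past *)

Section history.
Context {R : realType} {d : measure_display} {T : measurableType d}.
Implicit Types (B : R -> T -> R) (G : set (set T)).

(** The past of [B] including time [t], whereas [filt] for [X] is the strict past. Optional stopping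
    is carried out for this filtration, which contains the strict past of [X]. *)
Definition history B t : set (set T) :=
  <<s [set S | exists s (A : set R), 0 <= s <= t /\ measurable A /\ S = B s @^-1` A] >>.

Lemma generated_measurable G : (forall A, G A -> measurable A) ->
  forall A, <<s G >> A -> measurable A.
Proof.
move=> mG A; apply: (@smallest_sub _ _ _ (@measurable _ T)) => //.
exact: sigma_algebra_measurable.
Qed.

Lemma generatedS G1 G2 : (forall A, G1 A -> <<s G2 >> A) -> forall A, <<s G1 >> A -> <<s G2 >> A.
Proof.
move=> H A; apply: (@smallest_sub _ _ _ <<s G2 >>) => //.
Qed.

Definition increment B s t : T -> R := fun w => B t w - B s w.

Lemma history_measurable B : (forall t, 0 <= t -> measurable_fun setT (B t)) ->
  forall t A, history B t A -> measurable A.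
Proof.
move=> mB t; apply: generated_measurable => _ [s [A [/andP[s0 _] [mA ->]]]].
by rewrite -[X in measurable X]setTI; exact: mB.
Qed.

Lemma history_le B s t A : s <= t -> history B s A -> history B t A.
Proof.
move=> st; apply: generatedS => _ [u [C [/andP[u0 us] [mC ->]]]].
by apply: sub_sigma_algebra; exists u, C; rewrite u0 (le_trans us).
Qed.

Lemma history_fun B s t : 0 <= s <= t ->
  measurable_fun setT (B s : g_sigma_algebraType
    [set S | exists s (A : set R), 0 <= s <= t /\ measurable A /\ S = B s @^-1` A] -> R).
Proof.
by move=> st _ A mA; rewrite setTI; apply: sub_sigma_algebra; exists s, A.
Qed.

End history.

Section brownian_increments.
Context {R : realType} {d : measure_display} {T : measurableType d}.
Variables (P : probability T R) (x0 : R) (B : R -> T -> R).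
Hypothesis HB : brownian_from P x0 B.

Let mB t : 0 <= t -> measurable_fun setT (B t). Proof. by case: HB => + _ _ _; exact. Qed.

Lemma brownian_history_measurable t A : history B t A -> measurable A.
Proof. exact: history_measurable. Qed.

Lemma increment_measurable s t : 0 <= s -> 0 <= t ->
  measurable_fun setT (increment B s t).
Proof. by move=> s0 t0; apply: measurable_funB; exact: mB. Qed.

Lemma increment_law s t C : 0 <= s -> s < t -> measurable C ->
  P (increment B s t @^-1` C) = normal_prob 0 (Num.sqrt (t - s)) C.
Proof.
move=> s0 st mC; case: HB => _ _ _ /(_ 1%N (fun j => if j is 0%N then s else t) s0).
by case=> [[]//|_ /(_ ord0 C mC)].
Qed.

Section grid.
Variables (m : nat) (tt : nat -> R).
Hypothesis tt0 : tt 0%N = 0.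
Hypothesis ttS : forall j, (j < m.+1)%N -> tt j < tt j.+1.

Let D j w := B (tt j.+1) w - B (tt j) w.

Let tt_ge0 j : (j <= m.+1)%N -> 0 <= tt j.
Proof.
by elim: j => [|j IH] jm; [rewrite tt0|rewrite (le_trans (IH (ltnW jm)))// ltW// ttS].
Qed.

Let mD j : (j < m.+1)%N -> measurable_fun setT (D j).
Proof. by move=> jm; apply: increment_measurable; apply: tt_ge0 => //; exact: ltnW. Qed.

Let G : set (set T) := [set A | exists E : nat -> set R,
  (forall j, measurable (E j)) /\ A = [set w | forall j, (j < m)%N -> E j (D j w)]].

Let GI : setI_closed G.
Proof.
move=> _ _ [E [mE ->]] [F [mF ->]]; exists (fun j => E j `&` F j); split.
  by move=> j; exact: measurableI.
by apply/seteqP; split => w; [move=> [? ?] j jm; split; auto|move=> H; split => j /H[]].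
Qed.

Let GE (E : nat -> set R) (C : set R) : (forall j, measurable (E j)) -> measurable C ->
  P ([set w | forall j, (j < m)%N -> E j (D j w)] `&` D m @^-1` C) =
  ((\prod_(j < m) fine (P (D j @^-1` E j))) * fine (P (D m @^-1` C)))%:E.
Proof.
move=> mE mC; case: HB => _ _ _ H.
have [ind _] := H m.+1 tt (tt_ge0 (leq0n _)) ttS.
pose E' j := if (j < m)%N then E j else C.
have := ind (fun j => D j @^-1` E' j); rewrite big_ord_recr/= /E' ltnn.
under eq_bigr => j _ do rewrite ltn_ord.
move=> <-; last first.
  by move=> j; exists (E' j); split => //; rewrite /E'; case: ifP.
congr (P _); apply/seteqP; split => w /=.
- move=> [Hj Hm] j _ /=; case: ifPn => [jm|]; first exact: Hj.
  rewrite -leqNgt => mj; have -> : nat_of_ord j = m by apply/eqP; rewrite eqn_leq mj -ltnS ltn_ord.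
  exact: Hm.
- move=> K; split => [j jm|].
    by have := K (Ordinal (ltnW jm : (j < m.+1)%N)) I => /=; rewrite jm.
  by have := K ord_max I => /=; rewrite ltnn.
Qed.

(** Events on the first [m] increments form a pi-system, and the product rule for [m + 1]
    increments, used with and without a condition on the last one, factors the last increment
    out. *)
Lemma grid_increment_indep C A : measurable C -> <<s G >> A ->
  P (A `&` D m @^-1` C) = (P A * P (D m @^-1` C))%E.
Proof.
move=> mC GA; have mDC : measurable (D m @^-1` C).
  by rewrite -[X in measurable X]setTI; exact: mD.
apply: (proj2 (indep_gen GI _ mDC _ GA)) => // {A GA} A [E [mE ->]].
  rewrite (_ : [set w | _] = \bigcap_(j in [set j | (j < m)%N]) (D j @^-1` E j)); last first.
    by apply/seteqP; split.
  apply: bigcap_measurableType => j /= jm.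
  by rewrite -[X in measurable X]setTI; apply: mD => //; exact: ltnW.
rewrite GE//; have := GE mE measurableT; rewrite preimage_setT setIT probability_setT mulr1 => ->.
by rewrite EFinM fineK// fin_num_measure.
Qed.

(** The grid starts at 0, where the process is the constant [x0], so values at grid points are sums
    of increments. *)
Lemma grid_value_measurable j : (j <= m)%N ->
  measurable_fun setT (B (tt j) : g_sigma_algebraType G -> R).
Proof.
elim: j => [|j IH] jm.
  rewrite tt0 (_ : B 0 = cst x0); first exact: measurable_cst.
  by apply/funext => w; case: HB => _ -> _ _.
rewrite (_ : B (tt j.+1) = (fun w => B (tt j) w + D j w)); last first.
  by apply/funext => w; rewrite /D addrC subrK.
apply: measurable_funD; first exact: (IH (ltnW jm)).
move=> _ A mA; rewrite setTI; apply: sub_sigma_algebra.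
exists (fun i => if i == j then A else setT); split; first by move=> i; case: ifP.
apply/seteqP; split => w /=; first by move=> Dw i im; case: eqP => [->|].
by move/(_ j jm); rewrite eqxx.
Qed.

End grid.

(** The definition of Brownian motion gives independence only along finite grids. The past is
    generated by the pi-system of finite cylinders, and each cylinder is carried by one grid made of
    its own times together with 0, [s] and [t]. *)
Lemma increment_indep (s t : R) (A : set T) (C : set R) :
  0 <= s -> s < t -> history B s A -> measurable C ->
  P (A `&` increment B s t @^-1` C) = (P A * P (increment B s t @^-1` C))%E.
Proof.
move=> s0 st As mC.
pose cyl := foldr (fun p S => (B p.1 @^-1` p.2) `&` S) (@setT T) : seq (R * set R) -> set T.
pose ok := foldr (fun p Q => (0 <= p.1 <= s /\ measurable p.2) /\ Q) True : seq (R * set R) -> Prop.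
pose Pi : set (set T) := [set A | exists l, ok l /\ A = cyl l].
have PiI : setI_closed Pi.
  move=> _ _ [l1 [ok1 ->]] [l2 [ok2 ->]]; exists (l1 ++ l2); split.
    by elim: l1 ok1 => //= p l IH [okp okl]; split => //; exact: IH.
  elim: l1 {ok1} => /= [|p l IH]; first by rewrite setTI.
  by rewrite -setIA IH.
have PiG A' : history B s A' -> <<s Pi >> A'.
  apply: generatedS => _ [u [E [us [mE ->]]]].
  apply: sub_sigma_algebra; exists [:: (u, E)] => /=; split => //.
  by rewrite setIT.
have mPi A' : Pi A' -> measurable A'.
  move=> [l [okl ->]]; elim: l okl => //= p l IH [[/andP[p0 _] mp] okl].
  by apply: measurableI; [rewrite -[X in measurable X]setTI; exact: mB|exact: IH].
have mE : measurable (increment B s t @^-1` C).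
  rewrite -[X in measurable X]setTI; apply: increment_measurable => //.
  exact: le_trans (ltW st).
apply: (proj2 (indep_gen PiI mPi mE _ (PiG _ As))) => {As A} _ [l [okl ->]].
(* Sorting without repetition gives a strictly increasing list that starts at 0 and ends at [s]. *)
pose g := sort <=%R (undup (0 :: s :: map fst l)).
have gs x : x \in g -> 0 <= x <= s.
  rewrite mem_sort mem_undup !inE => /or3P[/eqP->|/eqP->|]; rewrite ?lexx ?s0//.
  elim: l okl {g} => //= p l IH [[ps _] okl]; rewrite inE => /orP[/eqP->//|]; exact: IH.
have g0 : 0 \in g by rewrite mem_sort mem_undup inE eqxx.
have gss : s \in g by rewrite mem_sort mem_undup !inE eqxx orbT.
have sg : sorted <%R g by rewrite sort_lt_sorted undup_uniq.
have [m gm] : exists m, size g = m.+1 by case: g g0 {gss gs sg} => // a g' _; exists (size g').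
(* The default value [t] matters: [g] has [m + 1] entries, so index [m + 1] overshoots and returns
   [t], the grid point after [s]. *)
pose tt j := nth t g j.
have tts j : (j < m.+1)%N -> 0 <= tt j <= s by move=> jm; apply: gs; rewrite mem_nth// gm.
have ttlt i j : (i < j)%N -> (j < m.+1)%N -> tt i < tt j.
  move=> ij jm; apply: (sorted_ltn_nth lt_trans) => //; rewrite inE gm//.
  exact: ltn_trans jm.
have ttle i j : (i <= j)%N -> (j < m.+1)%N -> tt i <= tt j.
  by rewrite leq_eqVlt => /predU1P[->//|ij jm]; apply/ltW/ttlt.
have gidx x : x \in g -> exists2 j, (j < m.+1)%N & tt j = x.
  by move=> xg; exists (index x g); [rewrite -gm index_mem|rewrite /tt nth_index].
have tt0 : tt 0%N = 0.
  have [j jm jE] := gidx _ g0; apply/eqP; rewrite eq_le.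
  by rewrite -{1}jE ttle//=; case/andP: (tts 0%N isT).
have ttm : tt m = s.
  have [j jm jE] := gidx _ gss; apply/eqP; rewrite eq_le -{2}jE ttle// andbT.
  by case/andP: (tts m (ltnSn m)).
have ttm1 : tt m.+1 = t by rewrite /tt nth_default// gm.
have ttS j : (j < m.+1)%N -> tt j < tt j.+1.
  rewrite ltnS leq_eqVlt => /predU1P[->|jm]; first by rewrite ttm ttm1.
  exact: ttlt.
rewrite -ttm1 -ttm; apply: (grid_increment_indep tt0 ttS mC).
have lg : {subset map fst l <= g}.
  by move=> x xl; rewrite mem_sort mem_undup !inE xl !orbT.
pose Gm := [set A | exists E : nat -> set R, (forall j, measurable (E j)) /\
  A = [set w | forall j, (j < m)%N -> E j (B (tt j.+1) w - B (tt j) w)]].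
rewrite -/Gm.
have key l' : ok l' -> {subset map fst l' <= g} ->
    measurable (cyl l' : set (g_sigma_algebraType Gm)).
  elim: l' => [_ _|p l' IH [[_ mp] okl'] /= lg']; first exact: measurableT.
  apply: measurableI; last by apply: IH => // x xl; apply: lg'; rewrite inE xl orbT.
  have [j jm <-] := gidx p.1 (lg' _ (mem_head _ _)).
  rewrite -[X in measurable X]setTI.
  have := @grid_value_measurable m tt tt0 j jm.
  by move=> /(_ measurableT p.2 mp).
exact: key.
Qed.

End brownian_increments.

Section optional_stopping.
Context {R : realType} {d : measure_display} {T : measurableType d}.
Variables (P : probability T R) (x0 : R) (B : R -> T -> R).
Hypothesis HB : brownian_from P x0 B.

Let mB t : 0 <= t -> measurable_fun setT (B t). Proof. by case: HB => + _ _ _; exact. Qed.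

Definition stopping_time (tau : T -> \bar R) :=
  (forall w, 0 <= tau w)%E /\ forall q, 0 <= q -> history B q [set w | (tau w <= q%:E)%E].

Let gen t := [set S | exists s (A : set R), 0 <= s <= t /\ measurable A /\ S = B s @^-1` A].

Lemma history_indep_increment d' (S : measurableType d') (U : T -> S) (s t : R) :
  0 <= s -> s < t -> measurable_fun setT (U : g_sigma_algebraType (gen s) -> S) ->
  [/\ measurable_fun setT U, indep_rv P U (increment B s t) &
   indep_rv P U (fun w => - increment B s t w)].
Proof.
move=> s0 st mU.
have hU A : measurable A -> history B s (U @^-1` A).
  by move=> mA; have := mU measurableT A mA; rewrite setTI.
split.
- by move=> _ A mA; rewrite setTI; apply: (@brownian_history_measurable _ _ _ _ _ _ HB s); exact: hU.
- by move=> A C mA mC; apply: (increment_indep HB) => //; exact: hU.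
- move=> A C mA mC.
  apply: (@increment_indep _ _ _ _ _ _ HB s t _ (-%R @^-1` C)) => //; first exact: hU.
  rewrite -[X in measurable X]setTI; exact: (oppr_measurable measurableT).
Qed.

Lemma increment_symmetric (s t : R) (C : set R) : 0 <= s -> s < t -> measurable C ->
  P (increment B s t @^-1` C) = P ((fun w => - increment B s t w) @^-1` C).
Proof.
move=> s0 st mC; rewrite (increment_law HB)//.
have -> : (fun w => - increment B s t w) @^-1` C = increment B s t @^-1` (-%R @^-1` C) by [].
rewrite (increment_law HB)//.
  by rewrite normal_probN// gt_eqF// sqrtr_gt0 subr_gt0.
rewrite -[X in measurable X]setTI; exact: (oppr_measurable measurableT).
Qed.

Lemma increment_second_moment (s t : R) : 0 <= s -> s < t ->
  (\int[P]_w (increment B s t w ^+ 2)%:E <= (6 * (t - s))%:E)%E.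
Proof.
move=> s0 st.
have mI : measurable_fun setT (increment B s t).
  by apply: (increment_measurable HB) => //; exact: le_trans (ltW st).
have mI' : measurable_fun setT (increment B s t : T -> measurableTypeR R).
  by move=> _ A mA; exact: mI.
pose V : {mfun T >-> measurableTypeR R} := HB.pack (increment B s t) (isMeasurableFun.Build _ _ _ _ _ mI').
have -> : (\int[P]_w (increment B s t w ^+ 2)%:E = \int[distribution P V]_x (x ^+ 2)%:E)%E.
  rewrite ge0_integral_distribution//.
    by apply/measurable_EFinP; exact: measurable_funX.
  by move=> y; rewrite lee_fin sqr_ge0.
have -> : (\int[distribution P V]_x (x ^+ 2)%:E = \int[normal_prob 0 (Num.sqrt (t - s))]_x (x ^+ 2)%:E)%E.
  by apply: eq_measure_integral => A mA _; exact: (increment_law HB).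
apply: (le_trans (normal_second_moment _)); first by rewrite sqrtr_gt0 subr_gt0.
by rewrite sqr_sqrtr// subr_ge0 ltW.
Qed.

(** [H] is a bet decided at time [s]. Replacing the increment by its negative leaves the integral
    unchanged, and averaging the two squares removes the cross term; likewise the positive and
    negative parts of the gain have equal integrals. *)
Lemma history_step (W H : T -> R) (s t : R) : 0 <= s -> s < t ->
  measurable_fun setT (W : g_sigma_algebraType (gen s) -> R) ->
  measurable_fun setT (H : g_sigma_algebraType (gen s) -> R) ->
  (forall w, H w = 0 \/ H w = 1) ->
  (\int[P]_w ((W w + H w * increment B s t w) ^+ 2)%:E
     <= \int[P]_w (W w ^+ 2)%:E + (6 * (t - s))%:E)%E /\
  (\int[P]_w (H w * increment B s t w)%:E = 0)%E.
Proof.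
move=> s0 st mW mH H01.
have t0 : 0 <= t by exact: le_trans (ltW st).
have mI := increment_measurable HB s0 t0.
have mIN : measurable_fun setT (fun w => - increment B s t w).
  exact: (measurableT_comp (@oppr_measurable R setT) mI).
have mWH : measurable_fun setT ((fun w => (W w, H w)) : g_sigma_algebraType (gen s) -> (R * R)%type).
  exact/measurable_fun_pair.
have [mU UV UV'] := history_indep_increment s0 st mWH.
have [mHT HV HV'] := history_indep_increment s0 st mH.
have [mWT _ _] := history_indep_increment s0 st mW.
have sym := increment_symmetric s0 st.
have sm := increment_second_moment s0 st.
have mHI : measurable_fun setT (fun w => H w * increment B s t w) by exact: measurable_funM.
split.
  pose f (z : (R * R) * R) := ((z.1.1 + z.1.2 * z.2) ^+ 2)%:E.
  have mf : measurable_fun setT f.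
    apply/measurable_EFinP; apply: measurable_funX; apply: measurable_funD.
      exact: (measurableT_comp measurable_fst measurable_fst).
    apply: measurable_funM => //.
    exact: (measurableT_comp measurable_snd measurable_fst).
  have f0 z : (0 <= f z)%E by rewrite lee_fin sqr_ge0.
  have E := @symmetric_integral _ _ _ _ _ _ _ P _ _ _ f mU mI mIN UV UV' sym mf f0.
  have fin : (\int[P]_w (W w ^+ 2)%:E + (6 * (t - s))%:E =
    2^-1%:E * (2%:E * \int[P]_w (W w ^+ 2)%:E + 2%:E * (6 * (t - s))%:E))%E.
    rewrite -ge0_muleDr ?lee_fin//; last first.
    - by rewrite mulr_ge0// subr_ge0 ltW.
    - by apply: integral_ge0 => w _; rewrite lee_fin sqr_ge0.
    by rewrite muleA -EFinM mulVf// mul1e.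
  have i0 : (0 <= \int[P]_w f ((W w, H w), increment B s t w))%E by exact: integral_ge0.
  have -> : (\int[P]_w ((W w + H w * increment B s t w) ^+ 2)%:E =
     2^-1%:E * (\int[P]_w f ((W w, H w), increment B s t w) +
               \int[P]_w f ((W w, H w), (- increment B s t w)%R)))%E.
    rewrite -E ge0_muleDr// -ge0_muleDl ?lee_fin ?invr_ge0// -EFinD.
    by rewrite (_ : 2^-1 + 2^-1 = 1) ?mul1e//; lra.
  rewrite fin; apply: lee_wpmul2l; first by rewrite lee_fin invr_ge0.
  have mfI (V : T -> R) : measurable_fun setT V -> measurable_fun setT (fun w => f ((W w, H w), V w)).
    move=> mV; apply: (measurableT_comp mf); apply/measurable_fun_pair => //.
  rewrite -ge0_integralD//; last 2 first.
  - exact: mfI.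
  - exact: mfI.
  have mW2 : measurable_fun setT (fun w => (W w ^+ 2)%:E).
    by apply/measurable_EFinP; exact: measurable_funX.
  have mI2 : measurable_fun setT (fun w => (increment B s t w ^+ 2)%:E).
    by apply/measurable_EFinP; exact: measurable_funX.
  apply: (@le_trans _ _ (\int[P]_w (2%:E * (W w ^+ 2)%:E + 2%:E * (increment B s t w ^+ 2)%:E))%E).
    apply: le_integralT => w; rewrite /f/= -!EFinM -!EFinD lee_fin.
    case: (H01 w) => ->; last by rewrite mul1r mul1r; nra.
    by rewrite !mul0r addr0; nra.
  rewrite ge0_integralD//; last 4 first.
  - by move=> w _; rewrite mule_ge0// lee_fin sqr_ge0.
  - by apply: emeasurable_funM.
  - by move=> w _; rewrite mule_ge0// lee_fin sqr_ge0.
  - by apply: emeasurable_funM.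
  rewrite !ge0_integralZl//; try (by move=> w _; rewrite lee_fin sqr_ge0).
  by apply: leeD => //; apply: lee_wpmul2l; rewrite ?lee_fin.
pose f (z : R * R) := maxe (z.1 * z.2)%:E 0%E.
have mf : measurable_fun setT f.
  apply: measurable_maxe => //; apply/measurable_EFinP; exact: measurable_funM.
have f0 z : (0 <= f z)%E by rewrite /f le_max lexx orbT.
have E := @symmetric_integral _ _ _ _ _ _ _ P _ _ _ f mHT mI mIN HV HV' sym mf f0.
have i2 : P.-integrable setT (EFin \o (fun w => H w * increment B s t w)).
  apply: (@integrable_L2 _ _ _ _ _ (6 * (t - s))) => //.
  apply: le_trans sm; apply: le_integralT => w; rewrite lee_fin.
  by case: (H01 w) => ->; rewrite ?mul1r// mul0r expr0n/= sqr_ge0.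
rewrite integralE.
have -> : (\int[P]_w (fun w => (H w * increment B s t w)%:E)^\+ w = \int[P]_w f (H w, increment B s t w))%E.
  by apply: eq_integral => w _; rewrite funeposE.
have e2 : (\int[P]_w (fun w => (H w * increment B s t w)%:E)^\- w = \int[P]_w f (H w, (- increment B s t w)%R))%E.
  by apply: eq_integral => w _; rewrite funenegE /f/= mulrN EFinN.
rewrite e2 -E subee// E -e2.
exact: integrable_neg_fin_num.
Qed.

End optional_stopping.

Section optional_stopping_theorem.
Context {R : realType} {d : measure_display} {T : measurableType d}.
Variables (P : probability T R) (x0 : R) (B : R -> T -> R).
Hypothesis HB : brownian_from P x0 B.

Let gen t := [set S | exists s (A : set R), 0 <= s <= t /\ measurable A /\ S = B s @^-1` A].

Lemma history_fun_le (U : T -> R) (s t : R) : s <= t ->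
  measurable_fun setT (U : g_sigma_algebraType (gen s) -> R) ->
  measurable_fun setT (U : g_sigma_algebraType (gen t) -> R).
Proof.
move=> st mU _ A mA; apply: (@history_le _ _ _ B s) => //.
exact: (mU measurableT A mA).
Qed.

(** The cap [n] makes the time finite, so that [fine] is harmless for nonnegative [tau]. The value
    is taken from [B] and not from the absorbed process, since the Gaussian increments are those of
    [B]. *)
Definition stopped_at (tau : T -> \bar R) (n : nat) (w : T) : R :=
  B (fine (mine (tau w) n%:R%:E)) w.

Section discretization.
Variable tau : T -> \bar R.
Hypothesis Htau : stopping_time B tau.
Variable k : nat.

Let h : R := k.+1%:R^-1.
Let h0 : 0 < h. Proof. by rewrite invr_gt0. Qed.
Let t_ (j : nat) : R := j%:R * h.
Let t_ge0 j : 0 <= t_ j. Proof. by rewrite mulr_ge0// ltW. Qed.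
Let t_S j : t_ j.+1 = t_ j + h. Proof. by rewrite /t_ -natr1 mulrDl mul1r. Qed.
Let t_lt j : t_ j < t_ j.+1. Proof. by rewrite t_S ltrDl. Qed.

Let H (j : nat) : T -> R := \1_(~` [set w | (tau w <= (t_ j)%:E)%E]).

(** A discrete stochastic integral: one unit is held on each increment until [tau], so the sum is
    the displacement of [B] up to [tau] rounded up to the grid and capped at [t_ J]. *)
Let W (J : nat) (w : T) : R := \sum_(j < J) H j w * increment B (t_ j) (t_ j.+1) w.

Let mH j : measurable_fun setT (H j : g_sigma_algebraType (gen (t_ j)) -> R).
Proof.
apply: (@measurable_indic _ (g_sigma_algebraType (gen (t_ j)))).
by apply: measurableC; apply: Htau.2.
Qed.

Let mI s t : 0 <= s -> s <= t ->
  measurable_fun setT (increment B s t : g_sigma_algebraType (gen t) -> R).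
Proof.
move=> s0 st; apply: measurable_funB; apply: history_fun.
  by rewrite lexx (le_trans s0).
by rewrite s0.
Qed.

Let mW J : measurable_fun setT (W J : g_sigma_algebraType (gen (t_ J)) -> R).
Proof.
elim: J => [|J IH].
  rewrite (_ : W 0 = cst 0); first exact: measurable_cst.
  by apply/funext => w; rewrite /W big_ord0.
rewrite (_ : W J.+1 = (fun w => W J w + H J w * increment B (t_ J) (t_ J.+1) w)); last first.
  by apply/funext => w; rewrite /W big_ord_recr.
apply: measurable_funD; first exact: (history_fun_le (ltW (t_lt J)) IH).
have mHJ := @history_fun_le (H J) _ _ (ltW (t_lt J)) (@mH J).
exact: (measurable_funM mHJ (mI (t_ge0 J) (ltW (t_lt J)))).
Qed.

Let mWT J : measurable_fun setT (W J).
Proof. by have [] := history_indep_increment HB (t_ge0 J) (t_lt J) (@mW J). Qed.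

Let H01 j w : H j w = 0 \/ H j w = 1.
Proof. by rewrite /H indicE; case: (w \in _); [right|left]. Qed.

Let W_moments J :
  (\int[P]_w (W J w ^+ 2)%:E <= (6 * t_ J)%:E)%E /\ (\int[P]_w (W J w)%:E = 0)%E.
Proof.
elim: J => [|J [IH1 IH2]].
  split.
    rewrite integral0_eq; first by rewrite lee_fin mulr_ge0.
    by move=> w _; rewrite /W big_ord0 expr0n.
  by rewrite integral0_eq// => w _; rewrite /W big_ord0.
have [S1 S2] := history_step HB (t_ge0 J) (t_lt J) (@mW J) (@mH J) (@H01 J).
have WS w : W J.+1 w = W J w + H J w * increment B (t_ J) (t_ J.+1) w.
  by rewrite /W big_ord_recr.
have B1 : (\int[P]_w (W J.+1 w ^+ 2)%:E <= (6 * t_ J.+1)%:E)%E.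
  under eq_integral do rewrite WS.
  apply: (le_trans S1); apply: (le_trans (leeD2r _ IH1)).
  by rewrite -EFinD lee_fin -mulrDr addrC subrK.
split => //.
have i1 : P.-integrable setT (EFin \o W J) := integrable_L2 (@mWT J) IH1.
have i2 : P.-integrable setT (EFin \o W J.+1) := integrable_L2 (@mWT J.+1) B1.
have i3 : P.-integrable setT (EFin \o (fun w => H J w * increment B (t_ J) (t_ J.+1) w)).
  rewrite (_ : _ \o _ = (fun w => (W J.+1 w)%:E - (W J w)%:E)%E); first exact: integrableB.
  by apply/funext => w /=; rewrite -EFinB WS addrC addKr.
under eq_integral do rewrite WS EFinD.
rewrite integralD_EFin//.
by rewrite S2 adde0; exact: IH2.
Qed.

Let W_path J w : exists s, [/\ 0 <= s, W J w = B s w - B 0 w &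
  ((tau w <= (t_ J)%:E) /\ (tau w <= s%:E) /\ (s%:E <= tau w + h%:E))%E \/
  (((t_ J)%:E < tau w)%E /\ s = t_ J)].
Proof.
have tau0 := Htau.1 w.
elim: J => [|J [s [s0 Ws IH]]].
  exists 0; split => //; first by rewrite /W big_ord0 subrr.
  have t00 : t_ 0%N = 0 by rewrite /t_ mul0r.
  have [tw|tw] := leP (tau w) (t_ 0)%:E; [left|by right; rewrite t00].
  by split=> //; rewrite -t00; split=> //; rewrite t00 adde_ge0// lee_fin ltW.
have WS : W J.+1 w = W J w + H J w * increment B (t_ J) (t_ J.+1) w.
  by rewrite /W big_ord_recr.
case: IH => [[tJ [ts st]]|[Jt sJ]].
  have HJ : H J w = 0 by rewrite /H indicE memNset//=; apply.
  exists s; split => //; first by rewrite WS HJ mul0r addr0.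
  by left; split; [apply: (le_trans tJ); rewrite lee_fin ltW|].
have HJ : H J w = 1 by rewrite /H indicE mem_set//=; apply/negP; rewrite -ltNge.
exists (t_ J.+1); split => //.
  by rewrite WS HJ mul1r Ws sJ /increment addrC addrA subrK.
have [tw|tw] := leP (tau w) (t_ J.+1)%:E; [left|by right].
by split=> //; split=> //; rewrite t_S EFinD leeD2r// ltW.
Qed.

(** The second-moment bound depends on the horizon [n] but not on the mesh, which is what lets the
    mesh tend to zero. *)
Lemma stopped_at_discretization n : exists V : T -> R,
  [/\ measurable_fun setT V, (\int[P]_w (V w ^+ 2)%:E <= (6 * n%:R)%:E)%E,
   (\int[P]_w (V w)%:E = 0)%E &
   forall w, exists s, [/\ 0 <= s, V w = B s w - x0 &
      `|s - fine (mine (tau w) n%:R%:E)| <= k.+1%:R^-1]].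
Proof.
(* [n * k.+1] steps of length [1 / k.+1] end exactly at time [n], the cap used in [stopped_at]. *)
have tn : t_ (n * k.+1) = n%:R by rewrite /t_ natrM mulfK.
exists (W (n * k.+1)); have [m1 m2] := W_moments (n * k.+1); rewrite tn in m1.
split; [exact: mWT|exact: m1|exact: m2|move=> w].
have [s [s0 Ws Hs]] := W_path (n * k.+1) w; rewrite tn in Hs.
have B0 : B 0 w = x0 by case: HB => _ + _ _; exact.
exists s; split => //; first by rewrite -B0.
rewrite -/h; have tau0 := Htau.1 w.
case: Hs => [[tn' [ts st]]|[nt ->]].
  rewrite min_l//; case: (tau w) tau0 tn' ts st => [r| |]//=.
  rewrite !lee_fin => r0 rn rs sr; rewrite ger0_norm ?subr_ge0//.
  by rewrite lerBlDl.
by rewrite (min_r (ltW nt))/= subrr normr0 ltW.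
Qed.

End discretization.

(** The discretised values converge pointwise, because their times are within the mesh of
    [min(tau, n)] and paths are continuous; the L2 bound, uniform in the mesh, carries their mean
    zero to the limit. *)
Theorem optional_stopping (tau : T -> \bar R) (n : nat) : stopping_time B tau ->
  [/\ measurable_fun setT (stopped_at tau n),
   P.-integrable setT (EFin \o stopped_at tau n) &
   (\int[P]_w (stopped_at tau n w)%:E = x0%:E)%E].
Proof.
move=> Htau.
have /boolp.choice[V HV] := fun k => stopped_at_discretization Htau k n.
have cV w : V k w @[k --> \oo] --> stopped_at tau n w - x0.
  apply/cvgrPdist_lt => e e0.
  have cB : path_continuous (B^~ w) by case: HB => _ _ + _; exact.
  have m0 : 0 <= fine (mine (tau w) n%:R%:E).
    by rewrite fine_ge0// le_min Htau.1 lee_fin ler0n.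
  have [dl dl0 Hd] := (path_continuousP _).1 cB _ _ m0 e0.
  have := near_infty_natSinv_lt (PosNum dl0).
  apply: filterS => k /= kd.
  have [_ _ _ /(_ w)[s [s0 -> sk]]] := HV k.
  rewrite /stopped_at opprB addrA subrK distrC; apply: Hd => //.
  exact: le_lt_trans kd.
have [m i E] := @expectation_L2_limit _ _ _ P V (fun w => stopped_at tau n w - x0) 0 (6 * n%:R)
  (fun k => let: And4 a _ _ _ := HV k in a) cV
  (fun k => let: And4 _ a _ _ := HV k in a) (fun k => let: And4 _ _ a _ := HV k in a).
have e : stopped_at tau n = (fun w => (stopped_at tau n w - x0) + x0).
  by apply/funext => w; rewrite subrK.
have ic : P.-integrable setT (EFin \o cst x0) by exact: finite_measure_integrable_cst.
split.
- by rewrite e; apply: measurable_funD.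
- rewrite e (_ : _ \o _ = (fun w => ((stopped_at tau n w - x0)%:E + x0%:E)%E)).
    exact: integrableD.
  by apply/funext => w.
- rewrite e; under eq_integral do rewrite EFinD.
  rewrite integralD_EFin// E add0e.
  transitivity (x0%:E * P setT)%E; first exact: integral_cst.
  by rewrite probability_setT mule1.
Qed.

(** At each cap [n] both stopped values have mean [x0]. Neither need be uniformly integrable as [n]
    grows, but a bounded difference passes to the limit by dominated convergence. *)
Lemma exit_identity (sigma rho : T -> \bar R) (D : T -> R) (C : R) :
  stopping_time B sigma -> stopping_time B rho -> measurable_fun setT D ->
  (forall n w, `|stopped_at rho n w - stopped_at sigma n w| <= C) ->
  {ae P, forall w, exists N, forall n, (N <= n)%N ->
     stopped_at rho n w - stopped_at sigma n w = D w} ->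
  (\int[P]_w (D w)%:E = 0)%E.
Proof.
move=> Hs Hr mD bD cD.
have [_ _ dc] : [/\ P.-integrable setT (EFin \o D),
    [sequence \int[P]_w (`|(stopped_at rho n w - stopped_at sigma n w)%:E - (D w)%:E|)]_n @ \oo --> 0%E &
    [sequence \int[P]_w ((stopped_at rho n w - stopped_at sigma n w)%:E)]_n @ \oo --> \int[P]_w ((D w)%:E)]%E.
  apply: (@dominated_convergence _ _ _ P setT measurableT
    (fun n => EFin \o (fun w => stopped_at rho n w - stopped_at sigma n w)) _ (cst C%:E)) => //.
  - move=> n; apply/measurable_EFinP; apply: measurable_funB.
      by have [] := optional_stopping n Hr.
    by have [] := optional_stopping n Hs.
  - exact/measurable_EFinP.
  - apply: filterS cD => w [N HN] _; apply: cvg_near_cst.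
    by exists N => // n /= /HN <-.
  - exact: finite_measure_integrable_cst.
  - by apply: aeW => w n _ /=; rewrite lee_fin.
apply/esym/(cvg_unique _ _ dc) => //.
apply: cvg_near_cst; apply: nearW => n /=.
have [_ i1 E1] := optional_stopping n Hr; have [_ i2 E2] := optional_stopping n Hs.
under eq_integral do rewrite EFinB.
by rewrite integralB_EFin// E1 E2 subee.
Qed.

(** At integer time [k] the density is at most a constant over the square root of [k], so the
    probability of lying strictly between 0 and [m] tends to 0, and lying there at all integers from
    [n] on has probability 0. *)
Lemma brownian_leaves_interval (m : R) : 0 < m ->
  {ae P, forall w, forall n : nat, exists2 k : nat, (n <= k)%N & B k%:R w <= 0 \/ m <= B k%:R w}.
Proof.
move=> m0.
have mB t : 0 <= t -> measurable_fun setT (B t) by case: HB => + _ _ _; exact.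
pose E n := \bigcap_(k in [set k | (n <= k)%N]) [set w | 0 < B k%:R w < m].
have mBk k : measurable [set w | 0 < B k%:R w < m].
  rewrite (_ : [set w | _] = B k%:R @^-1` `]0, m[%classic).
    by rewrite -[X in measurable X]setTI; apply: mB => //; exact: measurable_itv.
  by apply/seteqP; split => w /=; rewrite in_itv.
have mE n : measurable (E n) by apply: bigcap_measurableType => k _; exact: mBk.
have PE n : P (E n) = 0.
  apply/eqP; rewrite eq_le measure_ge0 andbT; apply/lee_addgt0Pr => e e0; rewrite add0e.
  have Hk k : (0 < k)%N -> (n <= k)%N -> (P (E n) <= (normal_peak (Num.sqrt k%:R) * m)%:E)%E.
    move=> k0 nk.
    have K0 : (0 : R) < k%:R by rewrite ltr0n.
    apply: (@le_trans _ _ (P (increment B 0 k%:R @^-1` `[- x0, m - x0]%classic))).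
      apply: le_measure; rewrite ?inE//.
        rewrite -[X in measurable X]setTI; apply: (increment_measurable HB) => //.
      move=> w /(_ k nk)/= /andP[B0 Bm]; rewrite in_itv/= /increment.
      case: HB => _ -> _ _; rewrite lerBrDr addNr (ltW B0)/= lerD2r; exact: ltW.
    rewrite (increment_law HB)// subr0.
    apply: (le_trans (normal_prob_itv _ _)); first by rewrite sqrtr_gt0.
      by rewrite -subr_ge0 opprK subrK ltW.
    by rewrite lee_fin opprK subrK.
  have [k0 [k0n k0e]] : exists k, ((0 < k)%N /\ (n <= k)%N) /\ normal_peak (Num.sqrt (k%:R : R)) * m <= e.
    have me0 : 0 <= m / e by rewrite divr_ge0// ltW.
    have := archi_boundP (sqr_ge0 (m / e)); set b := Num.bound _ => kP.
    (* [b] exceeds the square of [m / e], so the square root of [k] is at least [m / e]; the factor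
       [2 pi] in the peak is at least 1 and is dropped. *)
    pose k := (maxn b n).+1.
    have K0 : (0 : R) < k%:R by rewrite ltr0n.
    exists k; split; first by split => //; rewrite /k ltnW// ltnS leq_maxr.
    have sk0 : 0 < Num.sqrt (k%:R : R) by rewrite sqrtr_gt0.
    apply: (@le_trans _ _ ((Num.sqrt k%:R)^-1 * m)).
      apply: ler_wpM2r; first exact: ltW.
      rewrite /normal_peak sqr_sqrtr ?ler0n// lef_pV2 ?posrE//; last first.
        by rewrite sqrtr_gt0 mulrn_wgt0// mulr_gt0// pi_gt0.
      apply: ler_wsqrtr; rewrite -[_ * pi *+ 2]mulr_natr -mulrA; apply: ler_peMr; first exact: ltW.
      by have := pi_ge2 R; lra.
    rewrite mulrC ler_pdivrMr// mulrC -ler_pdivrMr//.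
    rewrite -(ger0_norm me0) -sqrtr_sqr; apply: ler_wsqrtr; apply: (le_trans (ltW kP)).
    by rewrite ler_nat /k leqW// leq_maxl.
  apply: (le_trans (Hk k0 k0n.1 k0n.2)); by rewrite lee_fin.
exists (\bigcup_n E n); split.
- exact: bigcup_measurable.
- apply/eqP; rewrite -measure_le0; apply: (le_trans (measure_sigma_subadditive _ _ _ (@subset_refl _ _))) => //.
  - exact: bigcup_measurable.
  - by rewrite eseries0// => n _ _; exact: PE.
- move=> w /= /existsNP[n Hn]; exists n => // k /= nk.
  apply/andP; split; rewrite ltNge; apply/negP => Bk; apply: Hn; exists k => //; by [left|right].
Qed.

End optional_stopping_theorem.

(** * The absorbed process *)

Section absorbed_path.
Context {R : realType}.
Variables (b x : R -> R).
Hypothesis b0 : 0 < b 0.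
Hypothesis cb : path_continuous b.
Hypothesis xb : forall t, 0 <= t ->
  x t = if `[< exists2 s, 0 <= s <= t & b s = 0 >] then 0 else b t.

(** Encoded as the first time with [b <= 0], so as to be an instance of [hit]; for a path starting
    above 0 this is the first zero, by the intermediate value theorem. *)
Definition absorption := hit 0 (fun t => - b t).

Let cNb : path_continuous (fun t => - b t).
Proof.
apply/path_continuousP => t e t0 e0; have [d d0 H] := (path_continuousP b).1 cb t e t0 e0.
by exists d => // s s0 /(H s s0); rewrite -opprD normrN.
Qed.

Lemma absorption_gt t : 0 <= t -> (t%:E < absorption)%E -> 0 < b t.
Proof. by move=> t0 tz; have := hit_before t0 _ tz; rewrite oppr_lt0 lee_fin; exact. Qed.

Lemma absorption_zero r : absorption = r%:E -> 0 <= r /\ b r = 0.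
Proof.
move=> zr; have [r0 _ br] := hit_attained cNb zr; split => //.
apply/eqP; rewrite eq_le; apply/andP; split; first by rewrite -oppr_ge0.
rewrite leNgt; apply/negP => br0.
have [|c] := @IVT _ b 0 r 0 r0 (path_continuous_itv (lexx 0) cb).
  by rewrite ge_min le_max (ltW br0) (ltW b0) orbT.
rewrite in_itv/= => /andP[c0 cr] bc.
have rc : r <= c by rewrite -lee_fin -zr; apply: hit_le; rewrite ?lee_fin// bc oppr0.
have cr' : c = r by apply/eqP; rewrite eq_le cr rc.
by move: br0; rewrite -cr' bc ltxx.
Qed.

Lemma absorbedE t : 0 <= t -> x t = if (absorption <= t%:E)%E then 0 else b t.
Proof.
move=> t0; rewrite xb//; congr (if _ then _ else _); apply/asboolP/idP.
- move=> [s /andP[s0 st] bs]; apply: (@le_trans _ _ s%:E); last by rewrite lee_fin.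
  by apply: hit_le; rewrite ?lee_fin// bs oppr0.
- case zr : absorption (hit_ge0 0 (fun t => - b t)) => [r| |]//; rewrite -/absorption zr.
    rewrite !lee_fin => r0 rt; have [_ br] := absorption_zero zr.
    by exists r => //; rewrite r0.
  by rewrite leNgt ltNyr.
Qed.

Lemma absorbed_eq t : 0 <= t -> (t%:E <= absorption)%E -> x t = b t.
Proof.
move=> t0 tz; rewrite absorbedE//; case: ifPn => // zt.
have zE : absorption = t%:E by apply/eqP; rewrite eq_le zt tz.
by have [_ ->] := absorption_zero zE.
Qed.

Lemma absorbed_ge0 t : 0 <= t -> 0 <= x t.
Proof.
move=> t0; rewrite absorbedE//; case: ifPn => //; rewrite -ltNge => tz.
exact/ltW/absorption_gt.
Qed.

Lemma absorbed_eq0 t : 0 <= t -> (x t = 0) <-> (absorption <= t%:E)%E.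
Proof.
move=> t0; rewrite absorbedE//; case: ifPn => //; rewrite -ltNge => tz.
by split => // bt; have := absorption_gt t0 tz; rewrite bt ltxx.
Qed.

Lemma absorbed_inf : ereal_inf (EFin @` [set t | 0 <= t /\ x t = 0]) = absorption.
Proof.
apply/eqP; rewrite eq_le; apply/andP; split; last first.
  by apply: le_ereal_inf_tmp => _ [t [t0 /(absorbed_eq0 t0) zt] <-].
case zr : absorption (hit_ge0 0 (fun t => - b t)) => [r| |]//; rewrite -/absorption zr.
  rewrite lee_fin => r0; apply: ge_ereal_inf; exists r%:E => //; exists r => //.
  by split => //; apply/(absorbed_eq0 r0); rewrite zr.
- by move=> _; rewrite leey.
- by rewrite leNgt ltNyr.
Qed.

(** [x] is [b] run with a clock that stops at [absorption], and this clock [m] is 1-Lipschitz. *)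
Lemma absorbed_continuous : path_continuous x.
Proof.
pose m t := fine (mine t%:E absorption).
have z0 : (0 <= absorption)%E := hit_ge0 _ _.
have mt t : 0 <= t -> x t = b (m t) /\ 0 <= m t.
  move=> t0; rewrite absorbedE// /m; have [zt|zt] := leP absorption t%:E.
    case zr : absorption zt z0 => [r| |]// _ _.
    by have [r0 ->] := absorption_zero zr.
  by [].
have mlip s t : `|m s - m t| <= `|s - t|.
  rewrite /m; case: absorption z0 => [r| |]//; last by rewrite !min_l ?leey.
  rewrite lee_fin => r0; rewrite -!EFin_min/=.
  have := ler_norm (s - t); have := ler_norm (t - s); rewrite distrC => h1 h2.
  by rewrite ler_norml; case: (leP s r) => sr; case: (leP t r) => tr; apply/andP; split; lra.
apply/path_continuousP => t e t0 e0; have [xt mt0] := mt t t0.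
have [d d0 H] := (path_continuousP b).1 cb _ e mt0 e0.
exists d => // s s0 st; have [-> ms0] := mt s s0; rewrite xt.
by apply: H => //; apply: le_lt_trans st.
Qed.

End absorbed_path.

Section path_operations.
Context {R : realType}.

Lemma path_continuous_comp (g f : R -> R) : continuous g -> path_continuous f ->
  path_continuous (g \o f).
Proof.
move=> cg; rewrite /path_continuous !subspace_continuousP => cf t t0.
exact: (cvg_comp f g (cf t t0) (cg (f t))).
Qed.

Lemma path_continuousB (f g : R -> R) : path_continuous f -> path_continuous g ->
  path_continuous (fun t => f t - g t).
Proof.
rewrite /path_continuous !subspace_continuousP => cf cg t t0.
by apply: cvgB; [exact: cf|exact: cg].
Qed.

Lemma path_continuousM (f g : R -> R) : path_continuous f -> path_continuous g ->
  path_continuous (fun t => f t * g t).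
Proof.
rewrite /path_continuous !subspace_continuousP => cf cg t t0.
by apply: cvgM; [exact: cf|exact: cg].
Qed.

Lemma path_continuous_cst (c : R) : path_continuous (fun=> c).
Proof. by rewrite /path_continuous subspace_continuousP => t t0; exact: cvg_cst. Qed.

(** A continuous path that is negative at the start cannot jump over 0, so the inequality in [hit]
    is an equality at the hitting time. *)
Lemma hit_value (f : R -> R) (r u : R) : path_continuous f -> 0 <= r -> f r < 0 ->
  hit r%:E f = u%:E -> f u = 0 /\ r <= u.
Proof.
move=> cf r0 fr hu; have [u0 ru fu] := hit_attained cf hu.
rewrite lee_fin in ru; split => //.
have [|c] := @IVT _ f r u 0 ru (path_continuous_itv r0 cf).
  by rewrite ge_min le_max (ltW fr) fu orbT.
rewrite in_itv/= => /andP[rc cu] fc.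
have uc : u <= c.
  by rewrite -lee_fin -hu; apply: hit_le; rewrite ?fc// ?lee_fin// (le_trans r0).
by have -> : u = c by apply/eqP; rewrite eq_le uc cu.
Qed.

End path_operations.

Section measurable_stopped_value.
Context {R : realType} {d : measure_display} {T : measurableType d}.
Variables (G : set (set T)) (Y : R -> T -> R) (tau : T -> \bar R).
Let T' := g_sigma_algebraType G.
Hypothesis mY : forall q, 0 <= q -> measurable_fun setT (Y q : T' -> R).
Hypothesis cY : forall w, path_continuous (Y^~ w).
Hypothesis tau0 : forall w, (0 <= tau w)%E.
Hypothesis mtau : forall q, 0 <= q -> <<s G >> [set w | (tau w <= q%:E)%E].

Lemma measurable_time : measurable_fun setT (tau : T' -> \bar R).
Proof.
apply: (measurability _ (ErealGenOInfty.measurableE R)) => // _ [_ [q ->] <-].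
rewrite setTI; have [q0|q0] := leP 0 q.
  rewrite (_ : _ @^-1` _ = ~` [set w | (tau w <= q%:E)%E]).
    by apply: measurableC; exact: mtau.
  by apply/seteqP; split => w /=; rewrite in_itv/= andbT ltNge => /negP.
rewrite (_ : _ @^-1` _ = setT)//; apply/seteqP; split => w //= _.
by rewrite in_itv/= andbT (lt_le_trans _ (tau0 w))// lte_fin.
Qed.

(** Evaluates [Y] at [tau] rounded down to the mesh. The rounded time need not be a stopping time,
    but it takes countably many values, which is enough for measurability; an infinite [tau] gets
    the default value of [stopped]. *)
Let grid_value (k : nat) (w : T) : R :=
  if tau w is r%:E then Y ((Num.truncn (r * k.+1%:R))%:R / k.+1%:R) w else 0.

Let measurable_grid_value k : measurable_fun setT (grid_value k : T' -> R).
Proof.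
move=> _ A mA; rewrite setTI.
pose t_ (j : nat) : R := j%:R / k.+1%:R.
have t0 j : 0 <= t_ j by rewrite divr_ge0.
have -> : grid_value k @^-1` A =
    (\bigcup_j ([set w | ((t_ j)%:E <= tau w)%E] `&` [set w | (tau w < (t_ j.+1)%:E)%E] `&` Y (t_ j) @^-1` A))
    `|` ([set w | (tau w = +oo)%E] `&` [set _ | A 0]).
  apply/seteqP; split => w /=; rewrite /grid_value.
  - case E : (tau w) (tau0 w) => [r| |]//; last by move=> _ A0; right.
    rewrite lee_fin => r0 Ar; left; exists (Num.truncn (r * k.+1%:R)) => //.
    have rk : 0 <= r * k.+1%:R by rewrite mulr_ge0.
    have /andP[h1 h2] := truncn_itv rk.
    split => //=; rewrite E; split; rewrite ?lee_fin ?lte_fin /t_.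
      by rewrite ler_pdivrMr.
    by rewrite ltr_pdivlMr.
  - move=> [[j _ [[]]]|[-> //]] /=.
    case: (tau w) (tau0 w) => [r| |]//.
    rewrite !lee_fin lte_fin => r0; rewrite /t_ ler_pdivrMr// ltr_pdivlMr// => h1 h2.
    suff -> : Num.truncn (r * k.+1%:R) = j by [].
    by apply: truncn_def; rewrite h1 h2.
have mt := measurable_time.
apply: measurableU.
  apply: bigcupT_measurable => j; apply: measurableI; last first.
    by have := mY (t0 j) measurableT mA; rewrite setTI.
  apply: measurableI.
    by have := emeasurable_fun_c_infty measurableT mt (t_ j)%:E; rewrite setTI.
  by have := emeasurable_fun_infty_o measurableT mt (t_ j.+1)%:E; rewrite setTI.
apply: measurableI.
  by have := mt measurableT _ (@emeasurable_set1 R +oo%E); rewrite setTI.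
have [A0|A0] := pselect (A 0).
  by rewrite (_ : [set _ | _] = setT)//; apply/seteqP; split.
by rewrite (_ : [set _ | _] = set0)//; apply/seteqP; split.
Qed.

Lemma measurable_stopped : measurable_fun setT (stopped Y tau : T' -> R).
Proof.
apply: (measurable_fun_cvg measurable_grid_value) => w _.
rewrite /grid_value /stopped; case: (tau w) (tau0 w) => [r| |]//; last by move=> _; exact: cvg_cst.
rewrite lee_fin => r0; apply/cvgrPdist_lt => e e0.
have [dl dl0 H] := (path_continuousP _).1 (@cY w) r e r0 e0.
have := near_infty_natSinv_lt (PosNum dl0); apply: filterS => k /= kd.
rewrite distrC; apply: H; first by rewrite divr_ge0.
have rk : 0 <= r * k.+1%:R by rewrite mulr_ge0.
have /andP[h1 h2] := truncn_itv rk.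
have e1 : (Num.truncn (r * k.+1%:R))%:R / k.+1%:R <= r by rewrite ler_pdivrMr.
rewrite distrC ger0_norm ?subr_ge0//; apply: lt_trans kd.
by rewrite ltrBlDr -[X in _ < X + _]mul1r -mulrDl ltr_pdivlMr// addrC natr1.
Qed.

End measurable_stopped_value.

Section absorbed_process.
Context {R : realType} {d : measure_display} {T : measurableType d}.
Variables (P : probability T R) (x0 : R) (B X : R -> T -> R).
Hypothesis x00 : 0 < x0.
Hypothesis HB : brownian_from P x0 B.
Hypothesis HX : absorbed_at0 B X.

Let cB w : path_continuous (B^~ w). Proof. by case: HB => _ _ + _; exact. Qed.
Let B0 w : 0 < B 0 w. Proof. by case: HB => _ -> _ _. Qed.
Let xb w t : 0 <= t -> X t w = if `[< exists2 s, 0 <= s <= t & B s w = 0 >] then 0 else B t w.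
Proof. exact: HX. Qed.

Let z w := absorption (B^~ w).
Let gen t := [set S | exists s (A : set R), 0 <= s <= t /\ measurable A /\ S = B s @^-1` A].
Let genX := [set S | exists t (A : set R), 0 <= t /\ measurable A /\ S = X t @^-1` A].

Lemma absorption_time w : H0 X w = z w.
Proof. exact: (absorbed_inf (@B0 w) (@cB w) (@xb w)). Qed.

Lemma process_ge0 t w : 0 <= t -> 0 <= X t w.
Proof. exact: (absorbed_ge0 (@B0 w) (@cB w) (@xb w)). Qed.

Lemma process_continuous w : path_continuous (X^~ w).
Proof. exact: (absorbed_continuous (@B0 w) (@cB w) (@xb w)). Qed.

Lemma process_start w : X 0 w = x0.
Proof.
have B0w : B 0 w = x0 by case: HB => _ -> _ _.
rewrite (absorbed_eq (@B0 w) (@cB w) (@xb w))//; exact: hit_ge0.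
Qed.

Lemma process_history t : 0 <= t -> measurable_fun setT (X t : g_sigma_algebraType (gen t) -> R).
Proof.
move=> t0.
rewrite (_ : X t = (fun w => if (z w <= t%:E)%E then 0 else B t w)); last first.
  by apply/funext => w; exact: (absorbedE (@B0 w) (@cB w) (@xb w)).
apply: measurable_fun_ifT => //; last by apply: history_fun; rewrite t0 lexx.
apply: (measurable_fun_bool true); rewrite setTI.
apply: (@measurable_hit _ _ (gen t) (cst 0%E) (fun s w => - B s w)) => //.
- move=> q /andP[q0 qt].
  have -> : [set w : T | (cst 0 w <= q%:E)%E] = setT.
    by apply/seteqP; split => w //= _; rewrite lee_fin.
  exact: (@measurableT _ (g_sigma_algebraType (gen t))).
- move=> q qt; apply: measurableT_comp; first exact: oppr_measurable.
  exact: history_fun.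
- by move=> w; apply: (path_continuous_comp (g := -%R)); [exact: opp_continuous|exact: cB].
Qed.

Lemma filt_history t A : filt X t A -> history B t A.
Proof.
apply: generatedS => _ [s [C [/andP[s0 st] [mC ->]]]].
apply: (@history_le _ _ _ B s _ _ (ltW st)).
by have := process_history s0 measurableT mC; rewrite setTI.
Qed.

Lemma filt_proc_sigma t A : filt X t A -> proc_sigma X A.
Proof.
apply: generatedS => _ [s [C [/andP[s0 _] [mC ->]]]].
by apply: sub_sigma_algebra; exists s, C.
Qed.

Lemma proc_sigma_measurable A : proc_sigma X A -> measurable A.
Proof.
apply: generated_measurable => _ [s [C [s0 [mC ->]]]].
apply: (brownian_history_measurable HB (t := s)).
by have := process_history s0 measurableT mC; rewrite setTI.
Qed.

Lemma process_proc_sigma t : 0 <= t -> measurable_fun setT (X t : g_sigma_algebraType genX -> R).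
Proof. by move=> t0 _ A mA; rewrite setTI; apply: sub_sigma_algebra; exists t, A. Qed.

Lemma proc_sigma_measurable_fun d' (S : measurableType d') (f : T -> S) :
  measurable_fun setT (f : g_sigma_algebraType genX -> S) -> measurable_fun setT f.
Proof.
move=> mf _ A mA; apply: proc_sigma_measurable.
exact: mf.
Qed.

Section admissible_time.
Variable sigma : T -> \bar R.
Hypothesis Hs : admissible X sigma.

Lemma admissible_stopping_time : stopping_time B sigma.
Proof. by case: Hs => s0 _ ms; split => // q q0; apply: filt_history; exact: ms. Qed.

Let s0 w : (0 <= sigma w)%E. Proof. by case: Hs. Qed.

Lemma admissible_le_absorption w : (sigma w <= z w)%E.
Proof. by rewrite -absorption_time; case: Hs. Qed.

(** Measurability is wanted for the sigma-algebra of the player's own process, since independence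
    across players is stated for these. *)
Lemma stopped_proc_sigma : measurable_fun setT (stopped X sigma : g_sigma_algebraType genX -> R).
Proof.
apply: measurable_stopped => //.
- exact: process_proc_sigma.
- exact: process_continuous.
- by move=> q q0; apply: (@filt_proc_sigma q); case: Hs => _ _; exact.
Qed.

Lemma stopped_measurable : measurable_fun setT (stopped X sigma).
Proof. by apply: proc_sigma_measurable_fun; exact: stopped_proc_sigma. Qed.

Lemma stopped_ge0 w : 0 <= stopped X sigma w.
Proof.
by rewrite /stopped; case: (sigma w) (s0 w) => [r| |]//; rewrite lee_fin; exact: process_ge0.
Qed.

Lemma stopped_brownian w r : sigma w = r%:E -> [/\ 0 <= r, stopped X sigma w = B r w & X r w = B r w].
Proof.
move=> sr; have r0 : 0 <= r by rewrite -lee_fin -sr.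
have e : X r w = B r w.
  by apply: (absorbed_eq (@B0 w) (@cB w) (@xb w)) => //; rewrite -sr admissible_le_absorption.
by split => //; rewrite /stopped sr.
Qed.

(** By continuity a time with value above [y] can be moved slightly to the right to a rational one,
    still after [sigma]. The restriction to times before absorption drops out because [X] is 0
    afterwards and [y >= 0]. *)
Lemma Msup_gt w (y : R) : 0 <= y -> (y%:E < Msup X sigma w)%E <->
  exists q : rat, [/\ 0 <= (ratr q : R), (sigma w <= (ratr q)%:E)%E & y < X (ratr q) w].
Proof.
move=> y0; split.
  move=> /ereal_sup_gt[_ [t [st tH] <-]]; rewrite lte_fin => yX.
  have t0 : 0 <= t by rewrite -lee_fin (le_trans (s0 w)).
  have e0 : 0 < X t w - y by rewrite subr_gt0.
  have [dl dl0 H] := (path_continuousP _).1 (@process_continuous w) t _ t0 e0.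
  have : t < t + dl by rewrite ltrDl.
  move=> /rat_in_itvoo[q]; rewrite in_itv/= => /andP[tq qd].
  have q0 : 0 <= (ratr q : R) by rewrite (le_trans t0)// ltW.
  exists q; split => //; first by rewrite (le_trans st)// lee_fin ltW.
  have := H _ q0; rewrite ger0_norm ?subr_ge0 ?(ltW tq)// ltrBlDl qd => /(_ isT).
  by rewrite ltr_norml => /andP[+ _]; rewrite opprB ltrBrDr subrK.
move=> [q [q0 sq yX]]; apply: (@lt_le_trans _ _ (X (ratr q) w)%:E); first by rewrite lte_fin.
apply: ereal_sup_ubound; exists (ratr q) => //; split => //.
rewrite absorption_time leNgt; apply/negP => /ltW zq.
have := (absorbed_eq0 (@B0 w) (@cB w) (@xb w) q0).2 zq.
by move=> X0; move: yX; rewrite X0 ltNge y0.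
Qed.

Lemma Msup_proc_sigma : measurable_fun setT (Msup X sigma : g_sigma_algebraType genX -> \bar R).
Proof.
pose T' := g_sigma_algebraType genX.
have ms q : 0 <= q -> measurable ([set w | (sigma w <= q%:E)%E] : set T').
  by move=> q0; apply: (@filt_proc_sigma q); case: Hs => _ _; exact.
apply: (measurability _ (ErealGenOInfty.measurableE R)) => // _ [_ [y ->] <-].
rewrite setTI; have [y0|y0] := leP 0 y.
  rewrite (_ : _ @^-1` _ = \bigcup_(q in [set q : rat | 0 <= (ratr q : R)])
     ([set w | (sigma w <= (ratr q)%:E)%E] `&` [set w | y < X (ratr q) w])); last first.
    apply/seteqP; split => w /=; rewrite in_itv/= andbT.
      by move=> /(Msup_gt w y0)[q [q0 sq yX]]; exists q.
    by move=> [q q0 [sq yX]]; apply/Msup_gt => //; exists q.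
  rewrite bigcup_mkcond; apply: bigcupT_measurable_rat => q; case: ifPn => // /set_mem/= q0.
  apply: measurableI; first exact: ms.
  rewrite (_ : [set w | _] = X (ratr q) @^-1` `]y, +oo[%classic).
    by have := process_proc_sigma q0 measurableT (measurable_itv `]y, +oo[); rewrite setTI.
  by apply/seteqP; split => w /=; rewrite in_itv/= andbT.
(* For negative [y] the event is that [sigma] is finite: then some nonnegative value enters the
   supremum, whereas for infinite [sigma] the supremum is over the empty set. *)
rewrite (_ : _ @^-1` _ = \bigcup_n [set w | (sigma w <= n%:R%:E)%E]); last first.
  apply/seteqP; split => w /=; rewrite in_itv/= andbT.
    move=> /ereal_sup_gt[_ [t [st tH] <-]] _.
    have t0 : 0 <= t by rewrite -lee_fin (le_trans (s0 w)).
    exists (Num.truncn t).+1 => //=; rewrite (le_trans st)// lee_fin ltW//.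
    by have /andP[] := truncn_itv t0.
  move=> [n _ /= sn]; case sr : (sigma w) (s0 w) sn => [r| |]// r0 _.
  rewrite lee_fin in r0.
  apply: (@lt_le_trans _ _ (X r w)%:E); first by rewrite lte_fin (lt_le_trans y0)// process_ge0.
  apply: ereal_sup_ubound; exists r => //; split; first by rewrite sr.
  by rewrite absorption_time -sr admissible_le_absorption.
by apply: bigcupT_measurable => n; exact: ms.
Qed.

Lemma Msup_measurable : measurable_fun setT (Msup X sigma).
Proof. by apply: proc_sigma_measurable_fun; exact: Msup_proc_sigma. Qed.

(** Up to absorption [B] is nonnegative, so Fatou's lemma applies to the values at [min(sigma, n)],
    each of mean [x0]. Where [sigma] is infinite, the default value 0 lies below the lower limit. *)
Theorem stopped_mean_le : (\int[P]_w (stopped X sigma w)%:E <= x0%:E)%E.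
Proof.
have Hst := admissible_stopping_time.
pose V n w := (stopped_at B sigma n w)%:E.
have V0 n w : (0 <= V n w)%E.
  rewrite lee_fin /stopped_at.
  have m0 : 0 <= fine (mine (sigma w) n%:R%:E) by rewrite fine_ge0// le_min s0 lee_fin ler0n.
  rewrite -(absorbed_eq (@B0 w) (@cB w) (@xb w))//.
    exact: process_ge0.
  rewrite fineK; first by rewrite ge_min admissible_le_absorption.
  rewrite ge0_fin_numE; first by rewrite gt_min ltry orbT.
  by rewrite le_min s0 lee_fin ler0n.
have mV n : measurable_fun setT (V n).
  by apply/measurable_EFinP; have [] := optional_stopping HB n Hst.
apply: (@le_trans _ _ (\int[P]_w limn_einf (V^~ w))%E).
  apply: le_integralT => w.
  case sr : (sigma w) (s0 w) => [r| |]//; last first.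
    rewrite /stopped sr => _; rewrite limn_einf_lim; apply: lime_ge; first exact: is_cvg_einfs.
    by apply: nearW => n; apply: le_ereal_inf_tmp => _ [k _ <-]; exact: V0.
  rewrite lee_fin => r0.
  rewrite (_ : limn_einf _ = (stopped X sigma w)%:E)//.
  apply: (fun u l H => (@cvg_limn_einf_sup R u l H).1).
  apply: cvg_near_cst; exists (Num.truncn r).+1 => // n /= rn.
  have [_ -> _] := stopped_brownian sr.
  rewrite /V /stopped_at sr min_l// lee_fin.
  have /andP[_ /ltW h] := truncn_itv r0; apply: (le_trans h).
  by rewrite ler_nat.
apply: (le_trans (fatou _ _ _ _)) => //.
rewrite (_ : limn_einf _ = x0%:E)//.
apply: (fun u l H => (@cvg_limn_einf_sup R u l H).1).
apply: cvg_near_cst; apply: nearW => n.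
by have [_ _] := optional_stopping HB n Hst.
Qed.

(** * Reaching a level after having stopped below it *)

Section exit_below_level.
Variable m : R.
Hypothesis m0 : 0 < m.

(** Negative exactly for [B] strictly between 0 and [m], so the exit from this interval is a [hit].
    If [B] is already outside at a finite [sigma], then [rho] equals [sigma]. *)
Let Z t w := B t w * (B t w - m).
Let rho w := hit (sigma w) (Z^~ w).

Let cZ w : path_continuous (Z^~ w).
Proof.
apply: path_continuousM => //; apply: path_continuousB => //.
exact: path_continuous_cst.
Qed.

Let Z_lt0 t w : 0 < B t w < m -> Z t w < 0.
Proof. by move=> /andP[b bm]; rewrite /Z pmulr_rlt0// subr_lt0. Qed.

Let Z_lt0' t w : Z t w < 0 -> 0 < B t w < m.
Proof.
rewrite /Z => Z0; have [b|b] := leP (B t w) 0.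
  by move: Z0; rewrite ltNge mulr_le0// subr_le0 (le_trans b)// ltW.
by rewrite /= -subr_lt0 -(pmulr_rlt0 _ b).
Qed.

Let rho_stopping : stopping_time B rho.
Proof.
split; first by move=> w; exact: hit_ge0.
move=> q q0; apply: (@measurable_hit _ _ (gen q) sigma Z) => //.
- move=> t /andP[t0 tq]; apply: (@history_le _ _ _ B t) => //.
  exact: admissible_stopping_time.2.
- move=> t tq; apply: measurable_funM; first exact: history_fun.
  by apply: measurable_funB; [exact: history_fun|exact: measurable_cst].
Qed.

Let inside w r : sigma w = r%:E -> Z r w < 0 -> forall t, r <= t -> (t%:E <= rho w)%E ->
  0 <= B t w <= m.
Proof.
move=> sr Zr t rt; have [r0 _ _] := stopped_brownian sr.
have t0 := le_trans r0 rt.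
rewrite le_eqVlt => /predU1P[e|tlt]; last first.
  have /Z_lt0'/andP[b bm] : Z t w < 0 by apply: hit_before tlt => //; rewrite sr lee_fin.
  by rewrite !ltW.
have hr : hit r%:E (Z^~ w) = t%:E by rewrite -sr; exact/esym.
have [Zt _] := hit_value (@cZ w) r0 Zr hr.
by move/eqP: Zt; rewrite /Z mulf_eq0 subr_eq0 => /orP[] /eqP ->; rewrite lexx ltW.
Qed.

(** Either the two capped times coincide, or the path stays in [[0, m]] from [sigma] to [rho]. *)
Let stopped_diff_bound n w : `|stopped_at B rho n w - stopped_at B sigma n w| <= m.
Proof.
rewrite /stopped_at.
have [ns|sn] := leP n%:R%:E (sigma w).
  have nr : (n%:R%:E <= rho w)%E by apply: (le_trans ns); exact: hit_ge.
  by rewrite !min_r// subrr normr0 ltW.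
case sr : (sigma w) (s0 w) sn => [r| |]// _; rewrite lte_fin => rn.
have [r0 _ _] := stopped_brownian sr.
have [Zr|Zr] := leP 0 (Z r w).
  have -> : rho w = r%:E.
    apply/eqP; rewrite eq_le; apply/andP; split; last by rewrite -sr; exact: hit_ge.
    by apply: hit_le => //; rewrite sr.
  by rewrite min_l ?lee_fin ?(ltW rn)// subrr normr0 ltW.
rewrite /=.
set v := mine (rho w) n%:R%:E.
have rv : (r%:E <= v)%E by rewrite le_min -{1}sr hit_ge lee_fin ltW.
have vE : v = (fine v)%:E.
  rewrite fineK// ge0_fin_numE; first by rewrite gt_min ltry orbT.
  by apply: le_trans rv; rewrite lee_fin.
have /andP[h1 h2] : 0 <= B (fine v) w <= m.
  apply: (inside sr Zr); first by rewrite -lee_fin -vE.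
  by rewrite -vE ge_min lexx.
have /andP[h3 h4] : 0 <= B r w <= m.
  by apply: (inside sr Zr) => //; rewrite -sr; exact: hit_ge.
by rewrite ler_norml; apply/andP; split; lra.
Qed.

(** The eventual difference: from below [m] the path exits at [m] if it gets there before 0, which
    is the event [m <= Msup], and at 0 otherwise. *)
Let D w : R := if stopped X sigma w < m then
  m * \1_[set w | (m%:E <= Msup X sigma w)%E] w - stopped X sigma w else 0.

Let final w : (forall n : nat, exists2 k : nat, (n <= k)%N & B k%:R w <= 0 \/ m <= B k%:R w) ->
  exists N, forall n, (N <= n)%N ->
     stopped_at B rho n w - stopped_at B sigma n w = D w.
Proof.
move=> leaves; case sr : (sigma w) (s0 w) => [r| |]//; last first.
  (* Infinite [sigma]: the stopped value is 0 by convention and [Msup] is minus infinity, so [D]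
     vanishes, as does the difference. *)
  move=> _; exists 0%N => n _.
  have rr : rho w = +oo%E by apply/eqP; rewrite -leye_eq -sr; exact: hit_ge.
  rewrite /stopped_at sr rr subrr /D /stopped sr m0 indicE memNset/=.
    by rewrite mulr0 subrr.
  rewrite /Msup sr => mM.
  have : ((-oo : \bar R) < m%:E)%E by rewrite ltNyr.
  move=> /lt_le_trans/(_ mM)/ereal_sup_gt[_ [t [+ _] _] _].
  by rewrite leye_eq.
move=> _; have [r0 sX Xr] := stopped_brownian sr.
have [u ru] : exists u, rho w = u%:E.
  have [k kr Bk] := leaves (Num.truncn r).+1.
  have rk : r <= k%:R.
    have /andP[_ /ltW h] := truncn_itv r0; apply: (le_trans h).
    by rewrite ler_nat.
  have Zk : 0 <= Z k%:R w.
    case: Bk => Bk; last by rewrite mulr_ge0 ?subr_ge0// (le_trans (ltW m0)).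
    by rewrite mulr_le0// subr_le0 (le_trans Bk)// ltW.
  have : (rho w <= k%:R%:E)%E by apply: hit_le => //; rewrite sr lee_fin.
  have : (0 <= rho w)%E := hit_ge0 _ _.
  case: (rho w) => [u _ _|_|]; first by exists u.
    by rewrite leye_eq.
  by rewrite leeNy_eq.
have u0 : 0 <= u by rewrite -lee_fin -ru; exact: hit_ge0.
have rleu : r <= u by rewrite -lee_fin -ru -sr; exact: hit_ge.
exists (Num.truncn u).+1 => n nu.
have un : u <= n%:R.
  have /andP[_ /ltW h] := truncn_itv u0; apply: (le_trans h).
  by rewrite ler_nat.
rewrite /stopped_at ru sr !min_l ?lee_fin//= ?(le_trans rleu)//.
have zE := absorption_time w.
have zr : (r%:E <= z w)%E by rewrite -sr admissible_le_absorption.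
rewrite /D sX; case: ltP => [Bm|mB]; last first.
  have Zr : 0 <= Z r w by rewrite mulr_ge0 ?subr_ge0// (le_trans (ltW m0)).
  have ur : u = r.
    apply/eqP; rewrite eq_le rleu andbT -lee_fin -ru.
    by apply: hit_le => //; rewrite sr.
  by rewrite ur subrr.
have Br0 : 0 <= B r w by rewrite -Xr process_ge0.
have [Brpos|Brneg] := ltP 0 (B r w); last first.
  have Br : B r w = 0 by apply/eqP; rewrite eq_le Br0 Brneg.
  have ur : u = r.
    apply/eqP; rewrite eq_le rleu andbT -lee_fin -ru.
    by apply: hit_le => //; rewrite ?sr// /Z Br mul0r.
  rewrite ur subrr Br subr0 indicE memNset ?mulr0//= => mM.
  have zr' : z w = r%:E.
    apply/eqP; rewrite eq_le zr andbT.
    apply/(absorbed_eq0 (@B0 w) (@cB w) (@xb w) r0).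
    by rewrite Xr.
  have : (Msup X sigma w <= 0)%E.
    apply: ge_ereal_sup => _ [t [st tH] <-].
    rewrite lee_fin; move: st tH; rewrite sr zE zr' !lee_fin => rt tr.
    have -> : t = r by apply/eqP; rewrite eq_le tr rt.
    by rewrite Xr Br.
  by move=> /(le_trans mM); rewrite lee_fin leNgt m0.
have Zr : Z r w < 0 by apply: Z_lt0; rewrite Brpos.
have [Zu _] := @hit_value _ (Z^~ w) r u (@cZ w) r0 Zr (etrans (congr1 (hit ^~ _) (esym sr)) ru).
have before t : r <= t -> t < u -> 0 < B t w < m.
  move=> rt tu; have t0 := le_trans r0 rt.
  have tr : (t%:E < rho w)%E by rewrite ru lte_fin.
  have st : (sigma w <= t%:E)%E by rewrite sr lee_fin.
  exact: (Z_lt0' (hit_before t0 st tr)).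
have rz : (r%:E < z w)%E.
  rewrite ltNge; apply/negP => /(absorbed_eq0 (@B0 w) (@cB w) (@xb w) r0).
  by rewrite Xr => e; rewrite e ltxx in Brpos.
(* Absorption cannot precede the exit, because the path is positive from [r] until just before
   [u]. *)
have uz : (u%:E <= z w)%E.
  rewrite leNgt; apply/negP => zu.
  case zc : (z w) rz zu => [c| |]//; rewrite !lte_fin => rc cu.
  have [c0 Bc] := absorption_zero (@B0 w) (@cB w) zc.
  by have := before c (ltW rc) cu; rewrite Bc ltxx.
have Xu : X u w = B u w by apply: (absorbed_eq (@B0 w) (@cB w) (@xb w)).
move/eqP: Zu; rewrite /Z mulf_eq0 subr_eq0 => /orP[] /eqP Bu; last first.
  rewrite Bu indicE mem_set ?mulr1//=.
  apply: ereal_sup_ubound; exists u; last by rewrite Xu Bu.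
  by split; rewrite ?sr ?lee_fin// zE.
rewrite Bu sub0r indicE memNset ?mulr0 ?sub0r//= => mM.
have zu : z w = u%:E.
  apply/eqP; rewrite eq_le uz andbT.
  by apply/(absorbed_eq0 (@B0 w) (@cB w) (@xb w) u0); rewrite Xu.
(* Exit at 0: the supremum is a maximum over [[r, u]] and thus strictly below [m], which excludes
   even [Msup = m]. *)
have [c] := EVT_max rleu (path_continuous_itv r0 (@cB w)).
rewrite in_itv/= => /andP[rc cu] Bc.
have : (Msup X sigma w <= (B c w)%:E)%E.
  apply: ge_ereal_sup => _ [t [st tH] <-].
  move: st tH; rewrite sr zE zu !lee_fin => rt tu.
  rewrite (absorbed_eq (@B0 w) (@cB w) (@xb w)) ?(le_trans r0)//; last by rewrite -/(z w) zu lee_fin.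
  by apply: Bc; rewrite in_itv/= rt.
move=> /(le_trans mM); rewrite lee_fin leNgt => /negP; apply.
move: cu; rewrite le_eqVlt => /predU1P[->|cu]; first by rewrite Bu.
by have /andP[] := before c rc cu.
Qed.

(** The variable [D] integrates to zero by [exit_identity]. This is the averaged form of the passage
    probability [x / m], valid for the whole law of the stopped value without conditioning on it. *)
Theorem hitting_identity :
  (m%:E * P [set w | (stopped X sigma w < m)%R /\ (m%:E <= Msup X sigma w)%E] =
   \int[P]_w (if (stopped X sigma w < m)%R then stopped X sigma w else 0%R)%:E)%E.
Proof.
pose E := [set w | stopped X sigma w < m /\ (m%:E <= Msup X sigma w)%E].
have mst := stopped_measurable.
have mlt : measurable_fun setT (fun w => stopped X sigma w < m).
  exact: measurable_fun_ltr.
have mM : measurable [set w | (m%:E <= Msup X sigma w)%E].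
  by have := emeasurable_fun_c_infty measurableT Msup_measurable m%:E; rewrite setTI.
have mltE : measurable [set w | stopped X sigma w < m].
  by have := mlt measurableT [set true] I; rewrite setTI.
have mE : measurable E by apply: measurableI.
pose f w := if stopped X sigma w < m then stopped X sigma w else 0.
have mf : measurable_fun setT f by apply: measurable_fun_ifT.
have fb w : `|f w| <= m.
  rewrite /f; case: ifP => [h|_]; last by rewrite normr0 ltW.
  by rewrite ger0_norm; [exact: ltW|exact: stopped_ge0].
have DE w : D w = m * \1_E w - f w.
  rewrite /D /f !indicE; case: ifP => h; last by rewrite memNset ?mulr0 ?subr0// => -[]; rewrite h.
  by congr (_ * (_ : bool)%:R - _); apply/idP/idP; rewrite !inE /E/= h => //; case.
have mD : measurable_fun setT D.
  rewrite (_ : D = fun w => m * \1_E w - f w); last exact/funext.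
  by apply: measurable_funB => //; apply: measurable_funM => //; exact: measurable_indic.
have D0 : (\int[P]_w (D w)%:E = 0)%E.
  apply: (exit_identity HB admissible_stopping_time rho_stopping mD stopped_diff_bound).
  by apply: filterS (brownian_leaves_interval HB m0) => w; exact: final.
have iE : P.-integrable setT (EFin \o (fun w => m * \1_E w)).
  apply: (@integrable_bounded _ _ _ _ _ m).
    by apply: measurable_funM => //; exact: measurable_indic.
  by move=> w; rewrite indicE; case: (_ \in _); rewrite ?mulr1 ?mulr0 ?normr0 ?gtr0_norm// ltW.
have if_ : P.-integrable setT (EFin \o f) by exact: integrable_bounded fb.
have : (\int[P]_w ((m * \1_E w)%:E - (f w)%:E) = 0)%E.
  by rewrite -[RHS]D0; apply: eq_integral => w _; rewrite DE EFinB.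
rewrite integralB_EFin//.
have -> : (\int[P]_w (m * \1_E w)%:E = m%:E * P E)%E.
  under eq_integral do rewrite EFinM.
  rewrite ge0_integralZl ?lee_fin ?(ltW m0)//; last exact/measurable_EFinP/measurable_indic.
  by rewrite integral_indic// setIT.
move=> /eqP; rewrite sube_eq; last 2 first.
- by rewrite fin_numM// fin_num_measure.
- by rewrite fin_num_adde_defl// integrable_fin_num.
by rewrite add0e => /eqP.
Qed.

End exit_below_level.

End admissible_time.

Lemma zero_admissible : admissible X (cst 0%E).
Proof.
split => //; first by move=> w; rewrite absorption_time; exact: hit_ge0.
move=> t t0; rewrite (_ : [set w | _] = setT).
  exact: (@measurableT _ (g_sigma_algebraType _)).
by apply/seteqP; split => w //= _; rewrite lee_fin.
Qed.

(** For [sigma = 0] the identity says that a level [m > x0] is reached with probability [x0 / m]. A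
    path that is never absorbed stays positive, hence almost surely reaches every such level; let
    [m] grow. *)
Lemma absorption_finite : {ae P, forall w, (H0 X w < +oo)%E}.
Proof.
pose E := [set w | H0 X w = +oo%E].
have zero w : stopped X (cst 0%E) w = x0 by rewrite /stopped/= process_start.
have HP (m : R) : x0 < m -> (P [set w | (m%:E <= Msup X (cst 0%E) w)%E] = (x0 / m)%:E)%E.
  move=> xm; have m0 := lt_trans x00 xm.
  have := hitting_identity zero_admissible m0.
  rewrite (_ : [set w | _ /\ _] = [set w | (m%:E <= Msup X (cst 0%E) w)%E]); last first.
    by apply/seteqP; split => w /=; [case|rewrite zero].
  under eq_integral do rewrite zero xm.
  have -> : (\int[P]_w x0%:E = x0%:E)%E.
    transitivity (x0%:E * P setT)%E; first exact: integral_cst.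
    by rewrite probability_setT mule1.
  move=> h; rewrite mulrC EFinM -h muleA -EFinM mulVf ?gt_eqF// mul1e//.
have mEc (n : nat) : measurable [set w | (H0 X w <= n%:R%:E)%E].
  rewrite (_ : [set w | _] = X n%:R @^-1` [set 0]).
    apply: proc_sigma_measurable; apply: sub_sigma_algebra.
    by exists n%:R, [set 0].
  apply/seteqP; split => w /=; rewrite absorption_time.
    by move/(absorbed_eq0 (@B0 w) (@cB w) (@xb w) (ler0n _ n)).
  by move/(absorbed_eq0 (@B0 w) (@cB w) (@xb w) (ler0n _ n)).
have EE : E = ~` (\bigcup_n [set w | (H0 X w <= n%:R%:E)%E]).
  apply/seteqP; split => w.
    by move=> /= Ew [n _ /=]; rewrite Ew leye_eq.
  move=> h; apply/eqP; rewrite -leye_eq leNgt; apply/negP => Hfin; apply: h.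
  have : (0 <= H0 X w)%E by rewrite absorption_time; exact: hit_ge0.
  case Hr : (H0 X w) Hfin => [r| |]// _; rewrite lee_fin => r0.
  exists (Num.truncn r).+1 => //=; rewrite Hr lee_fin ltW//.
  by have /andP[] := truncn_itv r0.
have mE : measurable E by rewrite EE; apply: measurableC; apply: bigcupT_measurable.
have PE (m : R) : x0 < m -> (P E <= (x0 / m)%:E)%E.
  move=> xm; have m0 := lt_trans x00 xm.
  have [N [mN PN subN]] := brownian_leaves_interval HB m0.
  have mM : measurable [set w | (m%:E <= Msup X (cst 0%E) w)%E].
    by have := emeasurable_fun_c_infty measurableT (Msup_measurable zero_admissible) m%:E; rewrite setTI.
  apply: (@le_trans _ _ (P ([set w | (m%:E <= Msup X (cst 0%E) w)%E] `|` N))).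
    apply: le_measure; rewrite ?inE//; first exact: measurableU.
    move=> w /= Ew; have [Nw|Nw] := pselect (N w); [by right|left].
    have /contrapT/(_ 0%N)[k _ Bk] : ~ ~ forall n : nat, exists2 k : nat, (n <= k)%N & B k%:R w <= 0 \/ m <= B k%:R w.
      by move=> h; apply: Nw; apply: subN.
    have zw : z w = +oo%E by rewrite -absorption_time.
    have Xk : X k%:R w = B k%:R w.
      by apply: (absorbed_eq (@B0 w) (@cB w) (@xb w)); rewrite -/(z w) ?zw ?leey.
    have Bpos : 0 < B k%:R w.
      by apply: (absorption_gt (b := B^~ w)); rewrite -/(z w) ?zw ?ltry.
    case: Bk => [Bk|Bk]; first by move: Bpos; rewrite ltNge Bk.
    apply: (@le_trans _ _ (X k%:R w)%:E); first by rewrite lee_fin Xk.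
    apply: ereal_sup_ubound; exists k%:R => //; split; first by rewrite lee_fin.
    by rewrite Ew leey.
  apply: (le_trans (measureU2 _ mM mN)).
  rewrite -[leRHS]adde0; apply: leeD; first by rewrite -(HP _ xm).
  by rewrite -PN.
have PE0 : P E = 0%E.
  apply/eqP; rewrite eq_le measure_ge0 andbT; apply/lee_addgt0Pr => e e0; rewrite add0e.
  (* This level exceeds [x0], and [x0] divided by it is at most [e]. *)
  have xm : x0 < x0 / e + x0 + 1 by rewrite -addrA ltr_wpDl ?ltrDl// divr_ge0// ltW.
  apply: (le_trans (PE _ xm)); rewrite lee_fin ler_pdivrMr ?(lt_trans x00)//.
  rewrite -addrA mulrDr mulrCA divff ?gt_eqF// mulr1 lerDl mulr_ge0// ?ltW//.
  by rewrite addr_gt0.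
exists E; split => // w /= h; apply/eqP; rewrite -leye_eq leNgt; exact/negP.
Qed.

End absorbed_process.

(** * Power laws *)

Section power_law.
Context {R : realType}.
Local Notation lebesgue := (@lebesgue_measure R).

(** With [c = N * x0] this is [Fcdf] for [b = (N - 1)^-1] and the cdf of the best rival value for
    [b = (1 + K)^-1]. *)
Definition power_cdf (c b x : R) : R :=
  if x < 0 then 0 else Num.min ((x / c) `^ b) 1.

Lemma powR_continuous (p x : R) : 0 < x -> {for x, continuous ((@powR R) ^~ p)}.
Proof.
move=> x0; apply: differentiable_continuous; apply/derivable1_diffP.
by apply: derivable_powR; rewrite in_itv/= x0.
Qed.

Lemma powR_le1 (u p : R) : 0 <= u <= 1 -> 0 <= p -> u `^ p <= 1.
Proof.
move=> /andP[u0 u1] p0; have -> : 1 = 1 `^ p :> R by rewrite powR1.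
by apply: ge0_ler_powR; rewrite ?nnegrE.
Qed.

Lemma powR_lt1 (u p : R) : 0 <= u < 1 -> 0 < p -> u `^ p < 1.
Proof.
move=> /andP[u0 u1] p0; have -> : 1 = 1 `^ p :> R by rewrite powR1.
by apply: gt0_ltr_powR; rewrite ?nnegrE.
Qed.

Lemma powR_ge1 (u p : R) : 1 <= u -> 0 <= p -> 1 <= u `^ p.
Proof.
move=> u1 p0; have -> : 1 = 1 `^ p :> R by rewrite powR1.
by apply: ge0_ler_powR; rewrite ?nnegrE// (le_trans ler01).
Qed.

Lemma powR_cvg_right (p u : R) : 0 <= u -> (0 < u) || (0 < p) ->
  x `^ p @[x --> u^'+] --> u `^ p.
Proof.
rewrite le_eqVlt => /predU1P[<-|u0]; last first.
  by move=> _; apply: cvg_at_right_filter; exact: powR_continuous.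
by rewrite ltxx/= => p0; rewrite powR0 ?gt_eqF//; exact: powR_cvg0.
Qed.

Lemma integral_powR (p u : R) : 0 <= u < 1 -> p + 1 != 0 -> (0 < u) || (0 < p) ->
  (\int[lebesgue]_(x in `[u, 1%R]) (x `^ p)%:E = ((1 - u `^ (p + 1)) / (p + 1))%:E)%E.
Proof.
move=> /andP[u0 u1] p1 up.
have up1 : (0 < u) || (0 < p + 1).
  by case/orP: up => [->//|p0]; rewrite ltr_wpDr ?orbT.
have gt0 (x : R) : x \in `]u, 1[ -> 0 < x.
  by rewrite in_itv/= => /andP[ux _]; exact: le_lt_trans ux.
rewrite (@continuous_FTC2 _ (fun x => x `^ p) (fun x => (p + 1)^-1 *: (x `^ (p + 1)))) //.
- rewrite powR1 -EFinB; congr EFin; rewrite /GRing.scale/=; field.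
  exact: p1.
- apply/continuous_within_itvP => //; split.
  + by move=> x /gt0 x0; exact: powR_continuous.
  + exact: powR_cvg_right.
  + by apply: cvg_at_left_filter; apply: powR_continuous.
- split.
  + by move=> x /gt0 x0; apply: derivableZ; apply: derivable_powR; rewrite in_itv/= x0.
  + by apply: cvgZr; exact: powR_cvg_right.
  + by apply: cvgZr; apply: cvg_at_left_filter; apply: powR_continuous.
- move=> x /gt0 x0; rewrite derive1E deriveZ; last first.
    by apply: derivable_powR; rewrite in_itv/= x0.
  rewrite -derive1E powR_derive1 ?in_itv/= ?x0// addrK /GRing.scale/= mulrA mulVf//.
  by rewrite mul1r.
Qed.

End power_law.

Section power_law_variable.
Context {R : realType} {d : measure_display} {T : measurableType d}.
Variables (P : probability T R) (V : T -> R) (c b : R).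
Hypotheses (c0 : 0 < c) (b0 : 0 < b) (mV : measurable_fun setT V).
Hypothesis VP : forall x, P [set w | V w <= x] = (power_cdf c b x)%:E.
Local Notation lebesgue := (@lebesgue_measure R).

Lemma measurable_ray x : measurable [set w | V w <= x].
Proof.
rewrite [X in measurable X](_ : _ = setT `&` V @^-1` `]-oo, x]%classic); last first.
  by apply/seteqP; split => w; rewrite /= in_itv/= => // -[].
by apply: mV.
Qed.

(** The left-hand side contains the quantile function of the law; the lemma is its duality with the
    cdf. *)
Lemma quantile_lt (x u : R) : 0 <= x -> 0 <= u ->
  (x < c * u `^ b^-1) = ((x / c) `^ b < u).
Proof.
move=> x0 u0; rewrite mulrC -ltr_pdivrMr//.
have xc : 0 <= x / c by rewrite divr_ge0// ltW.
apply/idP/idP => h.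
- have : (x / c) `^ b < (u `^ b^-1) `^ b.
    by apply: gt0_ltr_powR => //; rewrite nnegrE ?powR_ge0.
  by rewrite -powRrM mulVf ?gt_eqF// powRr1.
- have : ((x / c) `^ b) `^ b^-1 < u `^ b^-1.
    by apply: gt0_ltr_powR; rewrite ?invr_gt0// nnegrE ?powR_ge0.
  by rewrite -powRrM mulfV ?gt_eqF// powRr1.
Qed.

(** [V] has the law of [c * U ^ (1 / b)] with [U] uniform on [[0, 1]]: the two laws agree on the
    rays []x, +oo[], which generate the Borel sets. *)
Lemma power_law_integral (f : R -> \bar R) : measurable_fun setT f ->
  (forall x, (0 <= f x)%E) ->
  (\int[P]_w f (V w) = \int[lebesgue]_(u in `[0%R, 1%R]) f (c * u `^ b^-1)%R)%E.
Proof.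
move=> mf f0.
pose g (u : measurableTypeR R) : measurableTypeR R := c * u `^ b^-1.
have mg : measurable_fun setT g.
  by apply: measurable_funM => //; exact: measurable_powR.
pose U := uniform_prob (@ltr01 R).
have mVR : measurable_fun setT (V : T -> measurableTypeR R) by move=> _ A mA; exact: mV.
pose V' : {mfun T >-> measurableTypeR R} := HB.pack (V : T -> measurableTypeR R) (isMeasurableFun.Build _ _ _ _ _ mVR).
pose g' : {mfun measurableTypeR R >-> measurableTypeR R} := HB.pack g (isMeasurableFun.Build _ _ _ _ _ mg).
have UE A : measurable A -> U A = lebesgue (A `&` `[0, 1]).
  move=> mA; transitivity (\int[U]_u (\1_A u)%:E)%E; first by rewrite integral_indic// setIT.
  rewrite integral_uniform//.
  - by rewrite subr0 invr1 mul1e integral_indic.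
  - exact/measurable_EFinP/measurable_indic.
have rays x : distribution P V' `]x, +oo[%classic = distribution U g' `]x, +oo[%classic.
  have mVx := measurable_ray x.
  transitivity (1 - power_cdf c b x)%:E.
    transitivity (P (~` [set w | V w <= x])).
      by congr (P _); apply/seteqP; split => w; rewrite /= in_itv/= andbT ltNge => /negP.
    by rewrite probability_setC// EFinB; congr (_ - _)%E; exact: VP.
  apply/esym; transitivity (U (g @^-1` `]x, +oo[)) => //.
  rewrite UE; last by rewrite -[X in measurable X]setTI; apply: (mg).
  rewrite /power_cdf; case: ltP => x0.
    have -> : g @^-1` `]x, +oo[ `&` `[0, 1] = `[0, 1]%classic.
      apply/seteqP; split => u /=; first by case.
      move=> u01; split => //; rewrite in_itv/= andbT (lt_le_trans x0)// mulr_ge0 ?powR_ge0//.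
      exact: ltW.
    by rewrite lebesgue_measure_itv/= lte_fin ltr01 subr0 -EFinB subr0.
  have -> : g @^-1` `]x, +oo[ `&` `[0, 1] = `](x / c) `^ b, 1]%classic.
    apply/seteqP; split => u /=; rewrite !in_itv/= andbT.
    - by move=> [h /andP[u0 u1]]; rewrite -quantile_lt// u1 andbT.
    - move=> /andP[h u1]; have u0 : 0 <= u by rewrite (le_trans _ (ltW h))// powR_ge0.
      by rewrite quantile_lt// h u0.
  rewrite lebesgue_measure_itv/= lte_fin; case: ltP => h.
    by rewrite -EFinB.
  by rewrite subrr.
transitivity (\int[distribution P V']_y f y)%E; first by rewrite ge0_integral_distribution.
transitivity (\int[distribution U g']_y f y)%E.
  apply: eq_measure_integral => A mA _.
  apply: (@measure_unique _ R (measurableTypeR R) (@RGenOInfty.G R) (fun k => `](- k%:R), +oo[%classic)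
    _ _ _ _ (distribution P V') (distribution U g')) => //.
  - exact: RGenOInfty.measurableE.
  - move=> _ _ [x ->] [y ->]; exists (Num.max x y).
    by rewrite predeqE => z; split; rewrite /= !in_itv/= !andbT ?gt_max => /andP.
  - by move=> k; exists (- k%:R).
  - apply/seteqP; split => // x _; exists (Num.truncn `|x|).+1 => //=.
    rewrite in_itv/= andbT ltrNl (le_lt_trans (ler_norm _))// normrN.
    by have /andP[] := truncn_itv (normr_ge0 x).
  - by move=> _ [x ->]; exact: rays.
  - move=> k; apply: le_lt_trans (ltry 1); exact: probability_le1.
rewrite ge0_integral_distribution// integral_uniform//.
- by rewrite subr0 invr1 mul1e.
- exact: measurableT_comp.
- by move=> u; exact: f0.
Qed.

(** This is the mean of [U ^ (1 / b)] for uniform [U]. At [b = (N - 1)^-1] it equals [1 / N], so the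
    equilibrium value is obtained from the law alone. *)
Lemma power_law_mean :
  (\int[P]_w (Num.min (V w / c) 1)%:E = ((b^-1 + 1)^-1)%:E)%E.
Proof.
(* The maximum with 0 makes [f] nonnegative everywhere; almost surely it changes nothing, because
   [V <= 0] has probability 0. *)
pose f (x : R) : \bar R := (Num.max 0 (Num.min (x / c) 1))%:E.
have mf : measurable_fun setT f.
  apply/measurable_EFinP/measurable_maxr => //; apply: measurable_minr => //.
  exact: measurable_funM.
have f0 x : (0 <= f x)%E by rewrite lee_fin le_max lexx.
have b1 : 0 < b^-1 by rewrite invr_gt0.
transitivity (\int[P]_w f (V w))%E.
  apply: ae_eq_integral => //.
  - apply/measurable_EFinP/measurable_minr => //; exact: measurable_funM.
  - exact: measurableT_comp.
  have mV0 := measurable_ray 0.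
  exists [set w | V w <= 0]; split => //.
    transitivity (power_cdf c b 0)%:E; first exact: VP.
    by rewrite /power_cdf ltxx mul0r powR0 ?gt_eqF// minEle ler01.
  move=> w /= h; rewrite leNgt; apply/negP => Vw; apply: h => _.
  congr EFin; rewrite max_r// le_min ler01 andbT divr_ge0// ltW//.
rewrite power_law_integral//.
transitivity (\int[lebesgue]_(u in `[0%R, 1%R]) (u `^ b^-1)%:E)%E.
  apply: eq_integral => u; rewrite inE/= in_itv/= => /andP[u0 u1].
  rewrite /f mulrAC divff ?gt_eqF// mul1r.
  have u1b : u `^ b^-1 <= 1 by apply: powR_le1; [rewrite u0|exact: ltW].
  by rewrite min_l// max_r// powR_ge0.
rewrite integral_powR ?lexx ?ltr01 ?b1 ?orbT//; last by rewrite gt_eqF// addr_gt0.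
by rewrite powR0 ?subr0 ?mul1r// gt_eqF// addr_gt0.
Qed.

(** The quantile map is injective on [[0, 1]], so the preimage of a point has at most one element
    and Lebesgue measure 0. *)
Lemma power_law_atomless y : P [set w | V w = y] = 0%E.
Proof.
have mE : measurable [set y : R] by exact: measurable_set1.
have mW : measurable (V @^-1` [set y]) by rewrite -[X in measurable X]setTI; exact: mV.
transitivity (\int[P]_w (\1_[set y] (V w))%:E)%E.
  transitivity (\int[P]_w (\1_(V @^-1` [set y]) w)%:E)%E; first by rewrite integral_indic// setIT.
  by apply: eq_integral => w _; rewrite !indicE; congr (_%:R%:E); apply/idP/idP; rewrite !inE.
rewrite (@power_law_integral (fun v => (\1_[set y] v)%:E)); last 2 first.
- exact/measurable_EFinP/measurable_indic.
- by move=> x; rewrite lee_fin.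
pose A := (fun u : measurableTypeR R => (c * u `^ b^-1 : measurableTypeR R)) @^-1` [set y].
have mA : measurable A.
  rewrite -[X in measurable X]setTI.
  apply: (measurable_funM (measurable_cst c) (@measurable_powR R b^-1)) => //.
transitivity (lebesgue (A `&` `[0, 1])).
  rewrite -integral_indic//.
apply/eqP; rewrite eq_le measure_ge0 andbT -(lebesgue_measure_set1 ((y / c) `^ b)).
apply: le_measure; rewrite ?inE//; first exact: measurableI.
move=> u [/= <-]; rewrite in_itv/= => /andP[u0 _].
by rewrite mulrAC divff ?gt_eqF// mul1r -powRrM mulVf ?gt_eqF// powRr1.
Qed.

(** The integral equation that selects the exponent. With [z = x / c < 1] and [u0 = z ^ b],
    integrating [z * u ^ (- 1 / b)] over []u0, 1]] gives [(u0 - z) / (1 / b - 1)], since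
    [u0 ^ (1 / b) = z]. In the contest [1 / b - 1 = K]. *)
Lemma power_law_balance x : 0 <= x -> b <= 1 ->
  ((power_cdf c b x)%:E = (Num.min (x / c) 1)%:E +
    (b^-1 - 1)%:E * \int[P]_w (if (x < V w)%R then (x / V w)%R else 0%R)%:E)%E.
Proof.
move=> x0 b1.
have xc0 : 0 <= x / c by rewrite divr_ge0// ltW.
rewrite /power_cdf ltNge x0/=.
(* [powR] with exponent -1 is the inverse wherever [x < v], and it is measurable in [v]. *)
pose f (v : R) : \bar R := (if x < v then x * v `^ (-1) else 0)%:E.
have mf : measurable_fun setT f.
  apply/measurable_EFinP; apply: measurable_fun_if => //.
  - exact: measurable_fun_ltr.
  - by apply: measurable_funTS; apply: measurable_funM => //; apply: measurable_powR.
have f0 v : (0 <= f v)%E.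
  by rewrite lee_fin; case: ltP => // xv; rewrite mulr_ge0// powR_ge0.
transitivity ((Num.min (x / c) 1)%:E + (b^-1 - 1)%:E * \int[P]_w f (V w))%E; last first.
  congr (_ + _ * _)%E; apply: eq_integral => w _; rewrite /f; case: ltP => // xV.
  by rewrite powR_inv1// (le_trans x0)// ltW.
rewrite (power_law_integral mf f0).
pose u0 := (x / c) `^ b.
have fE u : 0 <= u <= 1 -> f (c * u `^ b^-1) = (if u0 < u then x / c * u `^ (- b^-1) else 0)%:E.
  move=> /andP[u_ge0 _]; rewrite /f quantile_lt// -/u0; case: ifP => // _.
  by rewrite powR_inv1 ?mulr_ge0 ?powR_ge0 ?(ltW c0)// powRN invfM mulrA.
have [xc|xc] := leP 1 (x / c).
- have u01 : 1 <= u0 by rewrite powR_ge1// ltW.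
  rewrite integral0_eq; first by rewrite mule0 adde0 min_r.
  move=> u; rewrite /= in_itv/= => u01'; rewrite fE// ltNge (le_trans _ u01)//.
  by case/andP: u01'.
have u01 : u0 <= 1 by rewrite powR_le1 ?xc0 ?ltW.
rewrite min_l//.
move: xc0; rewrite le_eqVlt => /predU1P[xc0|xc0].
  rewrite integral0_eq; first by rewrite mule0 adde0 -xc0 powR0// gt_eqF.
  by move=> u; rewrite /= in_itv/= => u01'; rewrite fE// -xc0 mul0r if_same.
have u00 : 0 < u0 by exact: powR_gt0.
have u0lt : u0 < 1 by rewrite powR_lt1 ?(ltW xc0).
transitivity ((x / c)%:E + (b^-1 - 1)%:E * ((x / c)%:E * \int[lebesgue]_(u in `[u0, 1%R]) (u `^ (- b^-1))%:E))%E; last first.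
  congr (_ + _ * _)%E.
  have mp : measurable_fun setT (fun u : measurableTypeR R => (x / c * u `^ (- b^-1))%:E).
    by apply/measurable_EFinP/measurable_funM => //; exact: measurable_powR.
  rewrite -ge0_integralZl//=; last 3 first.
  - by apply/measurable_EFinP/measurable_funTS; apply: measurable_powR.
  - by move=> u _; rewrite lee_fin powR_ge0.
  - by rewrite lee_fin ltW.
  rewrite -integral_itv_obnd_cbnd; last exact: measurable_funTS.
  have -> : `]u0, 1]%classic = `[0, 1]%classic `&` `]u0, +oo[%classic.
    apply/seteqP; split => u /=; rewrite !in_itv/= ?andbT.
    - by move=> /andP[h ->]; rewrite h (ltW (lt_trans u00 h)).
    - by move=> [/andP[_ ->] ->].
  rewrite integral_mkcondr; apply: eq_integral => u; rewrite inE/= in_itv/= => u01'.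
  by rewrite fE// patchE mem_setE in_itv/= andbT; case: ifP.
(* For [b = 1] the antiderivative would be a logarithm, but the coefficient [b^-1 - 1] vanishes. *)
have [b_eq1|b_neq1] := eqVneq b 1.
  by rewrite /u0 b_eq1 invr1 subrr mul0e adde0 powRr1// ltW.
rewrite integral_powR; last 3 first.
- by rewrite u0lt ltW.
- by rewrite addrC subr_eq0 eq_sym invr_eq1.
- by rewrite u00.
rewrite -!EFinM -EFinD; congr EFin.
have -> : u0 `^ (- b^-1 + 1) = u0 / (x / c).
  rewrite addrC powRB; last by rewrite (gt_eqF u00) implybT.
  rewrite powRr1; last exact: ltW.
  congr (_ / _); rewrite /u0 -powRrM mulfV ?gt_eqF//.
  by rewrite powRr1// ltW.
rewrite -/u0; set z := x / c; have zn : z != 0 by rewrite gt_eqF.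
have bn : - b^-1 + 1 != 0 by rewrite addrC subr_eq0 eq_sym invr_eq1.
have -> : b^-1 - 1 = - (- b^-1 + 1) by ring.
set q := - b^-1 + 1; have qn : q != 0 := bn.
by field; rewrite zn qn.
Qed.

End power_law_variable.

(** * From two-sided difference bounds to the power law *)

Section power_law_recursion.
Context {R : realType}.

Lemma le_of_add_harmonic (a b C : R) (m0 : nat) :
  (forall m : nat, (m0 <= m)%N -> a <= b + C / m.+1%:R) -> a <= b.
Proof.
move=> H; rewrite leNgt; apply/negP => ba.
have e0 : 0 < a - b by rewrite subr_gt0.
pose m := maxn m0 (Num.truncn (`|C| / (a - b))).
have := H m (leq_maxl _ _); rewrite leNgt => /negP; apply.
rewrite -ltrBrDl ltr_pdivrMr// mulrC -ltr_pdivrMr//.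
apply: (@le_lt_trans _ _ (`|C| / (a - b))).
  by rewrite ler_pM2r ?invr_gt0// ler_norm.
have /andP[_ h] := truncn_itv (divr_ge0 (normr_ge0 C) (ltW e0)).
by apply: (lt_le_trans h); rewrite ler_nat ltnS leq_maxr.
Qed.

Variables (N x0 : R) (p : R -> R).
Hypotheses (N1 : 1 < N) (x00 : 0 < x0) (px0 : p x0 = 1) (p0 : forall r, 0 <= p r).
(** Divided by [r - r'] and with [r'] tending to [r], this bound and the next become the two halves
    of (N - 1) r p'(r) = p(r), the differential equation of the power law. Since differentiability
    of [p] is not known, the bounds are iterated instead. *)
Hypothesis lower : forall r' r, 0 < r' -> r' < r -> r <= x0 ->
  (N * r' - r) * (p r - p r') <= (r - r') * p r'.
Hypothesis upper : forall r' r, 0 < r' -> r' < r -> r <= x0 ->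
  (r - r') * p r' <= (N - 1) * r * (p r - p r').

Let geometric_point s k : 0 < s < 1 -> 0 < x0 * s ^+ k <= x0.
Proof.
move=> /andP[s0 s1]; rewrite mulr_gt0 ?exprn_gt0//= ger_pMr//.
by rewrite exprn_ile1// ltW.
Qed.

(** Taking [r' = s * r] in [upper] gives [p (s * r) <= p r * (1 - z)] with [z = (1 - s) / (N - s)],
    and [1 - z <= expR (- z)] turns the product along the grid into an exponential. *)
Lemma geometric_upper s k : 0 < s < 1 ->
  p (x0 * s ^+ k) <= expR (- (k%:R * ((1 - s) / (N - s)))).
Proof.
move=> s01; have /andP[s0 s1] := s01.
have Ns : 0 < N - s by rewrite subr_gt0 (lt_trans s1).
elim: k => [|k IH]; first by rewrite expr0 mulr1 px0 mul0r oppr0 expR0.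
have /andP[r0 rx] := geometric_point k s01.
rewrite exprS [x0 * _]mulrCA; move: r0 rx IH; set r := x0 * s ^+ k => r0 rx IH.
have := upper (mulr_gt0 s0 r0) _ rx; rewrite gtr_pMl// => /(_ s1) h.
have h1 : p (s * r) <= p r * (1 - (1 - s) / (N - s)).
  have e : (1 - s) * p (s * r) <= (N - 1) * (p r - p (s * r)).
    by rewrite -(ler_pM2r r0); move: h; congr (_ <= _); ring.
  have -> : 1 - (1 - s) / (N - s) = (N - 1) / (N - s).
    by field; rewrite gt_eqF.
  rewrite mulrA ler_pdivlMr//; lra.
apply: (le_trans h1).
set z := (1 - s) / (N - s) in h1 IH *.
have -> : k.+1%:R * z = k%:R * z + z by rewrite -natr1 mulrDl mul1r.
rewrite opprD expRD; apply: ler_pM => //.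
  by rewrite /z subr_ge0 ler_pdivrMr// mul1r lerD2r ltW.
exact: expR_ge1Dx.
Qed.

(** Taking [r' = s * r] in [lower] gives [p r <= (1 + z) * p (s * r)] with
    [z = (1 - s) / (N * s - 1)]; dividing by that denominator is where [1 < N * s] enters. *)
Lemma geometric_lower s k : 0 < s < 1 -> 1 < N * s ->
  expR (- (k%:R * ((1 - s) / (N * s - 1)))) <= p (x0 * s ^+ k).
Proof.
move=> s01 Ns1; have /andP[s0 s1] := s01.
have Ns : 0 < N * s - 1 by rewrite subr_gt0.
elim: k => [|k IH]; first by rewrite expr0 mulr1 px0 mul0r oppr0 expR0.
have /andP[r0 rx] := geometric_point k s01.
rewrite exprS [x0 * _]mulrCA; move: r0 rx IH; set r := x0 * s ^+ k => r0 rx IH.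
have := lower (mulr_gt0 s0 r0) _ rx; rewrite gtr_pMl// => /(_ s1) h.
have h1 : p r <= (1 + (1 - s) / (N * s - 1)) * p (s * r).
  have e : (N * s - 1) * (p r - p (s * r)) <= (1 - s) * p (s * r).
    by rewrite -(ler_pM2r r0); move: h; congr (_ <= _); ring.
  have -> : 1 + (1 - s) / (N * s - 1) = (N * s - s) / (N * s - 1).
    by field; rewrite gt_eqF.
  rewrite mulrAC ler_pdivlMr//; lra.
set z := (1 - s) / (N * s - 1) in h1 IH *.
have -> : k.+1%:R * z = k%:R * z + z by rewrite -natr1 mulrDl mul1r.
rewrite opprD expRD [X in _ * X]expRN ler_pdivrMr ?expR_gt0//.
apply: (le_trans IH); apply: (le_trans h1); rewrite mulrC; apply: ler_wpM2l => //.
exact: expR_ge1Dx.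
Qed.

(** For fixed [r] the ratio [s] is chosen so that [r] is the grid point of index [m.+1]. Both
    exponents then tend to [L / (N - 1)] as the grid is refined, with errors of order [1 / m]. *)
Theorem power_law_of_recursion r : 0 < r <= x0 -> p r = (r / x0) `^ (N - 1)^-1.
Proof.
move=> /andP[r0]; rewrite le_eqVlt => /predU1P[->|rx].
  by rewrite px0 divff ?gt_eqF// powR1.
have q0 : 0 < r / x0 by rewrite divr_gt0.
have q1 : r / x0 < 1 by rewrite ltr_pdivrMr// mul1r.
pose L := - ln (r / x0).
have L0 : 0 < L by rewrite oppr_gt0 ln_lt0// q0.
have N10 : 0 < N - 1 by rewrite subr_gt0.
have grid (m : nat) : let h := L / m.+1%:R in let s := expR (- h) in
    [/\ 0 < h <= L, 0 < s < 1, 1 - h <= s, h / (1 + h) <= 1 - s & r = x0 * s ^+ m.+1].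
  move=> h s; have h0 : 0 < h by rewrite divr_gt0.
  have hL : h <= L by rewrite ler_pdivrMr// ler_peMr ?(ltW L0)// ler1n.
  split => //; first by rewrite h0.
  - by rewrite expR_gt0 expR_lt1 oppr_lt0.
  - exact: expR_ge1Dx.
  - have hp : 0 < 1 + h by rewrite addr_gt0.
    rewrite ler_pdivrMr// mulrBl mul1r lerBrDr -lerBrDl.
    have -> : 1 + h - h = 1 by ring.
    by rewrite /s expRN mulrC ler_pdivrMr ?expR_gt0// mul1r expR_ge1Dx.
  - have -> : s ^+ m.+1 = r / x0.
      rewrite /s -expRM_natl; have -> : m.+1%:R * - h = ln (r / x0).
        by rewrite /h mulrN mulrC divfK// opprK.
      by rewrite lnK ?posrE.
    by rewrite mulrC divfK// gt_eqF.
(* From index [m0] on, [h = L / m.+1] satisfies [N * h < N - 1], so [s >= 1 - h] gives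
   [N * s > 1]. *)
pose m0 := Num.truncn (N * L / (N - 1)).
have NL0 : 0 <= N * L / (N - 1).
  by rewrite divr_ge0 ?(ltW N10)// mulr_ge0 ?(ltW L0)// (le_trans ler01) ?ltW.
have fine_grid m : (m0 <= m)%N -> N * (L / m.+1%:R) < N - 1.
  move=> mm; rewrite mulrA ltr_pdivrMr// [ltRHS]mulrC -ltr_pdivrMr//.
  have /andP[_ h] := truncn_itv NL0; apply: (lt_le_trans h).
  by rewrite ler_nat ltnS.
have low m : (m0 <= m)%N -> let s := expR (- (L / m.+1%:R)) in
    1 < N * s /\ expR (- (m.+1%:R * ((1 - s) / (N * s - 1)))) <= p r.
  move=> mm s; have [/andP[h0 hL] s01 sh sh' rE] := grid m.
  have Ns : 1 < N * s.
    have h1 := fine_grid m mm.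
    have h2 : N * (1 - L / m.+1%:R) <= N * s by rewrite ler_pM2l// (lt_trans ltr01).
    by apply: lt_le_trans h2; rewrite mulrBr mulr1 ltrBrDl -ltrBrDr.
  by split => //; rewrite rE; apply: geometric_lower.
have pr0 : 0 < p r.
  by have [_] := low m0 (leqnn _); apply: lt_le_trans; exact: expR_gt0.
pose l := - ln (p r).
have pE : p r = expR (- l) by rewrite opprK lnK.
have l0 : 0 <= l.
  have [_ s01 _ _ rE] := grid 0%N.
  rewrite oppr_ge0 ln_le0// {1}rE; apply: (le_trans (geometric_upper _ s01)).
  rewrite expR_le1 oppr_le0 mulr_ge0// divr_ge0// subr_ge0 ?(ltW (lt_trans _ N1))//; case/andP: s01 => // _ s1; first exact: ltW.
have lL : l * (N - 1) <= L.
  (* The error term comes from [N * s - 1 >= N - 1 - N * h], multiplied by [l]. *)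
  apply: (@le_of_add_harmonic _ _ (l * N * L) m0) => m mm.
  have [/andP[h0 hL] s01 sh _ _] := grid m.
  have [Ns] := low m mm; rewrite pE ler_expR lerN2.
  set h := L / _ in h0 hL s01 sh Ns *; set s := expR _ in s01 sh Ns *.
  have hE : m.+1%:R * h = L by rewrite /h mulrC divfK.
  rewrite mulrA ler_pdivlMr ?subr_gt0// => H.
  have e1 : m.+1%:R * (1 - s) <= L by rewrite -hE ler_pM2l//; lra.
  have e2 : l * (N - 1 - N * h) <= l * (N * s - 1).
    apply: ler_wpM2l => //.
    have : N * (1 - h) <= N * s by rewrite ler_pM2l// (lt_trans ltr01).
    lra.
  have -> : l * N * L / m.+1%:R = l * N * h by rewrite /h mulrA.
  lra.
have Ll : L <= l * (N - 1).
  (* Here [1 - s >= h / (1 + h)] and [N - s <= N - 1 + h]; expanding [(N - 1 + h) * (1 + h)] leaves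
     the error [(N + h) * h], and [h <= L]. *)
  apply: (@le_of_add_harmonic _ _ (l * (N + L) * L) 0) => m _.
  have [/andP[h0 hL] s01 sh sh' rE] := grid m.
  have := geometric_upper m.+1 s01; rewrite -rE pE ler_expR lerN2; clear rE.
  set h := L / _ in h0 hL s01 sh sh' *; set s := expR _ in s01 sh sh' *.
  have hE : m.+1%:R * h = L by rewrite /h mulrC divfK.
  have Ns : 0 < N - s by case/andP: s01 => _ s1; rewrite subr_gt0 (lt_trans s1).
  have hp : 0 < 1 + h by rewrite addr_gt0.
  rewrite mulrA ler_pdivrMr// => H.
  have e1 : L / (1 + h) <= m.+1%:R * (1 - s).
    by rewrite -hE -mulrA ler_pM2l.
  have e2 : L / (1 + h) <= l * (N - 1 + h).
    apply: (le_trans e1); apply: (le_trans H); apply: ler_wpM2l => //; lra.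
  rewrite ler_pdivrMr// in e2; apply: (le_trans e2).
  have -> : l * (N + L) * L / m.+1%:R = l * (N + L) * h by rewrite /h mulrA.
  have -> : l * (N - 1 + h) * (1 + h) = l * (N - 1) + l * (N + h) * h by ring.
  by rewrite lerD2l ler_pM2r// ler_wpM2l// lerD2l.
rewrite pE /powR gt_eqF// -[ln _]opprK -/L mulrN; congr (expR (- _)).
apply: (mulIf (lt0r_neq0 N10)); rewrite mulrAC mulVf ?mul1r ?gt_eqF//; apply/eqP; rewrite eq_le lL.
exact: Ll.
Qed.

End power_law_recursion.

(** * Embedding the equilibrium law *)

Section drawup.
Context {R : realType}.
Variables (x : R -> R) (N x0 : R).
Hypotheses (cx : path_continuous x) (N1 : 1 < N) (x00 : 0 < x0) (xs : x 0 = x0).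
Hypothesis x_ge0 : forall t, 0 <= t -> 0 <= x t.

Definition drawup_gap (y : R -> R) t := y t - N * running_inf y t.
Definition drawup_time (y : R -> R) := hit 0 (drawup_gap y).
(** First passage to [r] or below, capped so that it equals the drawup time when the level has not
    been reached by then. *)
Definition level_time r (y : R -> R) := mine (hit 0 (fun t => r - y t)) (drawup_time y).

Lemma drawup_gap_continuous (y : R -> R) : path_continuous y -> path_continuous (drawup_gap y).
Proof.
move=> cy; apply: path_continuousB => //; apply: path_continuousM.
  exact: path_continuous_cst.
exact: running_inf_continuous.
Qed.

Lemma level_gap_continuous r (y : R -> R) : path_continuous y -> path_continuous (fun t => r - y t).
Proof. by move=> cy; apply: path_continuousB => //; exact: path_continuous_cst. Qed.

Lemma drawup_start : drawup_gap x 0 < 0.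
Proof.
rewrite /drawup_gap; have [s] := running_inf_attained cx (lexx 0).
move=> /andP[s0 s0']; have -> : s = 0 by apply/eqP; rewrite eq_le s0 s0'.
by move=> ->; rewrite xs -[X in X - _]mul1r -mulrBl pmulr_llt0// subr_lt0.
Qed.

Lemma running_inf_ge0 t : 0 <= t -> 0 <= running_inf x t.
Proof. by move=> t0; have [s /andP[s0 _] ->] := running_inf_attained cx t0; exact: x_ge0. Qed.

(** At a zero of a nonnegative path the running minimum is 0 as well, so the gap is 0; thus the
    drawup time never exceeds the absorption time. *)
Lemma drawup_time_le_zero t : 0 <= t -> x t = 0 -> (drawup_time x <= t%:E)%E.
Proof.
move=> t0 xt; apply: hit_le; rewrite ?lee_fin//.
have : running_inf x t <= x t by apply: running_inf_le => //; rewrite t0 lexx.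
rewrite /drawup_gap xt => h.
by rewrite (_ : running_inf x t = 0) ?mulr0 ?subrr//; apply/eqP; rewrite eq_le h running_inf_ge0.
Qed.

(** By continuity the drawup inequality is first met with equality, so the law of the stopped value
    is that of the running minimum, rescaled by [N]. *)
Lemma drawup_value v : drawup_time x = v%:E -> 0 <= v /\ x v = N * running_inf x v.
Proof.
move=> hv; have v0 : 0 <= v by rewrite -lee_fin -hv; exact: hit_ge0.
have [e _] := hit_value (drawup_gap_continuous cx) (lexx 0) drawup_start hv.
by split => //; apply/eqP; rewrite -subr_eq0; apply/eqP.
Qed.

Lemma drawup_before t : 0 <= t -> (t%:E <= drawup_time x)%E -> x t <= N * running_inf x t.
Proof.
move=> t0; rewrite le_eqVlt => /predU1P[/esym/drawup_value[_ ->]//|h].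
by have := hit_before t0 _ h; rewrite lee_fin => /(_ t0); rewrite /drawup_gap subr_lt0 => /ltW.
Qed.

Lemma level_value r u : r <= x0 -> hit 0 (fun t => r - x t) = u%:E -> 0 <= u /\ x u = r.
Proof.
rewrite le_eqVlt => /predU1P[->|rx] hu.
  have u0 : 0 <= u by rewrite -lee_fin -hu; exact: hit_ge0.
  split => //; have : (hit 0 (fun t => (x0 - x t)%R) <= 0%:E)%E.
    by apply: hit_le; rewrite ?lee_fin// xs subrr.
  rewrite hu lee_fin => u0'; have -> : u = 0 by apply/eqP; rewrite eq_le u0 u0'.
  exact: xs.
have start : r - x 0 < 0 by rewrite xs subr_lt0.
have [e u0] := hit_value (@level_gap_continuous r x cx) (lexx 0) start hu.
by split => //; apply/esym/eqP; rewrite -subr_eq0; apply/eqP.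
Qed.

Lemma above_level r t : 0 <= t -> (t%:E < hit 0 (fun t => (r - x t)%R))%E -> r < running_inf x t.
Proof.
move=> t0 ht; have [s /andP[s0 st] ->] := running_inf_attained cx t0.
have := @hit_before _ 0 (fun t => r - x t) s s0; rewrite lee_fin => /(_ s0) h.
by rewrite -subr_lt0; apply: h; apply: le_lt_trans ht; rewrite lee_fin.
Qed.

Lemma level_time_mono r' r : r' <= r -> (level_time r x <= level_time r' x)%E.
Proof.
move=> rr; rewrite /level_time le_min !ge_min lexx orbT andbT; apply/orP; left.
case hu : (hit 0 (fun t => r' - x t)) (hit_ge0 0 (fun t => r' - x t)) => [u| |]//; last first.
  by move=> _; exact: leey.
rewrite lee_fin => u0; have [_ _ h] := hit_attained (@level_gap_continuous r' x cx) hu.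
by apply: hit_le; rewrite ?lee_fin//; lra.
Qed.

(* Once the level [r] has been reached, the running minimum is at most [r], so before the drawup
   time the path cannot exceed [N * r]. *)
Lemma below_drawup r u t : 0 <= r <= x0 -> hit 0 (fun t => r - x t) = u%:E -> u <= t ->
  (t%:E <= drawup_time x)%E -> 0 <= x t <= N * r.
Proof.
move=> /andP[r0 rx] hu ut td; have [u0 xu] := level_value rx hu.
have t0 := le_trans u0 ut.
rewrite x_ge0//=; apply: (le_trans (drawup_before t0 td)).
rewrite ler_pM2l ?(lt_trans ltr01)// -xu; apply: running_inf_le => //.
by rewrite u0.
Qed.

(** Since [x v] is [N] times the minimum, [N * r < x v] says that level [r] has not been reached by
    the drawup time; the two branches locate the path at the capped passage. *)
Lemma drawup_position r v : 0 < r <= x0 -> drawup_time x = v%:E ->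
  if N * r < x v then level_time r x = v%:E
  else exists u, [/\ 0 <= u, u <= v, x u = r & level_time r x = u%:E].
Proof.
move=> /andP[r0 rx] hv; have [v0 xv] := drawup_value hv.
have N0 : 0 < N by rewrite (lt_trans ltr01).
rewrite /level_time hv.
have [hu|hu] := ltP v%:E (hit 0 (fun t => r - x t)).
  by rewrite xv ltr_pM2l// (above_level v0 hu).
have hu0 := hit_ge0 0 (fun t => r - x t).
case hE : (hit 0 (fun t => r - x t)) hu hu0 => [u| |]//; rewrite !lee_fin => uv u0.
have [_ xu] := level_value rx hE.
have /andP[_] : 0 <= x v <= N * r.
  by apply: (@below_drawup r u v); rewrite ?(ltW r0) ?hv ?lexx.
by rewrite leNgt => /negPf ->; exists u.
Qed.

Lemma drawup_time_le_start v : drawup_time x = v%:E -> x v <= N * x0.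
Proof.
move=> hv; have [v0 ->] := drawup_value hv.
rewrite ler_pM2l ?(lt_trans ltr01)// -xs; apply: running_inf_le => //.
by rewrite lexx.
Qed.

End drawup.

Section measurable_running_inf.
Context {R : realType} {T : pointedType}.
Variables (G : set (set T)) (Y : R -> T -> R) (t : R).
Hypothesis t0 : 0 <= t.
Hypothesis mY : forall q, 0 <= q <= t -> measurable_fun setT (Y q : g_sigma_algebraType G -> R).
Hypothesis cY : forall w, path_continuous (Y^~ w).

(** The minimum exceeds [a] exactly when the passage to [a] or below has not occurred by time [t],
    so [measurable_hit] applies. *)
Lemma measurable_running_inf :
  measurable_fun setT ((fun w => running_inf (Y^~ w) t) : g_sigma_algebraType G -> R).
Proof.
apply: (measurability _ (RGenOInfty.measurableE R)) => // _ [_ [a ->] <-].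
rewrite setTI (_ : _ @^-1` _ = ~` [set w | (hit 0 (fun q => (a - Y q w)%R) <= t%:E)%E]).
  apply: measurableC; apply: (@measurable_hit _ _ G (cst 0%E) (fun q w => a - Y q w)) => //.
  - move=> q /andP[q0 _]; rewrite (_ : [set w : T | _] = setT).
      exact: (@measurableT _ (g_sigma_algebraType G)).
    by apply/seteqP; split => w //= _; rewrite lee_fin.
  - by move=> q qt; apply: measurable_funB; [exact: measurable_cst|exact: mY].
  - by move=> w; exact: level_gap_continuous.
have cl w : path_continuous (fun q => a - Y q w) by exact: level_gap_continuous.
apply/seteqP; split => w /=; rewrite in_itv/= andbT => h.
- move=> /(hit_leP _ _ (cl w))[u [u0 ut _]]; rewrite subr_ge0 => Ya.
  have : running_inf (Y^~ w) t <= Y u w by apply: running_inf_le => //; rewrite u0.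
  by move=> /(lt_le_trans h); rewrite ltNge Ya.
- have [s /andP[s0 st] e] := running_inf_attained (@cY w) t0.
  rewrite ltNge; apply/negP; rewrite e => Ya; apply: h; apply/(hit_leP _ _ (cl w)).
  by exists s; rewrite lee_fin subr_ge0.
Qed.

End measurable_running_inf.

Section two_indicators.
Context {R : realType} {d : measure_display} {T : measurableType d}.
Variable P : probability T R.

Lemma integral_two_indic (a b : R) (A B : set T) : measurable A -> measurable B ->
  (\int[P]_w (a * \1_A w + b * \1_B w)%:E = a%:E * P A + b%:E * P B)%E.
Proof.
move=> mA mB.
have one (c : R) (C : set T) : measurable C -> P.-integrable setT (EFin \o (fun w => c * \1_C w)) /\
    (\int[P]_w (c * \1_C w)%:E = c%:E * P C)%E.
  move=> mC; have iC : P.-integrable setT (EFin \o (\1_C : T -> R)).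
    apply: (@integrable_bounded _ _ _ _ _ 1); first exact: measurable_indic.
    by move=> w; rewrite indicE ger0_norm//; case: (_ \in _).
  split.
    apply: (@integrable_bounded _ _ _ _ _ `|c|).
      by apply: measurable_funM => //; exact: measurable_indic.
    by move=> w; rewrite indicE normrM; case: (_ \in _); rewrite ?normr1 ?mulr1// normr0 mulr0.
  transitivity (\int[P]_w (c%:E * (\1_C w)%:E))%E; first by apply: eq_integral => w _; rewrite EFinM.
  by rewrite integralZl// integral_indic// setIT.
have [iA eA] := one a A mA; have [iB eB] := one b B mB.
transitivity (\int[P]_w ((a * \1_A w)%:E + (b * \1_B w)%:E))%E.
  by apply: eq_integral => w _; rewrite EFinD.
by rewrite integralD_EFin// eA eB.
Qed.

End two_indicators.

(** * Admissibility of the drawup time and the law at that time *)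

Section embedding.
Context {R : realType} {d : measure_display} {T : measurableType d}.
Variables (P : probability T R) (x0 N : R) (B X : R -> T -> R).
Hypothesis x00 : 0 < x0.
Hypothesis N1 : 1 < N.
Hypothesis HB : brownian_from P x0 B.
Hypothesis HX : absorbed_at0 B X.

Let cB w : path_continuous (B^~ w). Proof. by case: HB => _ _ + _; exact. Qed.
Let B0 w : 0 < B 0 w. Proof. by case: HB => _ -> _ _. Qed.
Let xb w t : 0 <= t -> X t w = if `[< exists2 s, 0 <= s <= t & B s w = 0 >] then 0 else B t w.
Proof. exact: HX. Qed.
Let cX w : path_continuous (X^~ w). Proof. exact: (process_continuous x00 HB HX). Qed.
Let X0 w : X 0 w = x0. Proof. exact: (process_start x00 HB HX). Qed.
Let X_ge0 w t : 0 <= t -> 0 <= X t w. Proof. exact: (process_ge0 x00 HB HX). Qed.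
Let genF t := [set S | exists s (A : set R), 0 <= s < t /\ measurable A /\ S = X s @^-1` A].
Let gen t := [set S | exists s (A : set R), 0 <= s <= t /\ measurable A /\ S = B s @^-1` A].
Let N0 : 0 < N. Proof. exact: lt_trans N1. Qed.

(** [filt] at [t] only sees times before [t]; the value at [t] itself is recovered as the limit
    along [t - t / k.+1], which needs [t > 0]. *)
Lemma process_filt t q : 0 < t -> 0 <= q <= t ->
  measurable_fun setT (X q : g_sigma_algebraType (genF t) -> R).
Proof.
move=> t0 /andP[q0]; have strict s : 0 <= s -> s < t ->
    measurable_fun setT (X s : g_sigma_algebraType (genF t) -> R).
  by move=> s0 st _ A mA; rewrite setTI; apply: sub_sigma_algebra; exists s, A; rewrite s0 st.
rewrite le_eqVlt => /predU1P[->|]; last exact: strict.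
pose s_ (k : nat) := t - t / k.+1%:R.
have s0 k : 0 <= s_ k by rewrite subr_ge0 ler_pdivrMr// ler_peMr ?(ltW t0)// ler1n.
have ms k : measurable_fun setT (X (s_ k) : g_sigma_algebraType (genF t) -> R).
  by apply: strict => //; rewrite ltrBlDl ltrDr divr_gt0.
apply: (measurable_fun_cvg ms).
move=> w _; apply/cvgrPdist_lt => e e0.
have [dl dl0 H] := (path_continuousP _).1 (@cX w) t e (ltW t0) e0.
have dt0 : 0 < dl / t by rewrite divr_gt0.
have := near_infty_natSinv_lt (PosNum dt0); apply: filterS => k /= kd.
rewrite distrC; apply: H => //.
rewrite /s_ addrAC subrr add0r normrN ger0_norm ?divr_ge0 ?(ltW t0)//.
by rewrite mulrC -ltr_pdivlMr.
Qed.

Definition drawup_stop w := drawup_time N (X^~ w).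

Lemma drawup_admissible : admissible X drawup_stop.
Proof.
split.
- by move=> w; exact: hit_ge0.
- move=> w; rewrite le_ereal_inf_tmp// => _ [t [t0 Xt] <-].
  exact: (drawup_time_le_zero N (@cX w) (@X_ge0 w) t0 Xt).
(* At [t = 0] the strict past is trivial, but the event is empty because the gap starts out
   negative. *)
- move=> t; rewrite le_eqVlt => /predU1P[<-|t0].
    rewrite (_ : [set w | _] = set0); first exact: (@measurable0 _ (g_sigma_algebraType (genF 0))).
    apply/seteqP; split => w //= h.
    have e : drawup_stop w = 0%:E by apply/eqP; rewrite eq_le h hit_ge0.
    have [_ _] := hit_attained (@drawup_gap_continuous R N _ (@cX w)) e.
    by rewrite leNgt (drawup_start (@cX w) N1 x00 (X0 w)).
  apply: (@measurable_hit _ _ (genF t) (cst 0%E) (fun s w => drawup_gap N (X^~ w) s)) => //.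
  + exact: ltW.
  + move=> q /andP[q0 _]; rewrite (_ : [set w : T | _] = setT).
      exact: (@measurableT _ (g_sigma_algebraType (genF t))).
    by apply/seteqP; split => w //= _; rewrite lee_fin.
  + move=> q qt; have /andP[q0 qt'] := qt.
    apply: measurable_funB; first exact: process_filt.
    apply: measurable_funM; first exact: measurable_cst.
    apply: (@measurable_running_inf _ _ (genF t) X) => // s /andP[s0 sq].
    by apply: process_filt; rewrite // s0 (le_trans sq).
  + by move=> w; exact: drawup_gap_continuous.
Qed.

Let tau := drawup_stop.
Let Xtau := stopped X tau.

Let before_tau t w : 0 <= t -> (t%:E <= tau w)%E -> B t w = X t w.
Proof.
move=> t0 h; apply/esym; apply: (absorbed_eq (@B0 w) (@cB w) (@xb w)) => //.
apply: (le_trans h); exact: (admissible_le_absorption x00 HB HX drawup_admissible).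
Qed.

Let alpha r w := level_time N r (X^~ w).

Let alpha_stopping r : stopping_time B (alpha r).
Proof.
have [_ ts] := admissible_stopping_time x00 HB HX drawup_admissible.
split; first by move=> w; rewrite le_min !hit_ge0.
move=> q q0; rewrite (_ : [set w | _] =
    [set w | (hit 0 (fun t => (r - X t w)%R) <= q%:E)%E] `|` [set w | (tau w <= q%:E)%E]).
  apply: (@measurableU _ (g_sigma_algebraType (gen q))); last exact: ts.
  apply: (@measurable_hit _ _ (gen q) (cst 0%E) (fun s w => r - X s w)) => //.
  - move=> s /andP[s0 _]; rewrite (_ : [set w : T | _] = setT).
      exact: (@measurableT _ (g_sigma_algebraType (gen q))).
    by apply/seteqP; split => w //= _; rewrite lee_fin.
  - move=> s /andP[s0 sq]; apply: measurable_funB; first exact: measurable_cst.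
    move=> _ A mA; rewrite setTI; apply: (@history_le _ _ _ B s) => //.
    by have := process_history x00 HB HX s0 measurableT mA; rewrite setTI.
  - by move=> w; exact: level_gap_continuous.
by apply/seteqP; split => w /=; rewrite /alpha /level_time ge_min => /orP.
Qed.

Section two_levels.
Variables r' r : R.
Hypotheses (r'0 : 0 < r') (r'r : r' < r) (rx : r <= x0).

Let r0 : 0 < r. Proof. exact: lt_trans r'r. Qed.

(** The change of the process between the two capped passages. Stopped values above [N * r] mean
    that neither level was reached, values in between that only [r] was, and the remaining ones that
    both were. *)
Let D w : R := if N * r < Xtau w then 0 else if N * r' < Xtau w then Xtau w - r else r' - r.

(** From the passage to [r] until the drawup time the path stays in [[0, N * r]]; without that
    passage both times are the drawup time. *)
Let diff_bound n w : `|stopped_at B (alpha r') n w - stopped_at B (alpha r) n w| <= N * r.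
Proof.
have Nr : 0 <= N * r by rewrite mulr_ge0// ltW.
have aa : (alpha r w <= alpha r' w)%E by apply: level_time_mono => //; exact: ltW.
have at' s : (alpha s w <= tau w)%E by rewrite ge_min lexx orbT.
rewrite /stopped_at.
have [na|an] := leP n%:R%:E (alpha r w).
  by rewrite !min_r ?(le_trans na)// subrr normr0.
have [hh|hh] := leP (hit 0 (fun t => (r - X t w)%R)) (tau w); last first.
  have e : alpha r w = tau w by rewrite /alpha /level_time min_r// ltW.
  have -> : alpha r' w = alpha r w by apply/eqP; rewrite eq_le aa e at'.
  by rewrite min_l ?(ltW an)// subrr normr0.
have e : alpha r w = hit 0 (fun t => r - X t w) by rewrite /alpha /level_time min_l.
case hu : (hit 0 (fun t => r - X t w)) (hit_ge0 0 (fun t => r - X t w)) hh => [u| |].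
- move=> u0 ut; rewrite e hu lte_fin in an; rewrite e hu in aa.
  have inside t : u <= t -> (t%:E <= tau w)%E -> 0 <= X t w <= N * r.
    move=> ut' tt; have r0x : 0 <= r <= x0 by rewrite (ltW r0).
    exact: (@below_drawup R (X^~ w) N x0 (@cX w) N1 x00 (X0 w) (@X_ge0 w) r u t r0x hu ut' tt).
  have a'0 : (0 <= alpha r' w)%E by apply: le_trans aa; exact: u0.
  set v := mine (alpha r' w) _; have uv : (u%:E <= v)%E by rewrite le_min aa lee_fin ltW.
  have vt : (v <= tau w)%E by rewrite ge_min at'.
  have vE : v = (fine v)%:E.
    rewrite fineK// ge0_fin_numE; first by rewrite gt_min ltry orbT.
    exact: le_trans uv.
  rewrite lee_fin in u0.
  have uv' : u <= fine v by rewrite -lee_fin -vE.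
  rewrite e hu.
  rewrite !before_tau//; last 2 first.
    exact: le_trans uv'.
    by rewrite -vE.
  have /andP[h1 h2] := inside _ uv' (etrans (congr1 (fun z => (z <= tau w)%E) (esym vE)) vt).
  have /andP[h3 h4] := inside u (lexx _) ut.
  by rewrite ler_norml; apply/andP; split; rewrite /=; lra.
- by move: an; rewrite e hu ltNge leey.
- by rewrite leeNy_eq.
Qed.

Let final w : (H0 X w < +oo)%E -> exists n0, forall n, (n0 <= n)%N ->
  stopped_at B (alpha r') n w - stopped_at B (alpha r) n w = D w.
Proof.
move=> Hfin; have [t0w tH _] : admissible X tau := drawup_admissible.
case tv : (tau w) (t0w w) (tH w) => [v| |]//; last first.
  by move=> _; rewrite leye_eq => /eqP h; rewrite h ltxx in Hfin.
rewrite lee_fin => v0 _.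
have XE : Xtau w = X v w by rewrite /Xtau /stopped tv.
exists (Num.truncn v).+1 => n nv.
have vn : v <= n%:R.
  have /andP[_ /ltW h] := truncn_itv v0; apply: (le_trans h).
  by rewrite ler_nat.
have at_time s u : alpha s w = u%:E -> 0 <= u -> u <= v -> stopped_at B (alpha s) n w = X u w.
  move=> e u0 uv; rewrite /stopped_at e min_l ?lee_fin ?(le_trans uv)//=.
  by rewrite before_tau// tv lee_fin.
have pos s := @drawup_position R (X^~ w) N x0 (@cX w) N1 x00 (X0 w) (@X_ge0 w) s v.
have r'01 : 0 < r' <= x0 by rewrite r'0 ltW// (lt_le_trans r'r).
have r01 : 0 < r <= x0 by rewrite r0.
have rr : N * r' < N * r by rewrite ltr_pM2l.
have := pos r r01 tv; have := pos r' r'01 tv; rewrite /D XE.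
case: (ltP (N * r) (X v w)) => [h|h].
  rewrite (lt_trans rr h) => e' e.
  by rewrite !(at_time _ v)// subrr.
case: ifP => [h' e'|h' [u' [u'0 u'v Xu' e']]] [u [u0 uv Xu e]].
  by rewrite (at_time r' v)// (at_time r u)// Xu.
by rewrite (at_time r' u')// (at_time r u)// Xu Xu'.
Qed.

Let p s := fine (P [set w | Xtau w <= N * s]).

(** The variable [D] has mean 0. On the middle event [Xtau] lies between [N * r'] and [N * r], and
    replacing it by either end gives the two inequalities. *)
Lemma drawup_law_bounds :
  (N * r' - r) * (p r - p r') <= (r - r') * p r' /\
  (r - r') * p r' <= (N - 1) * r * (p r - p r').
Proof.
have mXt : measurable_fun setT Xtau := stopped_measurable x00 HB HX drawup_admissible.
have mS s : measurable [set w | Xtau w <= N * s] := measurable_ray mXt _.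
have PE s : P [set w | Xtau w <= N * s] = (p s)%:E by rewrite fineK// fin_num_measure.
have mlt s : measurable_fun setT (fun w => N * s < Xtau w) by exact: measurable_fun_ltr.
have mD : measurable_fun setT D.
  apply: measurable_fun_ifT => //; apply: measurable_fun_ifT => //.
  exact: measurable_funB.
have D0 : (\int[P]_w (D w)%:E = 0)%E.
  apply: (exit_identity HB (alpha_stopping r) (alpha_stopping r') mD diff_bound).
  by apply: filterS (absorption_finite x00 HB HX) => w; exact: final.
have rr : N * r' < N * r by rewrite ltr_pM2l.
(* [lo a] is [D] with [Xtau - r] replaced by the constant [a]; its mean is
   [a * (p r - p r') - (r - r') * p r']. *)
pose lo a w := a * \1_[set w | Xtau w <= N * r] w + (r' - r - a) * \1_[set w | Xtau w <= N * r'] w.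
have loE a : (\int[P]_w (lo a w)%:E = (a * p r + (r' - r - a) * p r')%:E)%E.
  rewrite integral_two_indic//.
  transitivity (a%:E * (p r)%:E + (r' - r - a)%:E * (p r')%:E)%E; last by rewrite -!EFinM -EFinD.
  by congr (_ * _ + _ * _)%E; exact: PE.
have lo_val a w : lo a w = if N * r < Xtau w then 0 else if N * r' < Xtau w then a else r' - r.
  rewrite /lo !indicE; case: ltP => h.
    by rewrite !memNset ?mulr0 ?addr0//= => h'; move: (lt_le_trans (lt_trans rr h) h'); move: (lt_le_trans h h'); rewrite ltxx.
  rewrite mem_set//; case: ltP => h'.
    by rewrite memNset ?mulr0 ?addr0 ?mulr1//= leNgt h'.
  by rewrite mem_set// !mulr1 addrC subrK.
split.
- have : (\int[P]_w (lo (N * r' - r) w)%:E <= \int[P]_w (D w)%:E)%E.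
    apply: le_integralT => w; rewrite lee_fin lo_val /D; case: ltP => // _.
    by case: ltP => // h; rewrite lerB// ltW.
  rewrite loE D0 lee_fin; lra.
- have : (\int[P]_w (D w)%:E <= \int[P]_w (lo ((N - 1) * r) w)%:E)%E.
    apply: le_integralT => w; rewrite lee_fin lo_val /D; case: ltP => // h.
    by case: ltP => // _; rewrite mulrBl mul1r lerB.
  rewrite loE D0 lee_fin; lra.
Qed.

End two_levels.

Lemma drawup_law : has_law P X drawup_stop (power_cdf (N * x0) (N - 1)^-1).
Proof.
have mXt : measurable_fun setT Xtau := stopped_measurable x00 HB HX drawup_admissible.
have mS x : measurable [set w | Xtau w <= x] := measurable_ray mXt _.
pose F x := fine (P [set w | Xtau w <= x]).
have PE x : P [set w | Xtau w <= x] = (F x)%:E by rewrite fineK// fin_num_measure.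
have F0 x : 0 <= F x by rewrite fine_ge0.
have Fmono x y : x <= y -> F x <= F y.
  move=> xy; rewrite -lee_fin -!PE; apply: le_measure; rewrite ?inE//.
  by move=> w /= h; exact: le_trans xy.
have N10 : 0 < N - 1 by rewrite subr_gt0.
have c0 : 0 < N * x0 by rewrite mulr_gt0.
have Xc w : Xtau w <= N * x0.
  rewrite /Xtau /stopped; case tv : (tau w) => [v| |]; try exact: ltW.
  exact: (drawup_time_le_start (@cX w) N1 x00 (X0 w) tv).
have Fc x : N * x0 <= x -> F x = 1.
  move=> cx; rewrite /F (_ : [set w | _] = setT); first by rewrite probability_setT.
  by apply/seteqP; split => w //= _; exact: le_trans cx.
have Fpow r : 0 < r <= x0 -> F (N * r) = (r / x0) `^ (N - 1)^-1.
  apply: (power_law_of_recursion (p := fun s => F (N * s)) N1 x00) => //.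
  - by rewrite Fc.
  - by move=> s' s s'0 ss sx; have [] := drawup_law_bounds s'0 ss sx.
  - by move=> s' s s'0 ss sx; have [] := drawup_law_bounds s'0 ss sx.
move=> x; rewrite PE /power_cdf; congr EFin.
case: ltP => [x_lt0|x_ge0].
  rewrite /F (_ : [set w | _] = set0) ?measure0//; apply/seteqP; split => w //=.
  have := stopped_ge0 x00 HB HX drawup_admissible w => h.
  by move=> /(le_trans h); rewrite leNgt x_lt0.
have [cx|xc] := leP (N * x0) x.
  by rewrite Fc// min_r// powR_ge1 ?invr_ge0 ?(ltW N10)// ler_pdivlMr// mul1r.
have powE y : 0 < y -> y <= N * x0 -> F y = (y / (N * x0)) `^ (N - 1)^-1.
  move=> y0 yc; have -> : y = N * (y / N) by rewrite mulrC divfK// gt_eqF.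
  rewrite Fpow; last by rewrite divr_gt0//= ler_pdivrMr// mulrC.
  by congr (_ `^ _); field; rewrite !gt_eqF.
rewrite min_l; last first.
  by rewrite powR_le1 ?invr_ge0 ?(ltW N10)// divr_ge0 ?(ltW c0)//= ler_pdivrMr// mul1r ltW.
move: x_ge0; rewrite le_eqVlt => /predU1P[<-|x_gt0]; last by rewrite powE// ltW.
rewrite mul0r powR0 ?invr_eq0 ?gt_eqF//; apply/eqP; rewrite eq_le F0 andbT.
apply/ler_addgt0Pr => e e0; rewrite add0r.
(* The recursion does not reach 0, so [F 0] is squeezed by [F y] at the point [y] where the power
   law equals [e1]; capping at 1 keeps [y] below [N * x0]. *)
pose e1 := Num.min e 1; have e10 : 0 < e1 by rewrite lt_min e0 ltr01.
have e11 : e1 <= 1 by rewrite ge_min lexx orbT.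
pose y := N * x0 * e1 `^ (N - 1).
have y0 : 0 < y by rewrite mulr_gt0// powR_gt0.
have yc : y <= N * x0 by rewrite ger_pMr// powR_le1 ?(ltW N10)// (ltW e10).
apply: (le_trans (Fmono 0 y (ltW y0))); rewrite powE//.
have -> : y / (N * x0) = e1 `^ (N - 1) by rewrite /y mulrAC divff ?mul1r// gt_eqF.
rewrite -powRrM mulfV ?gt_eqF// powRr1 ?(ltW e10)// ge_min lexx//.
Qed.

End embedding.

(** * The contest *)

Section payoff_bounds.
Context {R : realType}.
Variables (n : nat) (K K2 : R) (i : 'I_n) (y : 'I_n -> R) (m : \bar R).
Hypotheses (K0 : 0 <= K) (K20 : 0 <= K2) (K2K : K2 <= K) (y0 : 0 <= y i).
(** Based at 0 instead of [y i], so that it depends on the rivals only and can be independent of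
    player [i]; nonnegativity of [y i] makes this harmless. *)
Let Y := \big[Num.max/0]_(j | j != i) y j.

Let rival_max : \big[Num.max/y i]_(j | j != i) y j = Num.max (y i) Y.
Proof.
rewrite /Y; elim/big_rec2: _ => [|j u v _ ->]; first by rewrite max_l.
by rewrite maxCA.
Qed.

Let winner : (y i == \big[Num.max/y i]_(j : 'I_n) y j) -> Y <= y i.
Proof.
move=> /eqP e; apply/bigmax_leP; split => // j _; rewrite e; exact: le_bigmax.
Qed.

Let rival_value : y i < Y -> \big[Num.max/y i]_(j | j != i) y j = Y.
Proof. by move=> h; rewrite rival_max max_r// ltW. Qed.

Let no_rival : Y <= y i -> (y i < \big[Num.max/y i]_(j | j != i) y j) = false.
Proof. by move=> h; rewrite rival_max max_l// ltxx. Qed.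

Let loser : y i < Y -> (y i == \big[Num.max/y i]_(j : 'I_n) y j) = false.
Proof. by move=> h; apply/negP => /winner; rewrite leNgt h. Qed.

(** Doubtful cases are resolved in the player's favour: a tie earns the full prize, and a rival
    value equal to [m] costs nothing. *)
Lemma payoff_le : payoff K K2 i y m <=
  (if Y <= y i then 1 else 0) - K * (if (y i < Y) && (Y%:E < m)%E then 1 else 0).
Proof.
rewrite /payoff; case: (leP Y (y i)) => h.
  rewrite (no_rival h)/= !mulr0 !subr0; case: ifP => // _.
  case: #|_| => [|k]; first by rewrite invr0.
  by rewrite invf_le1// ler1n.
rewrite (loser h) (rival_value h) h/= lerBlDr lerDl mulr_ge0//.
by case: ifP.
Qed.

(** The same cases resolved against the player: a tie earns nothing, and a rival value equal to [m]
    costs the full [K], which is where [K2 <= K] enters. *)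
Lemma payoff_ge :
  (if Y < y i then 1 else 0) - K * (if (y i < Y) && (Y%:E <= m)%E then 1 else 0)
    <= payoff K K2 i y m.
Proof.
rewrite /payoff; case: (ltgtP Y (y i)) => h.
- rewrite (no_rival (ltW h))/= !mulr0 !subr0.
  have ymax : \big[Num.max/y i]_(j : 'I_n) y j = y i.
    apply/eqP; rewrite eq_le le_bigmax andbT; apply/bigmax_leP; split => // j _.
    have [->//|ji] := eqVneq j i.
    by apply: le_trans (ltW h); exact: le_bigmax_cond.
  rewrite ymax eqxx (_ : #|_| = 1%N) ?invr1//.
  rewrite -(card1 i); apply: eq_card => j; apply/idP/idP => [/set_mem/= /eqP e|/eqP ->]; last first.
    by apply: mem_set; rewrite /= eqxx.
  apply/negPn/negP => ji; move: h; apply/negP; rewrite -leNgt -e.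
  exact: le_bigmax_cond.
- rewrite (loser h) (rival_value h) h/= !sub0r -opprD lerN2.
  case: (ltgtP Y%:E m) => _; rewrite ?mulr0 ?mulr1 ?addr0 ?add0r//.
- have h' : Y <= y i by rewrite h.
  rewrite (no_rival h')/= !mulr0 !subr0; case: ifP => // _.
Qed.

End payoff_bounds.

Section game.
Context {R : realType} {d : measure_display} {T : measurableType d}.
Variables (P : probability T R) (n : nat) (x0 K K2 : R) (X : 'I_n -> R -> T -> R).
Hypotheses (n2 : (2 <= n)%N) (x00 : 0 < x0) (K0 : 0 <= K) (K20 : 0 <= K2) (K2K : K2 <= K).
Hypothesis HX : forall i, absorbed_BM P x0 (X i).
Hypothesis indep : indep_family P (fun i => proc_sigma (X i)).
Let N := n%:R + K * (n%:R - 1).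
Let c := N * x0.

Let n1 : 1 <= n%:R - 1 :> R.
Proof. by rewrite lerBrDr -[1 + 1]/(2%:R) ler_nat. Qed.

Let N1E : N - 1 = (n%:R - 1) * (1 + K).
Proof. by rewrite /N; ring. Qed.

Let n10 : 0 < n%:R - 1 :> R. Proof. exact: lt_le_trans ltr01 n1. Qed.
Let K1 : 0 < 1 + K. Proof. by rewrite ltr_wpDr. Qed.

Lemma contest_N1 : 0 < N - 1.
Proof. by rewrite N1E mulr_gt0. Qed.

Let N0 : 0 < N.
Proof. by rewrite -[N](subrK 1) addr_gt0 ?contest_N1. Qed.

Let c0 : 0 < c. Proof. by rewrite mulr_gt0. Qed.

Section profile.
Variables (tau : 'I_n -> T -> \bar R) (i : 'I_n).
Hypothesis Ht : forall j, admissible (X j) (tau j).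
(** Only the rivals are tied to [F]; [tau i] is any admissible time, so the section covers
    deviations as well as equilibrium play. *)
Hypothesis rivals_law : forall j, j != i -> has_law P (X j) (tau j) (Fcdf N x0).

Let S j w := stopped (X j) (tau j) w.
Let M w := Msup (X i) (tau i) w.
Let Y w := \big[Num.max/0]_(j | j != i) S j w.
Let T_ j := g_sigma_algebraType [set A | exists t (C : set R), 0 <= t /\ measurable C /\ A = X j t @^-1` C].

Let mS j : measurable_fun setT (S j : T_ j -> R).
Proof. by have [B [HB HXB]] := HX j; exact: (stopped_proc_sigma x00 HB HXB). Qed.

Let S_ge0 j w : 0 <= S j w.
Proof. by have [B [HB HXB]] := HX j; exact: (stopped_ge0 x00 HB HXB). Qed.

Let mM : measurable_fun setT (M : T_ i -> \bar R).
Proof. by have [B [HB HXB]] := HX i; exact: (Msup_proc_sigma x00 HB HXB). Qed.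

Let to_measurable_fun j d' (U : measurableType d') (f : T -> U) :
  measurable_fun setT (f : T_ j -> U) -> measurable_fun setT f.
Proof. by have [B [HB HXB]] := HX j; exact: (proc_sigma_measurable_fun x00 HB HXB). Qed.

Let to_measurable j A : proc_sigma (X j) A -> measurable A.
Proof. by have [B [HB HXB]] := HX j; exact: (proc_sigma_measurable x00 HB HXB). Qed.

Let Y_ge0 w : 0 <= Y w.
Proof. exact: bigmax_ge_id. Qed.

Let Y_le w z : 0 <= z -> (Y w <= z) <-> (forall j, j != i -> S j w <= z).
Proof. by move=> z0; split => [/bigmax_leP[]//|h]; apply/bigmax_leP. Qed.

Let ray z := [set w | Y w <= z].

Let ray_neg z : z < 0 -> ray z = set0.
Proof.
by move=> z0; apply/seteqP; split => w //= h; move: (le_trans (Y_ge0 w) h); rewrite leNgt z0.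
Qed.

Let mS_ray j z : proc_sigma (X j) [set w | S j w <= z].
Proof.
rewrite (_ : [set w | _] = setT `&` S j @^-1` `]-oo, z]%classic); first exact: mS.
by apply/seteqP; split => w; rewrite /= in_itv/= => // -[].
Qed.

(** Independence of the processes is applied with [E] in slot [i] and a ray event of the stopped
    value in every other slot. *)
Let rays_indep E z : 0 <= z -> proc_sigma (X i) E ->
  P (ray z `&` E) = (fine (P E) * power_cdf c (N - 1)^-1 z ^+ n.-1)%:E.
Proof.
move=> z0 sE.
pose A j := if j == i then E else [set w | S j w <= z].
have sA j : proc_sigma (X j) (A j).
  by rewrite /A; case: eqVneq => [->//|_]; exact: mS_ray.
have := indep sA; rewrite (_ : \bigcap_(j in _) A j = ray z `&` E); last first.
  apply/seteqP; split => w.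
  - move=> h; split; last by have := h i I; rewrite /A eqxx.
    by apply/(Y_le w z0) => j ji; have := h j I; rewrite /A (negPf ji).
  - move=> [/(Y_le w z0) h Ew] j _; rewrite /A; case: eqVneq => [//|ji]; exact: h.
move=> ->; congr EFin; rewrite (bigD1 i)//= {1}/A eqxx; congr (_ * _).
rewrite (eq_bigr (fun=> power_cdf c (N - 1)^-1 z)); last first.
  move=> j ji; rewrite /A (negPf ji); have := rivals_law ji z.
  by move=> h; transitivity (fine (Fcdf N x0 z)%:E) => //; congr fine.
rewrite prodr_const; congr (_ ^+ _).
by rewrite cardC1 card_ord.
Qed.

(** Raising the common cdf to the power [n - 1] multiplies its exponent, and [N1E] reduces
    [(n - 1) / (N - 1)] to [1 / (1 + K)]. *)
Let rival_max_law z : P (ray z) = (power_cdf c (1 + K)^-1 z)%:E.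
Proof.
case: (ltP z 0) => z0; first by rewrite ray_neg// measure0 /power_cdf z0.
have sT : proc_sigma (X i) setT by exact: (@measurableT _ (T_ i)).
have := rays_indep z0 sT; rewrite setIT => ->; congr EFin.
rewrite probability_setT mul1r /power_cdf ltNge z0/=.
have zc0 : 0 <= z / c by rewrite divr_ge0// ltW.
have [h|h] := leP 1 (z / c).
  by rewrite !min_r ?expr1n// powR_ge1 ?invr_ge0 ?(ltW contest_N1) ?(ltW K1).
rewrite !min_l ?powR_le1 ?zc0 ?invr_ge0 ?(ltW contest_N1) ?(ltW K1) ?(ltW h)//.
rewrite -powR_mulrn ?powR_ge0// -powRrM; congr (_ `^ _).
have -> : n.-1%:R = n%:R - 1 :> R.
  by rewrite -subn1 natrB// (leq_trans _ n2).
by rewrite N1E invfM mulrC mulrA divff ?mul1r// gt_eqF.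
Qed.

Let mrayY z : measurable (ray z).
Proof.
case: (ltP z 0) => z0; first by rewrite ray_neg.
rewrite (_ : ray z = \bigcap_(j in [set j | j != i]) [set w | S j w <= z]).
  apply: fin_bigcap_measurable => [|j _]; first exact: finite_finset.
   by apply: (@to_measurable j); apply: mS_ray.
by apply/seteqP; split => w /=; [move/(Y_le w z0)|move=> h; apply/(Y_le w z0)].
Qed.

Let gY := [set A | exists z, A = ray z].

Let mY_gen : measurable_fun setT (Y : g_sigma_algebraType gY -> R).
Proof.
apply: (measurability _ (RGenOInfty.measurableE R)) => // _ [_ [z ->] <-].
rewrite setTI (_ : _ @^-1` _ = ~` ray z).
  by apply: measurableC; apply: sub_sigma_algebra; exists z.
by apply/seteqP; split => w /=; rewrite in_itv/= andbT ltNge => /negP.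
Qed.

(** The rays form a pi-system generating the events of [Y], so the product rule extends from
    them. *)
Let Y_indep E C : proc_sigma (X i) E -> measurable C ->
  measurable (Y @^-1` C) /\ P (Y @^-1` C `&` E) = (P (Y @^-1` C) * P E)%E.
Proof.
move=> sE mC; apply: (@indep_gen _ _ _ P gY E).
- move=> _ _ [z ->] [z' ->]; exists (Num.min z z'); rewrite /ray; apply/seteqP; split => w /=.
    by move=> [h h']; rewrite le_min h.
  by rewrite le_min => /andP.
- by move=> _ [z ->].
- exact: to_measurable sE.
- move=> _ [z ->]; case: (ltP z 0) => z0; first by rewrite ray_neg// set0I measure0 mul0e.
  rewrite rays_indep//.
  have sT : proc_sigma (X i) setT by exact: (@measurableT _ (T_ i)).
  have := rays_indep z0 sT; rewrite setIT probability_setT mul1r => ->.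
  by rewrite mulrC EFinM fineK// fin_num_measure//; exact: to_measurable sE.
- by have := mY_gen measurableT mC; rewrite setTI.
Qed.

Let mY : measurable_fun setT Y.
Proof.
move=> _ C mC; rewrite setTI.
have sT : proc_sigma (X i) setT by exact: (@measurableT _ (T_ i)).
by have [] := Y_indep sT mC.
Qed.

Let mX : measurable_fun setT (S i). Proof. exact: to_measurable_fun (@mS i). Qed.
Let mMT : measurable_fun setT M. Proof. exact: to_measurable_fun mM. Qed.

Let Y_indep_rv d' (U : measurableType d') (f : T -> U) :
  measurable_fun setT (f : T_ i -> U) -> indep_rv P Y f /\ indep_rv P f Y.
Proof.
move=> mf; split => C E mC mE.
  have sE : proc_sigma (X i) (f @^-1` E) by have := mf measurableT E mE; rewrite setTI.
  by have [] := Y_indep sE mC.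
have sC : proc_sigma (X i) (f @^-1` C) by have := mf measurableT C mC; rewrite setTI.
by have [_ e] := Y_indep sC mE; rewrite setIC e muleC.
Qed.

Let K1V : 0 < (1 + K)^-1. Proof. by rewrite invr_gt0. Qed.
Let Yatom z : P [set w | Y w = z] = 0%E.
Proof. exact: (power_law_atomless c0 K1V mY rival_max_law). Qed.

Lemma no_tie : P [set w | Y w = S i w] = 0%E.
Proof.
have [_ ind] := Y_indep_rv (@mS i).
pose E := [set z : R * R | z.2 = z.1].
have mE : measurable E.
  rewrite (_ : E = setT `&` [set z : R * R | (z.2)%:E = (z.1)%:E]).
    by apply: measurable_eqe => //; apply/measurable_EFinP.
  by rewrite setTI; apply/seteqP; split => z /=; [move=> ->|case].
have := indep_prob mX mY ind mE; rewrite /E/= => ->.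
by apply: integral0_eq => w _; exact: Yatom.
Qed.

(** With [M] frozen by independence, the atomless [Y] meets it with probability 0. Hence strict and
    weak comparison of [Y] with [M] give the same regret probability. *)
Lemma no_max_tie : P [set w | (Y w)%:E = M w] = 0%E.
Proof.
have [_ ind] := Y_indep_rv mM.
pose E := [set z : \bar R * R | (z.2)%:E = z.1].
have mE : measurable E.
  rewrite -[E]setTI; apply: measurable_eqe => //.
  by apply/measurable_EFinP.
have := indep_prob mMT mY ind mE; rewrite /E/= => ->.
apply: integral0_eq => w _; case: (M w) => [z| |].
- by rewrite -(Yatom z); congr (P _); apply/seteqP; split => w' /=; [case|move=> ->].
- by rewrite (_ : [set w' | _] = set0) ?measure0//; apply/seteqP; split.
- by rewrite (_ : [set w' | _] = set0) ?measure0//; apply/seteqP; split.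
Qed.

Lemma win_prob : P [set w | Y w <= S i w] = (\int[P]_w (power_cdf c (1 + K)^-1 (S i w))%:E)%E.
Proof.
have [_ ind] := Y_indep_rv (@mS i).
pose E := [set z : R * R | z.2 <= z.1].
have mE : measurable E.
  rewrite (_ : E = setT `&` [set z : R * R | ((z.2)%:E <= (z.1)%:E)%E]).
    by apply: measurable_lee => //; apply/measurable_EFinP.
  by rewrite setTI; apply/seteqP; split => z /=; rewrite lee_fin.
have := indep_prob mX mY ind mE; rewrite /E/= => ->.
by apply: eq_integral => w _; exact: rival_max_law.
Qed.

Let f (z : T * T) : \bar R := (if S i z.2 < Y z.1 then S i z.2 * Y z.1 `^ (-1) else 0)%:E.

Let mf : measurable_fun setT f.
Proof.
have m1 : measurable_fun setT (fun z : T * T => Y z.1) by apply: measurableT_comp.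
have m2 : measurable_fun setT (fun z : T * T => S i z.2) by apply: measurableT_comp.
apply/measurable_EFinP; apply: measurable_fun_ifT => //; first exact: measurable_fun_ltr.
apply: measurable_funM => //.
exact: (measurableT_comp (@measurable_powR R (-1)) m1).
Qed.

Let f0 z : (0 <= f z)%E.
Proof. by rewrite lee_fin; case: ifP => // _; rewrite mulr_ge0 ?powR_ge0. Qed.

Let fE w w' : f (w, w') = (if (S i w' < Y w)%R then (S i w' / Y w)%R else 0%R)%:E.
Proof. by rewrite /f/= powR_inv1. Qed.

(** [hitting_identity] averages over the own path at a fixed level, so [Y] is frozen first and taken
    as the level. Tonelli's theorem then exchanges the integrals, because [power_law_balance]
    averages over [Y] at a fixed own value. *)
Lemma regret_prob : P [set w | (S i w < Y w)%R /\ ((Y w)%:E <= M w)%E] =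
  (\int[P]_w \int[P]_w' (if (S i w < Y w')%R then (S i w / Y w')%R else 0%R)%:E)%E.
Proof.
have mZ : measurable_fun setT ((fun w => (S i w, M w)) : T_ i -> R * \bar R).
  exact: measurable_fun_pair.
have [ind _] := Y_indep_rv mZ.
pose E := [set z : R * (R * \bar R) | z.2.1 < z.1 /\ ((z.1)%:E <= z.2.2)%E].
have mE : measurable E.
  rewrite (_ : E = (setT `&` [set z : R * (R * \bar R) | ((z.2.1)%:E < (z.1)%:E)%E]) `&`
                   (setT `&` [set z : R * (R * \bar R) | ((z.1)%:E <= z.2.2)%E])); last first.
    by rewrite !setTI; apply/seteqP; split => z /=; rewrite lte_fin.
  apply: measurableI.
  - apply: measurable_lte => //; apply/measurable_EFinP => //.
    by apply: measurableT_comp => //.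
  - apply: measurable_lee => //; first exact/measurable_EFinP.
    by apply: measurableT_comp => //.
have := indep_prob mY (to_measurable_fun mZ) ind mE; rewrite /E/= => ->.
transitivity (\int[P]_w \int[P]_w' f (w, w'))%E; last first.
  rewrite fubini_tonelli//.
  by apply: eq_integral => w _; apply: eq_integral => w' _; rewrite fE.
apply: eq_integral => w _.
(* [hitting_identity] needs a positive level; at level 0 both sides vanish since [S i] is
   nonnegative. *)
have := Y_ge0 w; rewrite le_eqVlt => /predU1P[e|Yw0].
  rewrite integral0_eq; last by move=> w' _; rewrite fE -e ltNge S_ge0.
  rewrite (_ : [set w' | _] = set0) ?measure0//; apply/seteqP; split => w' //=.
  by rewrite -e ltNge S_ge0 => -[].
have [B [HB HXB]] := HX i.
have := hitting_identity x00 HB HXB (Ht i) Yw0 => h.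
have mg : measurable_fun setT (fun w' => (if S i w' < Y w then S i w' else 0)%:E).
  by apply/measurable_EFinP; apply: measurable_fun_ifT => //; exact: measurable_fun_ltr.
transitivity (((Y w)^-1)%:E * \int[P]_w' (if (S i w' < Y w)%R then S i w' else 0%R)%:E)%E.
  by rewrite -h muleA -EFinM mulVf ?gt_eqF// mul1e.
rewrite -ge0_integralZl//; last 2 first.
- by move=> w' _; rewrite lee_fin; case: ifP.
- by rewrite lee_fin invr_ge0 ltW.
apply: eq_integral => w' _; rewrite fE -EFinM; congr EFin.
by case: ifP => _; rewrite ?mulr0// mulrC.
Qed.

(** [power_law_balance] at exponent [(1 + K)^-1], integrated over the law of the own stopped
    value. *)
Lemma contest_value : (P [set w | (Y w <= S i w)%R] =
  \int[P]_w (Num.min (S i w / c)%R 1%R)%:E +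
    K%:E * P [set w | (S i w < Y w)%R /\ ((Y w)%:E <= M w)%E])%E.
Proof.
rewrite win_prob regret_prob.
have KE : ((1 + K)^-1)^-1 - 1 = K by rewrite invrK addrC addKr.
have K1le : (1 + K)^-1 <= 1 by rewrite invf_le1// lerDl.
pose g w : \bar R := (\int[P]_w' (if (S i w < Y w')%R then (S i w / Y w')%R else 0%R)%:E)%E.
have g0 w : (0 <= g w)%E.
  by apply: integral_ge0 => w' _; rewrite lee_fin; case: ifP => // _; rewrite divr_ge0.
have mg : measurable_fun setT g.
  rewrite (_ : g = fubini_G P f); first exact: measurable_fun_fubini_tonelli_G.
  by apply/funext => w; apply: eq_integral => w' _; rewrite fE.
have mmin : measurable_fun setT (fun w => (Num.min (S i w / c) 1)%:E).
  by apply/measurable_EFinP/measurable_minr => //; exact: measurable_funM.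
transitivity (\int[P]_w ((Num.min (S i w / c)%R 1%R)%:E + K%:E * g w))%E.
  apply: eq_integral => w _.
  by rewrite (power_law_balance c0 K1V mY rival_max_law (S_ge0 i w) K1le) KE.
rewrite ge0_integralD//; last 3 first.
- by move=> w _; rewrite lee_fin le_min ler01 andbT divr_ge0// ltW.
- by move=> w _; rewrite mule_ge0// lee_fin.
- exact: measurable_funeM.
by rewrite ge0_integralZl// lee_fin.
Qed.

Let indicator_integral (A C : set T) (p q : T -> bool) : measurable A -> measurable C ->
  (forall w, p w <-> A w) -> (forall w, q w <-> C w) ->
  (\int[P]_w ((if p w then 1 else 0) - K * (if q w then 1 else 0))%:E = P A - K%:E * P C)%E.
Proof.
move=> mA mC pA qC; transitivity (\int[P]_w (1 * \1_A w + (- K) * \1_C w)%:E)%E.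
  apply: eq_integral => w _; rewrite !indicE mul1r mulNr.
  have -> : p w = (w \in A) by apply/idP/idP; rewrite inE => /pA.
  have -> : q w = (w \in C) by apply/idP/idP; rewrite inE => /qC.
  by case: (w \in A); case: (w \in C).
by rewrite integral_two_indic// mul1e EFinN mulNe.
Qed.

Let regret := [set w | (S i w < Y w)%R /\ ((Y w)%:E <= M w)%E].

Let mregret : measurable regret.
Proof.
rewrite (_ : regret = (setT `&` [set w | ((S i w)%:E < (Y w)%:E)%E]) `&`
    (setT `&` [set w | ((Y w)%:E <= M w)%E])).
  apply: measurableI.
    by apply: measurable_lte => //; apply/measurable_EFinP.
  by apply: measurable_lee => //; apply/measurable_EFinP.
by rewrite !setTI; apply/seteqP; split => w /=; rewrite lte_fin.
Qed.

Let capped_mean := (\int[P]_w (Num.min (S i w / c)%R 1%R)%:E)%E.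

Let net_value : (P [set w | (Y w <= S i w)%R] - K%:E * P regret = capped_mean)%E.
Proof.
rewrite contest_value -/regret; set q := (K%:E * _)%E.
have qfin : q \is a fin_num by rewrite fin_numM// fin_num_measure.
by rewrite addeK.
Qed.

(** The favourable payoff bound, [no_max_tie] and [contest_value] bound the payoff by the mean of
    [min(S i / c, 1)]; dropping the cap leaves the mean of [S i / c], at most [x0 / c = 1 / N]. *)
Lemma expected_payoff_le : (expected_payoff P K K2 X tau i <= N^-1%:E)%E.
Proof.
have mwin : measurable [set w | (Y w <= S i w)%R].
  rewrite (_ : [set w | _] = setT `&` [set w | ((Y w)%:E <= (S i w)%:E)%E]).
    by apply: measurable_lee => //; apply/measurable_EFinP.
  by rewrite setTI; apply/seteqP; split => w /=; rewrite lee_fin.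
pose C := [set w | (S i w < Y w)%R /\ ((Y w)%:E < M w)%E].
have mC : measurable C.
  rewrite (_ : C = (setT `&` [set w | ((S i w)%:E < (Y w)%:E)%E]) `&`
      (setT `&` [set w | ((Y w)%:E < M w)%E])).
    apply: measurableI.
      by apply: measurable_lte => //; apply/measurable_EFinP.
    by apply: measurable_lte => //; apply/measurable_EFinP.
  by rewrite !setTI; apply/seteqP; split => w /=; rewrite lte_fin.
have mtie : measurable [set w | (Y w)%:E = M w].
  rewrite -[X in measurable X]setTI; apply: measurable_eqe => //.
  by apply/measurable_EFinP.
have PC : P regret = P C.
  apply/eqP; rewrite eq_le; apply/andP; split.
  - apply: (@le_trans _ _ (P (C `|` [set w | (Y w)%:E = M w]))).
      apply: le_measure; rewrite ?inE//; first exact: measurableU.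
      move=> w [h]; rewrite le_eqVlt => /predU1P[e|h']; [by right|by left].
    apply: (le_trans (measureU2 _ mC mtie)).
    by rewrite -[leRHS]adde0 leeD2l//; rewrite -no_max_tie.
  - apply: le_measure; rewrite ?inE// => w [h h']; split => //; exact: ltW.
apply: (@le_trans _ _ capped_mean).
  rewrite -net_value PC -(@indicator_integral _ _ (fun w => Y w <= S i w)
    (fun w => (S i w < Y w) && ((Y w)%:E < M w)%E))//; last first.
    by move=> w; split => [/andP|/andP].
  apply: le_integralT => w; rewrite lee_fin.
  by have := @payoff_le R n K K2 i (S^~ w) (M w); apply.
have [B [HB HXB]] := HX i.
apply: (@le_trans _ _ (\int[P]_w ((c^-1)%:E * (S i w)%:E))%E).
  apply: le_integralT => w; rewrite -EFinM lee_fin ge_min mulrC lexx//.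
rewrite ge0_integralZl//; last 3 first.
- exact/measurable_EFinP.
- by move=> w _; rewrite lee_fin.
- by rewrite lee_fin invr_ge0 ltW.
apply: (@le_trans _ _ ((c^-1)%:E * x0%:E)%E).
  rewrite lee_wpmul2l ?lee_fin ?invr_ge0 ?(ltW c0)//.
  exact: (stopped_mean_le x00 HB HXB).
by rewrite -EFinM lee_fin /c invfM mulrAC -mulrA divff ?mulr1// gt_eqF.
Qed.

(** The same chain with the unfavourable bound and [no_tie]. The capped mean is computed from the
    law [F] by [power_law_mean], without a martingale equality for [tau i]. *)
Lemma expected_payoff_ge : has_law P (X i) (tau i) (Fcdf N x0) ->
  (N^-1%:E <= expected_payoff P K K2 X tau i)%E.
Proof.
move=> law_i.
have NV : 0 < (N - 1)^-1 by rewrite invr_gt0 contest_N1.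
have := power_law_mean c0 NV mX law_i; rewrite invrK subrK => <-.
have mwin : measurable [set w | (Y w < S i w)%R].
  rewrite (_ : [set w | _] = setT `&` [set w | ((Y w)%:E < (S i w)%:E)%E]).
    by apply: measurable_lte => //; apply/measurable_EFinP.
  by rewrite setTI; apply/seteqP; split => w /=; rewrite lte_fin.
have mtie : measurable [set w | Y w = S i w].
  rewrite (_ : [set w | _] = setT `&` [set w | (Y w)%:E = (S i w)%:E]).
    by apply: measurable_eqe => //; apply/measurable_EFinP.
  by rewrite setTI; apply/seteqP; split => w /=; [move=> ->|case].
have PW : (P [set w | (Y w <= S i w)%R] <= P [set w | (Y w < S i w)%R])%E.
  apply: (@le_trans _ _ (P ([set w | (Y w < S i w)%R] `|` [set w | Y w = S i w]))).
    rewrite (_ : [set w | (Y w <= S i w)%R] = [set w | (Y w < S i w)%R] `|` [set w | Y w = S i w])//.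
    apply/seteqP; split => w /=; first by rewrite le_eqVlt => /predU1P[]; [right|left].
    by case => [/ltW//|->].
  apply: (le_trans (measureU2 _ mwin mtie)).
  by rewrite -[leRHS]adde0 leeD2l//; rewrite -no_tie.
rewrite -/capped_mean -net_value.
apply: (@le_trans _ _ (P [set w | (Y w < S i w)%R] - K%:E * P regret)%E).
  by rewrite leeD2r.
rewrite -(@indicator_integral _ _ (fun w => Y w < S i w)
    (fun w => (S i w < Y w) && ((Y w)%:E <= M w)%E))//; last first.
  by move=> w; split => [/andP|/andP].
apply: le_integralT => w; rewrite lee_fin.
by have := @payoff_ge R n K K2 i (S^~ w) (M w); apply.
Qed.

End profile.

End game.

Theorem theorem3 (R : realType) (d : measure_display) (T : measurableType d)
  (P : probability T R) (n : nat) (x0 K K2 : R)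
  (X : 'I_n -> R -> T -> R) :
  (2 <= n)%N -> 0 < x0 -> 0 <= K -> 0 <= K2 -> K2 <= K ->
  (forall i, absorbed_BM P x0 (X i)) ->
  indep_family P (fun i => proc_sigma (X i)) ->
  let N := n%:R + K * (n%:R - 1) in
  (exists tau : 'I_n -> T -> \bar R,
     forall i, admissible (X i) (tau i) /\
               has_law P (X i) (tau i) (Fcdf N x0)) /\
  (forall tau : 'I_n -> T -> \bar R,
     (forall j, admissible (X j) (tau j) /\
                has_law P (X j) (tau j) (Fcdf N x0)) ->
     forall (i : 'I_n) (sigma : T -> \bar R), admissible (X i) sigma ->
       (expected_payoff P K K2 X (fun j => if j == i then sigma else tau j) i
        <= expected_payoff P K K2 X tau i)%E).
Proof.
move=> n2 x00 K0 K20 K2K HX indep N.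
have N1 : 1 < N by rewrite -subr_gt0; exact: contest_N1.
split.
  exists (fun i => drawup_stop N (X i)) => i; have [B [HB HXB]] := HX i.
  split; first exact: (drawup_admissible x00 N1 HB HXB).
  exact: (drawup_law x00 N1 HB HXB).
move=> tau Htau i sigma Hsigma.
(* The value [1 / N] separates the two sides: no deviation earns more, and stopping with law [F]
   earns at least that. *)
apply: (@le_trans _ _ N^-1%:E).
- apply: (expected_payoff_le (x0 := x0)) => //.
  + by move=> j; case: (eqVneq j i) => [->//|_]; case: (Htau j).
  + by move=> j ji; rewrite (negPf ji); case: (Htau j).
- apply: (expected_payoff_ge (x0 := x0)) => //.
  + by move=> j; case: (Htau j).
  + by move=> j _; case: (Htau j).
  + by case: (Htau i).
Qed.
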